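(* Let $\mathcal L=-\operatorname{div}(A\nabla+B_1)+B_2\cdot\nabla$ satisfy Hypothesis A. Let either $u(x,t)=\partial_t\mathcal S_t^{\mathcal L}f(x)$ for some $f\in C_c^\infty(\mathbb R^n)$, or $u(x,t)=\mathcal D_t^{\mathcal L,+}f(x)$ for some $f\in C_c^\infty(\mathbb R^n)$. There exist $m_6\in\mathbb N$ and $\varepsilon_6>0$ such that if $m\ge m_6$ and $p\in(2-\varepsilon_6,2+\varepsilon_6)$, then for every $0<q<p$, $$\|\widetilde N_q(t^m\partial_t^mu)\|_{L^{p,\infty}(\mathbb R^n)}\lesssim\|\mathbb S(t^{m+1}\partial_t^m\nabla u)\|_{L^p(\mathbb R^n)}+\|\mathbb V(t\nabla u)\|_{L^p(\mathbb R^n)},$$ with implicit constants depending on $p,m,n$ and ellipticity.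
   Context: Notation. $n\ge3$; points of $\mathbb R^{n+1}$ are $(x,t)$; $\mathbb R^{n+1}_+=\{t>0\}$; $\nabla=(\nabla_\|,\partial_t)$. $L^{p,\infty}$ is weak $L^p$. For $F$ on $\mathbb R^{n+1}_+$: $\Gamma(x)=\{(y,t)\in\mathbb R^{n+1}_+:|x-y|<t\}$, $\mathbb SF(x)=(\iint_{\Gamma(x)}|F(y,t)|^2\frac{dydt}{t^{n+1}})^{1/2}$, $\mathbb VF(x)=(\int_0^\infty|F(x,t)|^2\frac{dt}t)^{1/2}$, $\mathcal C_{x,t}=\{(y,s):|x-y|<t/8,|t-s|<t/8\}$, $\widetilde N_qF(x)=\sup_{(y,t)\in\Gamma(x)}(|\mathcal C_{y,t}|^{-1}\iint_{\mathcal C_{y,t}}|F|^q)^{1/q}$. Layer potentials. $Y^{1,2}(\mathbb R^{n+1})=\{u\in L^{2(n+1)/(n-1)}:\nabla u\in L^2\}$; $B_{\mathcal L}[u,v]=\iint_{\mathbb R^{n+1}}(A\nabla u\cdot\overline{\nabla v}+uB_1\cdot\overline{\nabla v}+\overline vB_2\cdot\nabla u)$; $\mathcal L:Y^{1,2}(\mathbb R^{n+1})\to Y^{1,2}(\mathbb R^{n+1})^*$ is the induced operator (an isomorphism when $B_{\mathcal L}$ is coercive). For $f\in C_c^\infty(\mathbb R^n)$, $\mathcal S^{\mathcal L}f$ is the unique $u\in Y^{1,2}(\mathbb R^{n+1})$ with $B_{\mathcal L}[u,v]=\int f\,\overline{v(\cdot,0)}$ for all $v$; $\mathcal D^{\mathcal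 L,+}f=-\Phi|_{\mathbb R^{n+1}_+}+\mathcal L^{-1}(F^+_\Phi)|_{\mathbb R^{n+1}_+}$ with $\Phi\in Y^{1,2}(\mathbb R^{n+1})$ any extension of $f$ and $\langle F_\Phi^+,G\rangle=\iint_{\mathbb R^{n+1}_+}(A\nabla\Phi\cdot\overline{\nabla G}+B_1\Phi\cdot\overline{\nabla G}+B_2\cdot\nabla\Phi\,\overline G)$. A subscript $t$ denotes the slice at height $t$. Hypothesis A. $A=A(x)$ is a $t$-independent complex $(n+1)\times(n+1)$ matrix with $\lambda|\xi|^2\le\operatorname{Re}(A(x)\xi\cdot\overline\xi)$ and $|A(x)\xi\cdot\overline\zeta|\le\lambda^{-1}|\xi||\zeta|$ for a.e. $x$ and all $\xi,\zeta\in\mathbb C^{n+1}$, for some $\lambda>0$; $B_1,B_2\in L^n(\mathbb R^n;\mathbb C^{n+1})$ are $t$-independent with $\max\{\|B_1\|_n,\|B_2\|_n\}<\tilde\rho_1$. Here $\tilde\rho_1=\tilde\rho_1(n,\lambda)>0$ is a fixed constant (known to exist) such that this smallness implies that $B_{\mathcal L}$ is bounded and coercive on $Y^{1,2}(\mathbb R^{n+1})$ and, for $f\in C_c^\infty(\mathbb R^n)$ and integers $m\ge1$: $\iint_{\mathbb R^{n+1}_+}|t^m\partial_t^m\nabla\mathcal S_t^{\mathcal L}f|^2\frac{dxdt}t\le C_m\|f\|_2^2$; $\sup_{\tau>0}(\|\mathcal S_\tau^{\mathcal L}f\|_{L^{2n/(n-2)}}+\|(\nabla\mathcal S^{\mathcal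 L}f)(\cdot,\tau)\|_2)\le C\|f\|_2$; $\iint_{\mathbb R^{n+1}_+}|t^m\partial_t^{m-1}\nabla\mathcal D_t^{\mathcal L,+}f|^2\frac{dxdt}t\le C_m\|f\|_2^2$; $\sup_{\tau>0}\|\mathcal D_\tau^{\mathcal L,+}f\|_2\le C\|f\|_2$. ''Depends on ellipticity'' means depends only on $\lambda$ and $\tilde\rho_1$. *)

(* Defs.v *)
From HB Require Import structures.
From mathcomp Require Import all_boot all_order all_algebra.
From mathcomp Require Import complex.
From mathcomp Require Import all_classical all_reals all_analysis.

Set Implicit Arguments.
Unset Strict Implicit.
Unset Printing Implicit Defensive.
Import Order.TTheory GRing.Theory Num.Theory.
Import numFieldNormedType.Exports.

Local Open Scope classical_set_scope.
Local Open Scope ring_scope.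
Local Open Scope complex_scope.

(* The sigma-algebra of 'rV[R]_n is generated by the coordinates, i.e. it is
   the Borel one. *)
Section borel_rV.
Context {R : realType} {n : nat}.

Let coors : 'I_n -> 'rV[R]_n -> R := fun i x => x 0 i.

Let rV_set0 : g_sigma_preimage coors set0.
Proof. exact: sigma_algebra0. Qed.

Let rV_setC A : g_sigma_preimage coors A -> g_sigma_preimage coors (~` A).
Proof. exact: sigma_algebraC. Qed.

Let rV_bigcup (F : _^nat) : (forall i, g_sigma_preimage coors (F i)) ->
  g_sigma_preimage coors (\bigcup_i (F i)).
Proof. exact: sigma_algebra_bigcup. Qed.

HB.instance Definition _ := @isMeasurable.Build
  (measure_tuple_display default_measure_display)
  'rV[R]_n (g_sigma_preimage coors) rV_set0 rV_setC rV_bigcup.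

End borel_rV.

Lemma measurable_rV_coord (R : realType) n (i : 'I_n) :
  measurable_fun [set: 'rV[R]_n] (fun x : 'rV[R]_n => x 0 i).
Proof.
move=> _ Y mY; rewrite setTI; apply: sub_sigma_algebra => /=.
rewrite -bigcup_seq/=; exists i => /=; first by rewrite mem_index_enum.
by exists Y => //; rewrite setTI.
Qed.

Definition snoc_rV (R : realType) n (z : 'rV[R]_n * measurableTypeR R) :
    'rV[R]_n.+1 :=
  \row_(i < n.+1) if unlift ord_max i is Some j then z.1 0 j else z.2.

Lemma measurable_snoc_rV (R : realType) n :
  measurable_fun setT (@snoc_rV R n).
Proof.
pose coors (i : 'I_n.+1) (x : 'rV[R]_n.+1) := x 0 i.
apply: (@measurability _ _ _ _ setT (@snoc_rV R n)
  (\big[setU/set0]_(i < n.+1)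
    preimage_set_system setT (coors i) measurable)) => //.
rewrite -bigcup_mkord_ord => _ [_ [i lti [A mA <-]] <-].
rewrite !setTI.
pose j : 'I_n.+1 := inord i.
suff : measurable ((fun z => @snoc_rV R n z 0 j) @^-1` A) by [].
have [k jk|jn] := unliftP ord_max j.
  rewrite (_ : (fun z => _) = (fun x : 'rV[R]_n => x 0 k) \o fst); last first.
    by apply/funext => z; rewrite mxE jk liftK.
  rewrite -[X in measurable X]setTI.
  by apply: (measurableT_comp (measurable_rV_coord k)).
rewrite (_ : (fun z => _) = snd); last first.
  by apply/funext => z; rewrite mxE jn unlift_none.
by rewrite -[X in measurable X]setTI; exact: measurable_snd.
Qed.

Section snoc_measure.
Local Open Scope ereal_scope.
Context {R : realType} {n : nat} (m : {measure set 'rV[R]_n -> \bar R}).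

Definition snoc_measure : set 'rV[R]_n.+1 -> \bar R :=
  pushforward (m \x lebesgue_measure) (@snoc_rV R n).

Let snoc_measure0 : snoc_measure set0 = 0.
Proof. by rewrite /snoc_measure /pushforward preimage_set0 measure0. Qed.

Let snoc_measure_ge0 A : 0 <= snoc_measure A.
Proof. by rewrite /snoc_measure /pushforward; exact: measure_ge0. Qed.

Let snoc_measure_sigma_additive : semi_sigma_additive snoc_measure.
Proof.
move=> F mF tF mUF; rewrite /snoc_measure /pushforward preimage_bigcup.
have mpre A : measurable A -> measurable (@snoc_rV R n @^-1` A).
  by move=> mA; rewrite -[X in measurable X]setTI; exact: measurable_snoc_rV.
apply: measure_semi_sigma_additive.
- by move=> k; exact: mpre.
- apply/trivIsetP => /= i j _ _ ij; rewrite -preimage_setI.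
  by move/trivIsetP : tF => /(_ _ _ _ _ ij) ->//; rewrite preimage_set0.
- by rewrite -preimage_bigcup; exact: mpre.
Qed.

HB.instance Definition _ := isMeasure.Build _ _ _
  snoc_measure snoc_measure0 snoc_measure_ge0 snoc_measure_sigma_additive.

End snoc_measure.

Fixpoint lebesgue_rV (R : realType) n : {measure set 'rV[R]_n -> \bar R} :=
  if n is k.+1 then snoc_measure (lebesgue_rV R k) else dirac (0 : 'rV[R]_0).

Lemma lebesgue_rV_box (R : realType) n (a b : 'rV[R]_n) :
  (forall i, a 0 i <= b 0 i) ->
  lebesgue_rV R n [set x : 'rV[R]_n | forall i, a 0 i < x 0 i <= b 0 i] =
  (\prod_(i < n) (b 0 i - a 0 i))%:E.
Proof.
elim: n a b => [|n IHn] a b leab.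
  by rewrite big_ord0 /= diracE mem_set// => -[].
pose a' : 'rV[R]_n := \row_i a 0 (widen_ord (leqnSn n) i).
pose b' : 'rV[R]_n := \row_i b 0 (widen_ord (leqnSn n) i).
have wl i : widen_ord (leqnSn n) i = lift ord_max i :> 'I_n.+1.
  by apply: val_inj; rewrite /= /bump leqNgt ltn_ord.
transitivity ((lebesgue_rV R n \x lebesgue_measure)%E
    ([set x : 'rV[R]_n | forall i, a' 0 i < x 0 i <= b' 0 i] `*`
     `]a 0 ord_max, b 0 ord_max]%classic)).
  congr ((lebesgue_rV R n \x lebesgue_measure)%E _).
  apply/seteqP; split=> -[x t] /=.
    move=> H; split=> [i|].
      by have := H (lift ord_max i); rewrite !mxE liftK wl.
    by have := H ord_max; rewrite !mxE unlift_none /= in_itv.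
  move=> [H]; rewrite in_itv /= => Ht i; rewrite mxE.
  by case: unliftP => [j ->|-> //]; have := H j; rewrite !mxE wl.
rewrite product_measure1E//=; last first.
  rewrite (_ : [set x : 'rV[R]_n | _] = \bigcap_(i in [set: 'I_n])
     ((fun x : 'rV[R]_n => x 0 i) @^-1` `]a' 0 i, b' 0 i]%classic)).
    apply: fin_bigcap_measurable => // i _.
    by rewrite -[X in measurable X]setTI; exact: measurable_rV_coord.
  apply/seteqP; split=> x /= H i; first by move=> _; rewrite /= in_itv; exact: H.
  by have := H i I; rewrite /= in_itv.
rewrite IHn; last by move=> i; rewrite !mxE.
rewrite lebesgue_measure_itv/= lte_fin big_ord_recr/=.
case: ltgtP (leab ord_max) => // [ltab _|eab _].
  rewrite -EFinB -EFinM; congr (_ * _)%:E.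
  by apply: eq_bigr => i _; rewrite !mxE.
by rewrite eab subrr mulr0 mule0.
Qed.

Definition lebesgue_xt (R : realType) n :
    {measure set ('rV[R]_n * measurableTypeR R) -> \bar R} :=
  (lebesgue_rV R n \x lebesgue_measure)%E.

Section complex_vectors.
Context {R : realType}.

Definition cmod (z : R[i]) : R := Normc.normc z.

Definition vnorm {k} (v : 'cV[R[i]]_k) : R :=
  Num.sqrt (\sum_(i < k) cmod (v i 0) ^+ 2).

(* [a . b], bilinear: conjugations are always written explicitly. *)
Definition dot k (a b : 'cV[R[i]]_k) : R[i] := \sum_(i < k) a i 0 * b i 0.

Definition vconj k (v : 'cV[R[i]]_k) : 'cV[R[i]]_k := map_mx conjc v.

Definition enorm k (x : 'rV[R]_k) : R := Num.sqrt (\sum_(i < k) x 0 i ^+ 2).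

Definition cmeasurable d (T : measurableType d) (D : set T) (F : T -> R[i]) :=
  measurable_fun D (fun z => complex.Re (F z)) /\
  measurable_fun D (fun z => complex.Im (F z)).

Definition cintegral d (T : measurableType d)
    (mu : {measure set T -> \bar R}) (D : set T) (F : T -> R[i]) : R[i] :=
  Rintegral mu D (fun z => complex.Re (F z)) +i*
  Rintegral mu D (fun z => complex.Im (F z)).

End complex_vectors.

Section test_functions.
Context {R : realType} {V : normedModType R} {I : Type} (e : I -> V).

Fixpoint partials (alpha : seq I) (phi : V -> R) : V -> R :=
  if alpha is i :: alpha' then fun z => 'D_(e i) (partials alpha' phi) z
  else phi.

(* When [e] is a basis, this is C^infinity. *)
Definition smooth (phi : V -> R) := forall alpha : seq I,
  continuous (partials alpha phi) /\
  forall i z, derivable (partials alpha phi) z (e i).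

Definition test_function (U : set V) (phi : V -> R) :=
  smooth phi /\
  exists K : set V,
    [/\ compact K, K `<=` U & forall z, ~ K z -> phi z = 0].

Definition ctest_function (f : V -> R[i]) :=
  test_function setT (fun x => complex.Re (f x)) /\
  test_function setT (fun x => complex.Im (f x)).

End test_functions.

Section spacetime.
Context {R : realType} {n : nat}.

Local Notation C := R[i].
Local Notation pt := ('rV[R]_n * measurableTypeR R)%type.
Local Notation mux := (lebesgue_rV R n).
Local Notation muxt := (lebesgue_xt R n).

Definition upper : set pt := [set z | 0 < z.2].

Definition x_basis (i : 'I_n) : 'rV[R]_n := delta_mx 0 i.

(* The t-direction is the last one. *)
Definition xt_basis (i : 'I_n.+1) : 'rV[R]_n * R :=
  if unlift ord_max i is Some j then (delta_mx 0 j, 0) else (0, 1).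

Definition Cc_smooth (f : 'rV[R]_n -> C) := ctest_function x_basis f.

Definition loc_integrable (U : set pt) (F : pt -> C) :=
  cmeasurable U F /\
  forall K : set ('rV[R]_n * R), compact K -> K `<=` U ->
    (\int[muxt]_(z in K) (cmod (F z))%:E < +oo)%E.

(* [G] is the distributional derivative [d^alpha F] in the open set [U]. *)
Definition weak_deriv (U : set pt) (alpha : seq 'I_n.+1) (F G : pt -> C) :=
  [/\ loc_integrable U F, loc_integrable U G &
      forall phi : 'rV[R]_n * R -> R, test_function xt_basis U phi ->
        cintegral muxt U (fun z => F z * (partials xt_basis alpha phi z)%:C) =
        (-1) ^+ size alpha * cintegral muxt U (fun z => G z * (phi z)%:C)].

Definition weak_dt (U : set pt) (m : nat) (F G : pt -> C) :=
  weak_deriv U (nseq m ord_max) F G.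

Definition weak_dt_vec (U : set pt) (m : nat) (F G : pt -> 'cV[C]_n.+1) :=
  forall i, weak_dt U m (fun z => F z i 0) (fun z => G z i 0).

Definition weak_grad (U : set pt) (u : pt -> C) (du : pt -> 'cV[C]_n.+1) :=
  forall i, weak_deriv U [:: i] u (fun z => du z i 0).

(* [g] is the slice [F(., tau)] of [F]: the local L^2 limit of [F(., s)] as
   [s] tends to [tau], averaged over [|s - tau| < h] so that it does not depend
   on the representative of [F]. It is unique up to null sets; if
   [s |-> F(., s)] is continuous at [tau] with values in L^2_loc, it is the
   value of that map at [tau]. *)
Definition slice (F : pt -> C) (tau : R) (g : 'rV[R]_n -> C) :=
  cmeasurable setT g /\
  forall r : R, 0 < r ->
    ((h *+ 2)^-1%:E *
       \int[muxt]_(z in [set z : pt | enorm z.1 < r /\ `|z.2 - tau| < h]%R)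
         (cmod (F z - g z.1) ^+ 2)%:E)%E @[h --> 0^'+] --> 0%E.

Definition sobolev_exp : R := (2 * n.+1)%:R / (n - 1)%:R.

(* [u] is in Y^{1,2}(R^(n+1)), and [du] is its weak gradient. *)
Definition Y12 (u : pt -> C) (du : pt -> 'cV[C]_n.+1) :=
  [/\ cmeasurable setT u,
      ('N[muxt]_(sobolev_exp%:E)[EFin \o (cmod \o u)] < +oo)%E,
      weak_grad setT u du &
      ('N[muxt]_2%:E[EFin \o (vnorm \o du)] < +oo)%E].

Definition Y12_norm (u : pt -> C) (du : pt -> 'cV[C]_n.+1) : \bar R :=
  ('N[muxt]_(sobolev_exp%:E)[EFin \o (cmod \o u)] +
   'N[muxt]_2%:E[EFin \o (vnorm \o du)])%E.

Section operator.
Variables (A : 'rV[R]_n -> 'M[C]_n.+1) (B1 B2 : 'rV[R]_n -> 'cV[C]_n.+1).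

Definition form (D : set pt) (u : pt -> C) (du : pt -> 'cV[C]_n.+1)
    (v : pt -> C) (dv : pt -> 'cV[C]_n.+1) : C :=
  cintegral muxt D (fun z =>
    dot (A z.1 *m du z) (vconj (dv z)) +
    u z * dot (B1 z.1) (vconj (dv z)) +
    conjc (v z) * dot (B2 z.1) (du z)).

(* [s] is the single layer potential of [f], and [ds] its gradient. *)
Definition single_layer (f : 'rV[R]_n -> C)
    (s : pt -> C) (ds : pt -> 'cV[C]_n.+1) :=
  Y12 s ds /\
  forall v dv g, Y12 v dv -> slice v 0 g ->
    form setT s ds v dv = cintegral mux setT (fun x => f x * conjc (g x)).

(* [u] is the double layer potential of [f] in the upper half space; [w] is the
   inverse of the operator applied to the functional
   [G |-> form upper Phi dPhi G dG]. *)
Definition double_layer (f : 'rV[R]_n -> C) (u : pt -> C) :=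
  exists Phi dPhi w dw,
    [/\ Y12 Phi dPhi, slice Phi 0 f, Y12 w dw,
        forall v dv, Y12 v dv ->
          form setT w dw v dv = form upper Phi dPhi v dv &
        forall z, upper z -> u z = - Phi z + w z].

End operator.

Definition elliptic (lam : R) (A : 'rV[R]_n -> 'M[C]_n.+1) :=
  \forall x \ae mux, forall xi zeta : 'cV[C]_n.+1,
    lam * vnorm xi ^+ 2 <= complex.Re (dot (A x *m xi) (vconj xi)) /\
    cmod (dot (A x *m xi) (vconj zeta)) <= lam^-1 * vnorm xi * vnorm zeta.

Definition coefficients (lam rho : R) (A : 'rV[R]_n -> 'M[C]_n.+1)
    (B1 B2 : 'rV[R]_n -> 'cV[C]_n.+1) :=
  [/\ forall i j, cmeasurable setT (fun x => A x i j),
      forall i, cmeasurable setT (fun x => B1 x i 0),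
      forall i, cmeasurable setT (fun x => B2 x i 0),
      elliptic lam A &
      ('N[mux]_(n%:R%:E)[EFin \o (vnorm \o B1)] < rho%:E)%E /\
      ('N[mux]_(n%:R%:E)[EFin \o (vnorm \o B2)] < rho%:E)%E].

Definition form_bounded (M : R) A B1 B2 :=
  forall u du v dv, Y12 u du -> Y12 v dv ->
    ((cmod (form A B1 B2 setT u du v dv))%:E <=
     M%:E * Y12_norm u du * Y12_norm v dv)%E.

Definition form_coercive (c : R) A B1 B2 :=
  forall u du, Y12 u du ->
    (c%:E * (Y12_norm u du * Y12_norm u du) <=
     (complex.Re (form A B1 B2 setT u du u du))%:E)%E.

Definition L2norm (f : 'rV[R]_n -> C) : \bar R :=
  'N[mux]_2%:E[EFin \o (cmod \o f)].

Definition L2norm_vec (f : 'rV[R]_n -> 'cV[C]_n.+1) : \bar R :=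
  'N[mux]_2%:E[EFin \o (vnorm \o f)].

Definition square_energy (m : nat) (G : pt -> 'cV[C]_n.+1) : \bar R :=
  (\int[muxt]_(z in upper) ((z.2 ^+ m * vnorm (G z)) ^+ 2 / z.2)%:E)%E.

Definition slice_exp : R := (2 * n)%:R / (n - 2)%:R.

Definition single_layer_bounds (K : R) (Km : nat -> R) A B1 B2 :=
  forall f s ds, Cc_smooth f -> single_layer A B1 B2 f s ds ->
  (forall m, (1 <= m)%N -> exists2 G, weak_dt_vec upper m ds G &
     (square_energy m G <= (Km m)%:E * (L2norm f * L2norm f))%E) /\
  (forall tau : R, 0 < tau -> exists g, exists dg : 'rV[R]_n -> 'cV[C]_n.+1,
     [/\ slice s tau g,
         forall i, slice (fun z => ds z i 0) tau (fun x => dg x i 0) &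
         ('N[mux]_(slice_exp%:E)[EFin \o (cmod \o g)] +
          L2norm_vec dg <= K%:E * L2norm f)%E]).

Definition double_layer_bounds (K : R) (Km : nat -> R) A B1 B2 :=
  forall f u, Cc_smooth f -> double_layer A B1 B2 f u ->
  (exists2 du, weak_grad upper u du &
     forall m, (1 <= m)%N -> exists2 G, weak_dt_vec upper m.-1 du G &
       (square_energy m G <= (Km m)%:E * (L2norm f * L2norm f))%E) /\
  (forall tau : R, 0 < tau -> exists2 g, slice u tau g &
     (L2norm g <= K%:E * L2norm f)%E).

(* The constants are uniform over all operators with ellipticity [lam] and
   lower order terms smaller than [rho] in L^n. An estimate on a derivative or
   on a slice includes the existence of that derivative or slice; both are
   unique up to null sets. *)
Definition smallness_threshold (lam rho : R) :=
  exists M c K : R, exists Km : nat -> R,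
    0 < c /\
    forall A B1 B2, coefficients lam rho A B1 B2 ->
      [/\ form_bounded M A B1 B2, form_coercive c A B1 B2,
          single_layer_bounds K Km A B1 B2 &
          double_layer_bounds K Km A B1 B2].

Definition cone (x : 'rV[R]_n) : set pt :=
  [set z | 0 < z.2 /\ enorm (x - z.1) < z.2].

Definition whitney (z : pt) : set pt :=
  [set w | enorm (z.1 - w.1) < z.2 / 8 /\ `|z.2 - w.2| < z.2 / 8].

(* The square functions and the maximal function below take as argument the
   modulus of the function they are applied to. *)
Definition conical_square (F : pt -> R) (x : 'rV[R]_n) : \bar R :=
  ((\int[muxt]_(z in cone x) (F z ^+ 2 / z.2 ^+ n.+1)%:E) `^ 2^-1)%E.

Definition vertical_square (F : pt -> R) (x : 'rV[R]_n) : \bar R :=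
  ((\int[lebesgue_measure]_(t in [set t : R | 0 < t]%R)
      (F (x, t) ^+ 2 / t)%:E) `^ 2^-1)%E.

Definition nontangential_max (q : R) (F : pt -> R) (x : 'rV[R]_n) : \bar R :=
  ereal_sup [set
    (((fine (muxt (whitney z)))^-1%:E *
       \int[muxt]_(w in whitney z) (F w `^ q)%:E) `^ q^-1)%E | z in cone x].

Definition Lp_norm (p : R) (g : 'rV[R]_n -> \bar R) : \bar R :=
  'N[mux]_(p%:E)[g]%E.

Definition weak_Lp_norm (p : R) (g : 'rV[R]_n -> \bar R) : \bar R :=
  ereal_sup [set (s%:E * mux [set x | (s%:E < `|g x|)%E] `^ p^-1)%E
            | s in [set s : R | 0 < s]].

End spacetime.

(* Main.v *)
From HB Require Import structures.
Require Import Defs.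
From mathcomp Require Import all_boot all_order all_algebra.
From mathcomp Require Import complex.
From mathcomp Require Import all_classical all_reals all_analysis.
Import Order.TTheory GRing.Theory Num.Theory.
Import numFieldNormedType.Exports.
Local Open Scope classical_set_scope.
Local Open Scope ring_scope.
From mathcomp Require Import measurable_realfun ring lra.
Set Implicit Arguments.
Unset Strict Implicit.
Unset Printing Implicit Defensive.

(** Let [F], [g] and [H] stand for the weak derivatives dt^m u, dt u and
    dt^m grad u. In the upper half space they satisfy grad F = H and
    F = dt^(m - 1) g, and the estimate rests on these two relations. Write
    S and V for the conical and the vertical square function on the right.

    At a point (y, t), let B be a cylinder of size t around it and h a small
    multiple of t. Since grad F = H, shifting F by at most h changes it, in
    the mean square, by at most h^2 times the energy of H on B
    ([translation_ae], [translate_L2], [mean_oscillation]). Since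
    F = dt^(m - 1) g, the mean of F against a smooth kernel of size h becomes,
    after the derivatives have moved onto the kernel, at most h^(1 - m) times
    the mean of |g|. A function is its mean plus its oscillation, so F is
    bounded in L^2 of a smaller cylinder ([L2_bound]).

    The same oscillation bound at the scales h / 2^k improves the exponent:
    where F^2 exceeds a multiple of 2^(k (n + 1)) times its mean, the mean over
    a cell of size h / 2^k cannot account for it, so F^2 is there bounded by
    its oscillation at that scale, which carries the factor 4^-k. Summing over
    k bounds F in L^q for q <= 2 + 2 / (n + 1) ([self_improvement],
    [local_average]). Hence the choice eps6 = 2 / (n + 1), for which every
    q < p is below this exponent; the choice m6 = 1 is what the relation
    F = dt^(m - 1) g asks for.

    The cylinder B lies in the cones over the points x' close to y, so the
    energy of H on B is at most a multiple of S(x')^2 for all those x'; by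
    Cauchy-Schwarz on vertical segments, the integral of |g| over B is at most
    that of V over a disc. Therefore the average defining the nontangential
    maximal function at (y, t) is at most C t^-n times the integral of S + V
    over the disc |x' - y| < t ([nontangential_mean_le]).

    Finally the set where the maximal function exceeds s is a union of discs
    |x - y| < t for which t^n <= C s^-p times the integral of (S + V)^p over
    the cube of half-side t at y. A Vitali covering ([vitali_cubes]) bounds its
    measure by C s^-p times the whole integral of (S + V)^p
    ([weak_type_bound], [weak_Lp_bound]). *)

(** * Coordinates and boxes *)

Section spacetime_boxes.
Context {R : realType} {n : nat}.
Local Notation pt := ('rV[R]_n * measurableTypeR R)%type.
Local Notation muxt := (lebesgue_xt R n).

(** Coordinates are numbered by ['I_n.+1], time being [ord_max], so that space
    and time directions are treated alike. *)
Definition crd (i : 'I_n.+1) (z : pt) : R := snoc_rV z 0 i.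

(** Half-open, so that boxes form a pi-system of sets of known measure. *)
Definition box (a b : 'I_n.+1 -> R) : set pt :=
  [set z | forall i, a i < crd i z <= b i].

Definition vec (c : 'I_n.+1 -> R) : pt :=
  (\row_j c (lift ord_max j), c ord_max).

Lemma crdE i (z : pt) :
  crd i z = if unlift ord_max i is Some j then z.1 0 j else z.2.
Proof. by rewrite /crd mxE. Qed.

Lemma crd_lift j (z : pt) : crd (lift ord_max j) z = z.1 0 j.
Proof. by rewrite crdE liftK. Qed.

Lemma crd_max (z : pt) : crd ord_max z = z.2.
Proof. by rewrite crdE unlift_none. Qed.

Lemma crd_vec c i : crd i (vec c) = c i.
Proof. by rewrite crdE /vec; case: unliftP => [j ->|->] //=; rewrite mxE. Qed.

Lemma crdD i (z w : pt) : crd i (z + w : 'rV[R]_n * R) = crd i z + crd i w.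
Proof. by rewrite !crdE; case: unliftP => [j _|_] //=; rewrite mxE. Qed.

Lemma crd_inj (z w : pt) : (forall i, crd i z = crd i w) -> z = w.
Proof.
case: z w => [x t] [y s] zw; congr pair; last by have := zw ord_max; rewrite !crd_max.
by apply/rowP => j; have := zw (lift ord_max j); rewrite !crd_lift.
Qed.

Lemma measurable_crd i : measurable_fun setT (crd i).
Proof.
exact: (measurableT_comp (measurable_rV_coord i) (@measurable_snoc_rV R n)).
Qed.

Lemma measurable_box a b : measurable (box a b).
Proof.
rewrite (_ : box a b = \bigcap_(i in [set: 'I_n.+1]) (crd i @^-1` `]a i, b i]%classic)).
  apply: fin_bigcap_measurable => // i _.
  by rewrite -[X in measurable X]setTI; exact: measurable_crd.
apply/seteqP; split=> z /= H i; first by move=> _; rewrite /= in_itv; exact: H.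
by have := H i I; rewrite /= in_itv.
Qed.

Lemma muxt_box a b : (forall i, a i <= b i) ->
  muxt (box a b) = (\prod_(i < n.+1) (b i - a i))%:E.
Proof.
move=> ab; have := @lebesgue_rV_box R n.+1 (\row_i a i) (\row_i b i).
have lab i : (\row_i a i) 0 i <= (\row_i b i) 0 i by rewrite !mxE.
move=> /(_ lab) H; rewrite /lebesgue_xt.
transitivity (lebesgue_rV R n.+1 [set x : 'rV[R]_n.+1 | forall i,
    (\row_i a i) 0 i < x 0 i <= (\row_i b i) 0 i]).
  rewrite /=/snoc_measure/pushforward; congr ((_ \x _)%E _).
  by apply/seteqP; split=> z /= + i => /(_ i); rewrite !mxE /crd mxE.
by rewrite H; congr EFin; apply: eq_bigr => i _; rewrite !mxE.
Qed.

Definition boxes : set (set pt) := [set A | exists a b, A = box a b].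

Lemma box_setI a b c d : box a b `&` box c d =
  box (fun i => Num.max (a i) (c i)) (fun i => Num.min (b i) (d i)).
Proof.
apply/seteqP; split=> z /=.
  by move=> [zab zcd] i; have /andP[? ?] := zab i; have /andP[? ?] := zcd i; rewrite gt_max le_min; apply/andP; split; apply/andP.
by move=> H; split=> i; have := H i; rewrite gt_max le_min => /andP[/andP[? ?] /andP[? ?]]; apply/andP.
Qed.

Lemma boxes_setI : setI_closed boxes.
Proof.
by move=> _ _ [a [b ->]] [c [d ->]]; rewrite box_setI; do 2 eexists.
Qed.

Definition cube (k : nat) : set pt := box (fun=> - k%:R) (fun=> k%:R).

Lemma bigcup_cube : \bigcup_k cube k = setT.
Proof.
apply/seteqP; split=> // z _.
pose M := \sum_(i < n.+1) `|crd i z|.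
have M0 : 0 <= M by apply: sumr_ge0.
exists (Num.truncn M).+1 => // i /=.
have iM : `|crd i z| <= M by rewrite /M (bigD1 i)//= lerDl sumr_ge0.
have : `|crd i z| < (Num.truncn M).+1%:R by apply: le_lt_trans iM _; rewrite truncnS_gt.
by rewrite ltr_norml => /andP[-> /ltW].
Qed.

End spacetime_boxes.

(** * The measure of space-time *)

Lemma measurable_to_rV (R : realType) n d (T : measurableType d) (D : set T)
    (f : T -> 'rV[R]_n) :
  (forall i, measurable_fun D (fun z => f z 0 i)) -> measurable_fun D f.
Proof.
move=> mf mD; move: (mD); pose coors (i : 'I_n) (x : 'rV[R]_n) := x 0 i.
apply: (measurability (\big[setU/set0]_(i < n)
    preimage_set_system setT (coors i) measurable)) => //.
rewrite -bigcup_seq => _ [_ [i _ [A mA <-]] <-].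
by rewrite setTI; exact: mf.
Qed.

Lemma measurable_rV_box (R : realType) n (a b : 'rV[R]_n) :
  measurable [set x : 'rV[R]_n | forall i, a 0 i < x 0 i <= b 0 i].
Proof.
rewrite (_ : [set x : 'rV[R]_n | _] = \bigcap_(i in [set: 'I_n])
   ((fun x : 'rV[R]_n => x 0 i) @^-1` `]a 0 i, b 0 i]%classic)).
  apply: fin_bigcap_measurable => // i _.
  by rewrite -[X in measurable X]setTI; exact: measurable_rV_coord.
apply/seteqP; split=> x /= H i; first by move=> _; rewrite /= in_itv; exact: H.
by have := H i I; rewrite /= in_itv.
Qed.

Section spacetime_measure.
Context {R : realType} {n : nat}.
Local Notation pt := ('rV[R]_n * measurableTypeR R)%type.
Local Notation mux := (lebesgue_rV R n).
Local Notation muxt := (lebesgue_xt R n).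

Let crd_boxes i : measurable_fun [set: g_sigma_algebraType (@boxes R n)]
  (crd i : g_sigma_algebraType (@boxes R n) -> measurableTypeR R).
Proof.
apply: (measurability _ (RGenOInfty.measurableE R)) => _ [_ [x ->] <-].
rewrite setTI (_ : _ @^-1` _ = \bigcup_k
   (box (fun j => if j == i then x else - k%:R) (fun=> k%:R))).
  apply: bigcup_measurable => k _; apply: sub_sigma_algebra.
  by exists (fun j => if j == i then x else - k%:R), (fun=> k%:R).
apply/seteqP; split=> z /=.
  rewrite in_itv /= andbT => xz.
  have [k _ zk] : (\bigcup_k @cube R n k) z by rewrite bigcup_cube.
  exists k => // j /=; have /andP[zk1 zk2] := zk j.
  by case: eqP => [ji|_]; rewrite ?zk2 ?zk1 ?ji ?xz.
by move=> [k _ /(_ i)]; rewrite /= eqxx in_itv /= andbT => /andP[].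
Qed.

(** A half-space in one coordinate is a countable union of boxes. *)
Lemma measurable_ptE : @measurable _ pt = <<s @boxes R n >>.
Proof.
apply/seteqP; split; last first.
  apply: smallest_sub; first exact: sigma_algebra_measurable.
  by move=> _ [a [b ->]]; exact: measurable_box.
suff H : measurable_fun [set: g_sigma_algebraType (@boxes R n)]
    (id : g_sigma_algebraType (@boxes R n) -> pt).
  by move=> A mA; have := H measurableT A mA; rewrite setTI.
apply/measurable_fun_pairP; split; last first.
  rewrite (_ : _ \o _ = crd ord_max); last by apply/funext => z; rewrite crd_max.
  exact: crd_boxes.
apply: measurable_to_rV => i; rewrite (_ : (fun z => _) = crd (lift ord_max i)).
  exact: crd_boxes.
by apply/funext => z; rewrite crd_lift.
Qed.

Lemma measurable_to_pt d (T : measurableType d) (f : T -> pt) :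
  (forall i, measurable_fun setT (crd i \o f)) -> measurable_fun setT f.
Proof.
move=> mf; apply/measurable_fun_pairP; split.
  apply: measurable_to_rV => i; rewrite (_ : (fun z => _) = crd (lift ord_max i) \o f)//.
  by apply/funext => z /=; rewrite crd_lift.
rewrite (_ : _ \o _ = crd ord_max \o f); first exact: mf.
by apply/funext => z /=; rewrite crd_max.
Qed.

Lemma muxt_box_lty a b : (muxt (@box R n a b) < +oo)%E.
Proof.
have [ab|/existsNP[i /negP]] := pselect (forall i, a i <= b i).
  by rewrite muxt_box// ltry.
rewrite -ltNge => ba; rewrite (_ : box a b = set0) ?measure0//.
apply/seteqP; split=> // z /(_ i) /andP[az zb].
by have := lt_trans (lt_le_trans az zb) ba; rewrite ltxx.
Qed.

(** Measures finite on the pi-system of boxes are determined by it, since the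
    cubes exhaust the space. *)
Lemma muxt_eq (m1 m2 : {measure set pt -> \bar R}) :
  (forall a b, m1 (box a b) = m2 (box a b)) ->
  (forall a b, (m1 (box a b) < +oo)%E) ->
  forall A, measurable A -> m1 A = m2 A.
Proof.
move=> m12 m1oo; apply: (measure_unique (@boxes R n) (@cube R n)).
- exact: measurable_ptE.
- exact: boxes_setI.
- by move=> k; exists (fun=> - k%:R), (fun=> k%:R).
- exact: bigcup_cube.
- by move=> _ [a [b ->]].
- by move=> k; exact: m1oo.
Qed.

Definition translate (v z : pt) : pt := (z : 'rV[R]_n * R) + v.

Lemma crd_translate v i z : crd i (translate v z) = crd i z + crd i v.
Proof. exact: crdD. Qed.

Lemma measurable_translate v : measurable_fun setT (translate v).
Proof.
apply: measurable_to_pt => i.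
rewrite (_ : _ \o _ = (fun z => crd i z + crd i v)).
  by apply: measurable_funD => //; exact: measurable_crd.
by apply/funext => z /=; rewrite crd_translate.
Qed.

(** A translate of a box is a box with the same side lengths. *)
Lemma muxt_translate v A : measurable A -> muxt (translate v @^-1` A) = muxt A.
Proof.
move=> mA; apply/esym.
pose mp := isMeasurableFun.Build _ _ _ _ (translate v) (measurable_translate v).
pose p : {mfun pt >-> pt} := HB.pack (translate v) mp.
have H a b : muxt (box a b) = pushforward muxt p (box a b).
  rewrite /pushforward /=.
  rewrite (_ : _ @^-1` _ = box (fun i => a i - crd i v) (fun i => b i - crd i v)).
    have [ab|/existsNP[i /negP]] := pselect (forall i, a i <= b i).
      rewrite !muxt_box//; last by move=> i; rewrite lerD2r.
      by congr EFin; apply: eq_bigr => i _; rewrite opprB addrA subrK.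
    rewrite -ltNge => ba.
    have box0 c d : d i < c i -> box c d = set0 :> set pt.
      move=> dc; apply/seteqP; split=> // z /(_ i) /andP[az zb].
      by have := lt_trans (lt_le_trans az zb) dc; rewrite ltxx.
    by rewrite !box0// ltrD2r.
  apply/seteqP; split=> z /= + i => /(_ i); rewrite ?crd_translate ltrBlDr lerBrDr//.
have := @muxt_eq muxt (pushforward muxt p) H.
by apply => // a b; exact: muxt_box_lty.
Qed.

Lemma ge0_integral_translate v D (f : pt -> \bar R) : measurable D ->
  measurable_fun D f -> (forall z, D z -> 0 <= f z)%E ->
  (\int[muxt]_(z in D) f z = \int[muxt]_(z in translate v @^-1` D) f (translate v z))%E.
Proof.
move=> mD mf f0.
have f0' : {in D, forall y, (0 <= f y)%E} by move=> z; rewrite inE; exact: f0.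
pose mp := isMeasurableFun.Build _ _ _ _ (translate v) (measurable_translate v).
pose p : {mfun pt >-> pt} := HB.pack (translate v) mp.
rewrite (eq_measure_integral (pushforward muxt p)).
  exact: (@ge0_integral_pushforward _ _ pt pt R (translate v) (measurable_translate v) muxt D f mD mf f0').
move=> A mA _; apply/esym; exact: muxt_translate.
Qed.

End spacetime_measure.

Section sigma_finite.
Context {R : realType}.

Let sigma_finite_rV n : sigma_finite setT (lebesgue_rV R n).
Proof.
pose Q k := [set x : 'rV[R]_n | forall i, - k%:R < x 0 i <= k%:R].
exists Q => [|k].
  apply/seteqP; split=> // x _.
  have [k _ Hk] : (\bigcup_k @cube R n k) (x, 0) by rewrite bigcup_cube.
  by exists k => // i; have := Hk (lift ord_max i); rewrite crd_lift.
have le_k i : (const_mx (- k%:R) : 'rV[R]_n) 0 i <= (const_mx k%:R : 'rV[R]_n) 0 i.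
  by rewrite !mxE -subr_ge0 opprK addr_ge0.
rewrite (_ : Q k = [set x : 'rV[R]_n | forall i,
    (const_mx (- k%:R) : 'rV[R]_n) 0 i < x 0 i <= (const_mx k%:R : 'rV[R]_n) 0 i]).
  by split; [exact: measurable_rV_box|rewrite lebesgue_rV_box// ltry].
by apply/seteqP; split=> x /= + i => /(_ i); rewrite !mxE.
Qed.

(** A copy of the measure that carries its sigma-finiteness, which Tonelli's
    theorem expects in the type. *)
Definition slebesgue_rV n : set 'rV[R]_n -> \bar R := lebesgue_rV R n.

HB.instance Definition _ n := Measure.copy (@slebesgue_rV n) (lebesgue_rV R n).

HB.instance Definition _ n := Measure_isSigmaFinite.Build _ _ _
  (@slebesgue_rV n) (@sigma_finite_rV n).

Definition slebesgue_xt n : set ('rV[R]_n * measurableTypeR R)%type -> \bar R :=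
  lebesgue_xt R n.

HB.instance Definition _ n := Measure.copy (@slebesgue_xt n) (lebesgue_xt R n).

Let sigma_finite_xt n : sigma_finite setT (@slebesgue_xt n).
Proof.
exists (@cube R n); first by rewrite bigcup_cube.
by move=> k; split; [exact: measurable_box|exact: muxt_box_lty].
Qed.

HB.instance Definition _ n := Measure_isSigmaFinite.Build _ _ _
  (@slebesgue_xt n) (@sigma_finite_xt n).

End sigma_finite.

(** * Smooth bumps on the line *)

Section smooth_line.
Context {R : realType}.
Implicit Types (f g : R -> R) (P : {poly R}).

(** The derivative is exhibited rather than computed, which makes the class
    stable under sums, products and affine changes of variable by induction. *)
Fixpoint Ck (k : nat) f : Prop :=
  if k is k'.+1 then exists2 f' : R -> R, (forall x : R, is_derive x 1 f (f' x)) & Ck k' f'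
  else True.

Definition smooth1 f := forall k, Ck k f.

Lemma CkS k f : Ck k.+1 f -> Ck k f.
Proof.
elim: k f => // k IH f [f' df f'k]; exists f' => //; exact: IH.
Qed.

Lemma Ck_cst k (c : R) : Ck k (cst c).
Proof.
elim: k c => // k IH c; exists (cst 0) => // x; exact: is_derive_cst.
Qed.

Lemma CkD k f g : Ck k f -> Ck k g -> Ck k (f \+ g).
Proof.
elim: k f g => // k IH f g [f' df f'k] [g' dg g'k].
exists (f' \+ g'); last exact: IH.
by move=> x; exact: is_deriveD.
Qed.

Lemma CkM k f g : Ck k f -> Ck k g -> Ck k (f \* g).
Proof.
elim: k f g => // k IH f g fk gk.
have [f' df f'k] := fk; have [g' dg g'k] := gk.
exists ((f \* g') \+ (g \* f')).
  by move=> x; exact: is_deriveM.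
by apply: CkD; apply: IH => //; exact: CkS.
Qed.

Lemma Ck_affine k f (c d : R) : Ck k f -> Ck k (fun x => f (c * x + d)).
Proof.
elim: k f => // k IH f [f' df f'k].
exists (fun x => c * f' (c * x + d)); last first.
  by apply: (@CkM k (cst c)); [exact: Ck_cst|exact: IH].
move=> x.
have -> : (fun x => f (c * x + d)) = f \o (fun x => c * x + d) by [].
have dl : is_derive x 1 (fun x : R => c * x + d) c.
  have := is_deriveD (is_deriveZ c (is_derive_id x (1 : R))) (is_derive_cst d x 1).
  by rewrite addr0 scaler1.
have := @is_derive1_comp _ f (fun x => c * x + d) x _ _ (df (c * x + d)) dl.
by rewrite mulrC.
Qed.

Lemma smooth1_is_derive f (x : R) : smooth1 f -> is_derive x 1 f (derive1 f x).
Proof. by move=> /(_ 1%N)[f' df _]; apply: DeriveDef; rewrite ?derive1E. Qed.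

Lemma smooth1_derive1 f : smooth1 f -> smooth1 (derive1 f).
Proof.
move=> sf k; have [f' df f'k] := sf k.+1.
by rewrite (_ : derive1 f = f')//; apply/funext => x; rewrite derive1E; exact: derive_val.
Qed.

Lemma smooth1_derive1n k f : smooth1 f -> smooth1 (derive1n k f).
Proof.
elim: k f => // k IH f sf; rewrite derive1nS; exact/smooth1_derive1/IH.
Qed.

Lemma smooth1_continuous f : smooth1 f -> continuous f.
Proof.
move=> sf x; apply: differentiable_continuous; apply/derivable1_diffP.
exact: (smooth1_is_derive x sf).(@ex_derive _ _ _ _ _ _ _).
Qed.

(** The functions P(1/x) exp(-1/x), extended by 0 to x <= 0, form a class
    stable under differentiation; exp(-1/x) is the case P = 1. *)
Definition expinv P (x : R) : R := if 0 < x then P.[x^-1] * expR (- x^-1) else 0.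

(** With y = 1/x this is y^k exp(-y) <= k!; it yields the derivative at 0. *)
Lemma expinv_bound P : exists2 C : R, 0 <= C &
  forall x, `|expinv P x| <= C * `|x| ^+ 2.
Proof.
have powexp k (y : R) : 0 < y -> y ^+ k * expR (- y) <= k`!%:R.
  move=> y0; rewrite expRN ler_pdivrMr ?expR_gt0//.
  case: k => [|k].
    by rewrite expr0 fact0 mul1r (le_trans _ (expR_ge1Dx y))// lerDl ltW.
  have := expR_ge1Dxn k (ltW y0) => H.
  rewrite mulrC -ler_pdivrMr ?ltr0n ?fact_gt0//.
  by apply: le_trans H; rewrite lerDr.
exists (\sum_(i < size P) `|P`_i| * (i.+2)`!%:R).
  by apply: sumr_ge0 => i _; rewrite mulr_ge0.
move=> x; rewrite /expinv; case: ifPn => x0; last first.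
  by rewrite normr0 mulr_ge0 ?sumr_ge0// => i _; rewrite mulr_ge0.
have y0 : 0 < x^-1 by rewrite invr_gt0.
rewrite -ler_pdivrMr ?exprn_gt0 ?normr_gt0 ?gt_eqF//.
rewrite (gtr0_norm x0) -exprVn normrM (gtr0_norm (expR_gt0 _)).
set y := x^-1 in y0 *.
rewrite horner_coef.
apply: (@le_trans _ _ ((\sum_(i < size P) `|P`_i| * y ^+ i) * expR (- y) * y ^+ 2)).
  rewrite ler_wpM2r ?exprn_ge0 ?(ltW y0)// ler_wpM2r ?expR_ge0//.
  apply: le_trans (ler_norm_sum _ _ _) _; apply: ler_sum => i _.
  by rewrite normrM normrX (gtr0_norm y0).
rewrite !mulr_suml; apply: ler_sum => i _.
rewrite -!mulrA ler_wpM2l// (_ : _ * _ = y ^+ i.+2 * expR (- y)).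
  exact: powexp.
by rewrite !exprS; ring.
Qed.

Lemma is_derive_expinv P (x : R) :
  is_derive x 1 (expinv P) (expinv ('X^2 * (P - P^`())) x).
Proof.
have [x0|x0|->] := ltgtP x 0.
- rewrite /expinv [in X in is_derive _ _ _ X]ltNge (ltW x0) /=.
  apply: near_eq_is_derive (is_derive_cst 0 x 1).
  near=> z; rewrite ltNge (_ : z <= 0)//; near: z; exact: lt_le_nbhsl.
- rewrite [in X in is_derive _ _ _ X]/expinv x0.
  have dV : is_derive x 1 (fun y : R => y^-1) (- x ^- 2).
    have := @is_deriveV R id x 1 1 (lt0r_neq0 x0) (is_derive_id x 1).
    by rewrite [_ *: _]mulr1.
  have d1 := @is_derive1_comp _ _ _ _ _ _ (is_derive_poly P x^-1) dV.
  have d2 := @is_derive1_comp _ expR (fun y : R => - y^-1) x _ _ (is_derive_expR (- x^-1)) (is_deriveN dV).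
  have := is_deriveM d1 d2; rewrite opprK.
  set D := (X in is_derive x 1 _ X -> _) => dM.
  rewrite (_ : _ * _ = D).
    apply: near_eq_is_derive dM; near=> z; rewrite /expinv (_ : 0 < z)//.
    near: z; exact: lt_nbhsr.
  rewrite /D /GRing.scale /= hornerM hornerXn hornerD hornerN exprVn.
  ring.
- rewrite [in X in is_derive _ _ _ X]/expinv ltxx.
  have [C C0 HC] := expinv_bound P.
  have H : (h^-1 *: ((expinv P \o shift 0) (h *: 1) - expinv P 0)) @[h --> 0^'] --> 0.
    have E0 : expinv P 0 = 0 by rewrite /expinv ltxx.
    apply/cvgr0Pnorm_lt => e e0; near=> h => /=.
    rewrite E0 subr0.
    have h0 : h != 0 by near: h; exact: nbhs_dnbhs_neq.
    rewrite addr0 [h *: 1]mulr1 [_ *: _]mulrC normrM normfV.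
    rewrite ltr_pdivrMr ?normr_gt0//; apply: le_lt_trans (HC h) _.
    rewrite expr2 mulrA ltr_pM2r ?normr_gt0//.
    rewrite (@le_lt_trans _ _ ((C + 1) * `|h|))//.
      by rewrite ler_wpM2r// lerDl.
    rewrite mulrC -ltr_pdivlMr ?ltr_wpDl//.
    near: h; apply: dnbhs0_lt; rewrite divr_gt0// ltr_wpDl//.
  by apply: DeriveDef; [apply/cvg_ex; exists 0|apply/cvg_lim].
Unshelve. all: by end_near. Qed.

Lemma smooth1_expinv P : smooth1 (expinv P).
Proof.
move=> k; elim: k P => // k IH P; exists (expinv ('X^2 * (P - P^`()))) => //.
by move=> x; exact: is_derive_expinv.
Qed.

(** The factor [k.+1 ^+ 2] beats the distance [k.+1^-1] by which the support
    exceeds [b]: the limit is the indicator of the half-open interval. *)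
Definition bump (a b : R) (k : nat) (x : R) : R :=
  expinv 1 (k.+1%:R * (x - a)) * expinv 1 (k.+1%:R ^+ 2 * (b + k.+1%:R^-1 - x)).

Lemma expinv1E x : expinv 1 x = if 0 < x then expR (- x^-1) else 0.
Proof. by rewrite /expinv hornerC mul1r. Qed.

Lemma expinv1_ge0 x : 0 <= expinv 1 x.
Proof. by rewrite expinv1E; case: ifP => // _; exact: expR_ge0. Qed.

Lemma expinv1_le1 x : expinv 1 x <= 1.
Proof.
rewrite expinv1E; case: ifP => // x0.
by rewrite -expR0 ler_expR oppr_le0 invr_ge0 ltW.
Qed.

Lemma smooth1_bump a b k : smooth1 (bump a b k).
Proof.
move=> j; apply: (@CkM j (fun x => expinv 1 (k.+1%:R * (x - a)))
  (fun x => expinv 1 (k.+1%:R ^+ 2 * (b + k.+1%:R^-1 - x)))).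
  rewrite (_ : (fun x => _) = (fun x => expinv 1 (k.+1%:R * x + (- (k.+1%:R * a))))).
    by apply: Ck_affine; exact: smooth1_expinv.
  by apply/funext => x; rewrite mulrBr.
rewrite (_ : (fun x => _) = (fun x => expinv 1 (- k.+1%:R ^+ 2 * x +
    k.+1%:R ^+ 2 * (b + k.+1%:R^-1)))).
  by apply: Ck_affine; exact: smooth1_expinv.
by apply/funext => x; rewrite mulrBr mulNr addrC.
Qed.

Lemma bump_ge0 a b k x : 0 <= bump a b k x.
Proof. by rewrite mulr_ge0 ?expinv1_ge0. Qed.

Lemma bump_le1 a b k x : bump a b k x <= 1.
Proof. by rewrite mulr_ile1 ?expinv1_ge0 ?expinv1_le1. Qed.

Lemma bump_out a b k x : ~~ (a < x < b + 1) -> bump a b k x = 0.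
Proof.
rewrite negb_and -!leNgt => /orP[xa|bx]; rewrite /bump !expinv1E.
  by rewrite ltNge mulr_ge0_le0 ?subr_le0//= mul0r.
rewrite [X in _ * X]ifF ?mulr0//; apply/negbTE; rewrite -leNgt.
rewrite mulr_ge0_le0 ?exprn_ge0// subr_le0 (le_trans _ bx)// lerD2l.
by rewrite invf_le1// ler1n.
Qed.

Lemma cvg_bump a b x :
  bump a b k x @[k --> \oo] --> ((a < x <= b)%R%:R : R).
Proof.
have cvgV (u : nat -> R) : (forall k, 0 < u k) -> (u k)^-1 @[k --> \oo] --> 0 ->
    expinv 1 (u k) @[k --> \oo] --> (1 : R).
  move=> u0 u0oo;
  rewrite (_ : (fun k => _) = (fun k => expR (- (u k)^-1))); last first.
    by apply/funext => k; rewrite expinv1E u0.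
  have : expR (- (u k)^-1) @[k --> \oo] --> expR (- 0).
    by apply: continuous_cvg; [exact: continuous_expR|exact: cvgN].
  by rewrite oppr0 expR0.
have harm : (k.+1%:R^-1 : R) @[k --> \oo] --> (0 : R) by exact: cvg_harmonic.
have [ax|xa] := ltP a x; last first.
  rewrite (_ : (fun k => _) = cst 0) /=; first exact: cvg_cst.
  by apply/funext => k; rewrite bump_out// (le_gtF xa).
have H1 : expinv 1 (k.+1%:R * (x - a)) @[k --> \oo] --> (1 : R).
  apply: cvgV; first by move=> k; rewrite mulr_gt0// subr_gt0.
  rewrite (_ : (fun k => _) = (fun k => k.+1%:R^-1 * (x - a)^-1)); last first.
    by apply/funext => k; rewrite invfM.
  rewrite -[X in _ --> X](mul0r (x - a)^-1); apply: cvgMl; exact: harm.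
have [xb|bx] := leP x b => /=.
  rewrite -[X in _ --> X]mulr1; apply: cvgM; first exact: H1.
  apply: cvgV.
    by move=> k; rewrite mulr_gt0// subr_gt0 ltr_pwDr// invr_gt0.
  apply: (@squeeze_cvgr _ _ _ _ (cst 0) (fun k => k.+1%:R^-1)); last 2 first.
    exact: cvg_cst.
    exact: harm.
  near=> k; rewrite invr_ge0 mulr_ge0 ?exprn_ge0//=; last first.
    by rewrite subr_ge0 (le_trans xb)// lerDl.
  rewrite lef_pV2 ?posrE//; last first.
    by rewrite mulr_gt0// subr_gt0 ltr_pwDr// invr_gt0.
  rewrite expr2 -mulrA ler_peMr// (@le_trans _ _ (k.+1%:R * k.+1%:R^-1))//.
    by rewrite divff.
  by rewrite ler_wpM2l// addrAC lerDr subr_ge0.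
rewrite -[X in _ --> X](mulr0 (1 : R)); apply: cvgM; first exact: H1.
apply: cvg_near_cst; near=> k; rewrite expinv1E ifF//; apply/negbTE.
rewrite -leNgt mulr_ge0_le0 ?exprn_ge0// subr_le0 -lerBrDl.
near: k; apply: (cvgr_le (0 : R)) => //; rewrite subr_gt0//.
Unshelve. all: by end_near. Qed.

End smooth_line.

Section slide.
Context {R : realType}.
Local Notation leb := (@lebesgue_measure R).

Lemma continuous_measurable_line (f : R -> R) : continuous f -> measurable_fun setT f.
Proof. by move=> cf; apply: continuous_measurable_fun. Qed.

Lemma bump_primitive (a b : R) k :
  exists E : R -> R, forall x : R, is_derive x 1 E (bump a b k x).
Proof.
pose F x := \int[leb]_(t in [set` `]-oo, x]]) bump a b k t.
exists F => x.
have cb := smooth1_continuous (smooth1_bump a b k).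
have mb := continuous_measurable_line cb.
have ib u : leb.-integrable `]-oo, u] (EFin \o bump a b k).
  apply: (@integrableS _ _ _ leb setT) => //.
  apply: (@le_integrable _ _ _ leb setT _ _ (EFin \o \1_(`[a, b + 1]%classic))) => //=.
  - exact/measurable_EFinP.
  - move=> y _ /=; rewrite lee_fin ger0_norm ?bump_ge0// indicE ger0_norm//.
    have [yab|yab] := boolP (y \in `[a, b + 1]%classic); first by rewrite bump_le1.
    rewrite bump_out//; apply: contra yab => /andP[ay yb].
    by rewrite inE /= in_itv /= !ltW.
  - exact: integrable_indic_itv.
have x1 : x < x + 1 by rewrite ltrDl.
have [dF F'] := @continuous_FTC1 R (bump a b k) -oo%O x (x + 1) x1
   (ib (x + 1)) (ltNyr _) (cb x).
by apply: DeriveDef; [exact: dF|rewrite -derive1E; exact: F'].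
Qed.

(** If E' = f this is E x - E (x - tau), so that its derivative is a difference
    of two translates of [f]. *)
Definition slide (tau : R) (f : R -> R) (x : R) : R :=
  \int[leb]_(s in `[0, tau]) f (x - s).

Lemma slideE (tau : R) (f E : R -> R) x : 0 < tau -> continuous f ->
  (forall x : R, is_derive x 1 E (f x)) -> slide tau f x = E x - E (x - tau).
Proof.
move=> tau0 cf dE.
have dG (s : R) : is_derive s 1 (fun s => - E (x - s)) (f (x - s)).
  have dl : is_derive s 1 (fun s : R => x - s) (-1).
    have := is_deriveB (is_derive_cst x s 1) (is_derive_id s (1 : R)).
    by rewrite sub0r.
  have := is_deriveN (@is_derive1_comp _ E (fun s => x - s) s _ _ (dE (x - s)) dl).
  by rewrite mulrN1 opprK.
have cfx : continuous (fun s => f (x - s)).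
  move=> s; apply: (@continuous_comp _ _ _ (fun s : R => x - s) f); last exact: cf.
  by apply: continuousB; [exact: cvg_cst|exact: cvg_id].
have cG : continuous (fun s => - E (x - s)).
  move=> s; apply: differentiable_continuous; apply/derivable1_diffP.
  exact: (@ex_derive _ _ _ _ _ _ _ (dG s)).
rewrite /slide /Rintegral (@continuous_FTC2 _ _ (fun s => - E (x - s)) _ _ tau0).
- by rewrite -EFinB /= subr0 opprK addrC.
- exact: continuous_subspaceT.
- split.
  + by move=> s _; exact: (@ex_derive _ _ _ _ _ _ _ (dG s)).
  + by apply: cvg_at_right_filter; exact: cG.
  + by apply: cvg_at_left_filter; exact: cG.
- by move=> s _; rewrite derive1E; exact: (@derive_val _ _ _ _ _ _ _ (dG s)).
Qed.

Lemma smooth1_is_derive_slide (tau : R) (a b : R) k (x : R) : 0 < tau ->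
  is_derive x 1 (slide tau (bump a b k)) (bump a b k x - bump a b k (x - tau)).
Proof.
move=> tau0; have [E dE] := bump_primitive a b k.
have cb := smooth1_continuous (smooth1_bump a b k).
rewrite (_ : slide tau _ = E \- (fun x => E (x - tau))); last first.
  by apply/funext => y; exact: slideE.
apply: is_deriveB.
have dl : is_derive x 1 (fun s : R => s - tau) 1.
  have := is_deriveB (is_derive_id x (1 : R)) (is_derive_cst tau x 1).
  by rewrite subr0.
have := @is_derive1_comp _ E (fun s => s - tau) x _ _ (dE (x - tau)) dl.
by rewrite mulr1.
Qed.

Lemma smooth1_slide (tau : R) (a b : R) k : 0 < tau ->
  smooth1 (slide tau (bump a b k)).
Proof.
move=> tau0 [//|j]; exists (fun x => bump a b k x - bump a b k (x - tau)).
  by move=> x; exact: smooth1_is_derive_slide.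
have sb := smooth1_bump a b k.
rewrite (_ : (fun x => _) = (bump a b k \+ (cst (-1) \* (fun x => bump a b k (1 * x - tau))))).
  by apply: CkD; [exact: sb|apply: CkM; [exact: Ck_cst|exact: Ck_affine]].
by apply/funext => x /=; rewrite mulN1r mul1r.
Qed.

Lemma slide_out (tau : R) (a b : R) k x : 0 < tau ->
  ~~ (a < x < b + 1 + tau) -> slide tau (bump a b k) x = 0.
Proof.
move=> tau0 xab; rewrite /slide /Rintegral integral0_eq// => s.
rewrite /= in_itv /= => /andP[s0 st]; rewrite bump_out//.
by apply: contra xab => /andP[? ?]; apply/andP; split; lra.
Qed.

End slide.

(** * Product test functions *)

Section product_tests.
Context {R : realType} {n : nat}.
Local Notation pt := ('rV[R]_n * measurableTypeR R)%type.

(** Partial derivatives of a product act on one factor each: the mixed ones are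
    explicit and commute. *)
Definition prodf (e : 'I_n.+1 -> R -> R) (z : 'rV[R]_n * R) : R :=
  \prod_(i < n.+1) e i (crd i z).

Lemma crd_xt_basis (i j : 'I_n.+1) : crd j (@xt_basis R n i) = (j == i)%:R.
Proof.
rewrite crdE /xt_basis; case: (unliftP ord_max i) => [k ->|->] /=.
  case: (unliftP ord_max j) => [l ->|->] /=.
    by rewrite mxE eqxx (inj_eq lift_inj).
  by rewrite eq_liftF.
case: (unliftP ord_max j) => [l ->|->] /=; last by rewrite eqxx.
by rewrite mxE eq_sym eq_liftF.
Qed.

Lemma crdZ h i (z : 'rV[R]_n * R) : crd i (h *: z) = h * crd i z.
Proof. by rewrite !crdE; case: unliftP => [j _|_] //=; rewrite mxE. Qed.

Lemma continuous_crd i : continuous (crd i : 'rV[R]_n * R -> R).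
Proof.
case: (unliftP ord_max i) => [k ->|->].
  rewrite (_ : crd _ = (fun x : 'rV[R]_n => x 0 k) \o fst); last first.
    by apply/funext => z; rewrite crd_lift.
  move=> z; apply: continuous_comp; first exact: cvg_fst.
  exact: coord_continuous.
rewrite (_ : crd _ = snd); last by apply/funext => z; rewrite crd_max.
by move=> z; exact: cvg_snd.
Qed.

Lemma continuous_prodf e : (forall i, continuous (e i)) -> continuous (prodf e).
Proof.
move=> ce; rewrite /prodf.
have H s : continuous (fun z : 'rV[R]_n * R => \prod_(i <- s) e i (crd i z)).
  elim: s => [|i s IH].
    by under eq_fun do rewrite big_nil; move=> z; exact: cvg_cst.
  rewrite (_ : (fun z => _) = (fun z => e i (crd i z) * \prod_(i <- s) e i (crd i z))).
    move=> z; apply: cvgM; last exact: IH.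
    by apply: continuous_comp; [exact: continuous_crd|exact: ce].
  by apply/funext => z; rewrite big_cons.
exact: H.
Qed.

Lemma is_derive_prodf (e : 'I_n.+1 -> R -> R) i z (df : R) :
  is_derive (crd i z) 1 (e i) df ->
  is_derive z (@xt_basis R n i) (prodf e) ((\prod_(j < n.+1 | j != i) e j (crd j z)) * df).
Proof.
move=> [dei <-]; set c := \prod_(_ < _ | _) _.
have H : (h^-1 *: ((prodf e \o shift z) (h *: xt_basis i) - prodf e z)) @[h --> 0^'] -->
    c * 'D_1 (e i) (crd i z).
  rewrite (_ : (fun h => _) =
     (fun h => c * (h^-1 *: ((e i \o shift (crd i z)) (h *: 1) - e i (crd i z))))).
    by apply: cvgMr; exact: dei.
  apply/funext => h /=; rewrite /prodf (bigD1 i)//= [in X in _ - X](bigD1 i)//=.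
  rewrite (eq_bigr (fun j => e j (crd j z))); last first.
    by move=> j /negPf ji; rewrite crdD crdZ crd_xt_basis ji mulr0 add0r.
  rewrite crdD crdZ crd_xt_basis eqxx -/c -mulrBl /GRing.scale /=; ring.
by apply: DeriveDef; [apply/cvg_ex; eexists; exact: H|apply/cvg_lim].
Qed.

Lemma partials_prodf (e : 'I_n.+1 -> R -> R) alpha : (forall i, smooth1 (e i)) ->
  partials (@xt_basis R n) alpha (prodf e) =
  prodf (fun i => derive1n (count_mem i alpha) (e i)).
Proof.
move=> se; elim: alpha => [//|i alpha IH] /=.
rewrite IH; apply/funext => z.
set e' := fun i => _.
have de : is_derive (crd i z) 1 (e' i) (derive1 (e' i) (crd i z)).
  by apply: smooth1_is_derive; exact: smooth1_derive1n.
rewrite (@derive_val _ _ _ _ _ _ _ (is_derive_prodf de)) /prodf [RHS](bigD1 i)//= mulrC.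
rewrite eqxx add1n -derive1nS; congr (_ * _).
by apply: eq_bigr => j; rewrite eq_sym => /negPf ->.
Qed.

Lemma smooth_prodf (e : 'I_n.+1 -> R -> R) : (forall i, smooth1 (e i)) ->
  smooth (@xt_basis R n) (prodf e).
Proof.
move=> se alpha; rewrite partials_prodf//.
have se' i : smooth1 (derive1n (count_mem i alpha) (e i)) by exact: smooth1_derive1n.
split; first by apply: continuous_prodf => i; exact: smooth1_continuous.
move=> i z; apply: ex_derive; apply: is_derive_prodf.
exact: smooth1_is_derive.
Qed.

Lemma prodf_out e (a b : 'I_n.+1 -> R) z :
  (forall i x, ~~ (a i <= x <= b i) -> e i x = 0) ->
  ~ (forall i, a i <= crd i z <= b i) -> prodf e z = 0.
Proof.
move=> e0 /existsNP[i /negP zi]; rewrite /prodf (bigD1 i)//= e0 ?mul0r//.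
Qed.

Lemma compact_cbox (a b : 'I_n.+1 -> R) :
  compact [set z : 'rV[R]_n * R | forall i, a i <= crd i z <= b i].
Proof.
rewrite (_ : [set z | _] = [set x : 'rV[R]_n | forall i, `[a (lift ord_max i), b (lift ord_max i)]%classic (x 0 i)] `*`
   `[a ord_max, b ord_max]%classic).
  apply: compact_setX; last exact: segment_compact.
  by apply: (@rV_compact R n (fun i => `[a (lift ord_max i), b (lift ord_max i)]%classic)) => i; exact: segment_compact.
apply/seteqP; split=> z /=.
  move=> H; split=> [i|]; first by have := H (lift ord_max i); rewrite crd_lift in_itv.
  by have := H ord_max; rewrite crd_max in_itv.
rewrite in_itv /= => -[H zm] i; case: (unliftP ord_max i) => [j ->|->].
  by have := H j; rewrite crd_lift in_itv.
by rewrite crd_max.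
Qed.

Lemma test_function_prodf (e : 'I_n.+1 -> R -> R) (a b : 'I_n.+1 -> R) :
  (forall i, smooth1 (e i)) ->
  (forall i x, ~~ (a i <= x <= b i) -> e i x = 0) -> 0 < a ord_max ->
  test_function (@xt_basis R n) upper (prodf e).
Proof.
move=> se e0 a0; split; first exact: smooth_prodf.
exists [set z | forall i, a i <= crd i z <= b i]; split.
- exact: compact_cbox.
- move=> z /(_ ord_max); rewrite crd_max /upper /= => /andP[az _].
  exact: lt_le_trans az.
- by move=> z; exact: prodf_out.
Qed.

End product_tests.

(** * Tonelli's theorem *)

(** Restricted domains are handled by extending the integrand by zero. *)
Section tonelli_in.
Local Open Scope ereal_scope.
Context d1 d2 (T1 : measurableType d1) (T2 : measurableType d2) (R : realType).
Variables (m1 : {sigma_finite_measure set T1 -> \bar R})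
          (m2 : {sigma_finite_measure set T2 -> \bar R}).
Variables (D : set T1) (E : set T2) (mD : measurable D) (mE : measurable E).
Variables (f : T1 * T2 -> \bar R) (mf : measurable_fun setT f).
Hypothesis f0 : forall z, 0 <= f z.

Let g := f \_ (D `*` E).

Let mg : measurable_fun setT g.
Proof.
apply/(measurable_restrictT f (measurableX mD mE)).
by apply: measurable_funTS.
Qed.

Let g0 z : 0 <= g z.
Proof. by rewrite /g /patch; case: ifP. Qed.

Let gx x : x \in D -> \int[m2]_y g (x, y) = \int[m2]_(y in E) f (x, y).
Proof.
move=> xD; rewrite [RHS]integral_mkcond; apply: eq_integral => y _.
by rewrite /g /patch in_setX xD.
Qed.

Let gx0 x : x \notin D -> \int[m2]_y g (x, y) = 0.
Proof.
move=> /negPf xD; apply: integral0_eq => y _.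
by rewrite /g /patch in_setX xD.
Qed.

Let gy y : y \in E -> \int[m1]_x g (x, y) = \int[m1]_(x in D) f (x, y).
Proof.
move=> yE; rewrite [RHS]integral_mkcond; apply: eq_integral => x _.
by rewrite /g /patch in_setX yE andbT.
Qed.

Let gy0 y : y \notin E -> \int[m1]_x g (x, y) = 0.
Proof.
move=> /negPf yE; apply: integral0_eq => x _.
by rewrite /g /patch in_setX yE andbF.
Qed.

Lemma tonelli_in : \int[m1]_(x in D) \int[m2]_(y in E) f (x, y) =
  \int[m2]_(y in E) \int[m1]_(x in D) f (x, y).
Proof.
have H := fubini_tonelli g mg g0 (m1 := m1) (m2 := m2).
rewrite [LHS]integral_mkcond [RHS]integral_mkcond.
rewrite (eq_integral (fun x => \int[m2]_y g (x, y))).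
  rewrite H; apply: eq_integral => y _; rewrite /patch.
  by case: ifPn => yE; [rewrite gy|rewrite gy0].
move=> x _; rewrite /patch.
by case: ifPn => xD; [rewrite gx|rewrite gx0].
Qed.

Lemma measurable_tonelli_in :
  measurable_fun D (fun x => \int[m2]_(y in E) f (x, y)).
Proof.
have : measurable_fun setT (fun x => \int[m2]_y g (x, y)).
  exact: measurable_fun_fubini_tonelli_F.
move=> /(measurable_funS measurableT (@subsetT _ D)).
by apply: eq_measurable_fun => x xD; rewrite gx.
Qed.

Lemma measurable_tonelli_in2 :
  measurable_fun E (fun y => \int[m1]_(x in D) f (x, y)).
Proof.
have : measurable_fun setT (fun y => \int[m1]_x g (x, y)).
  exact: measurable_fun_fubini_tonelli_G.
move=> /(measurable_funS measurableT (@subsetT _ E)).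
by apply: eq_measurable_fun => y yE; rewrite gy.
Qed.

End tonelli_in.

Section tonelli_spacetime.
Local Open Scope ereal_scope.
Context {R : realType} {n : nat}.
Local Notation pt := ('rV[R]_n * measurableTypeR R)%type.
Local Notation mux := (lebesgue_rV R n).
Local Notation muxt := (lebesgue_xt R n).
Local Notation leb := (@lebesgue_measure R).

Lemma tonelli_xt_line (D : set pt) (E : set (measurableTypeR R))
    (f : pt * measurableTypeR R -> \bar R) :
  measurable D -> measurable E -> measurable_fun setT f -> (forall z, 0 <= f z) ->
  \int[muxt]_(w in D) \int[leb]_(s in E) f (w, s) =
  \int[leb]_(s in E) \int[muxt]_(w in D) f (w, s).
Proof. by move=> mD mE mf f0; exact: (tonelli_in (@slebesgue_xt R n) (@lebesgue_measure R) mD mE mf f0). Qed.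

Lemma measurable_tonelli_xt_line (E : set (measurableTypeR R))
    (f : pt * measurableTypeR R -> \bar R) :
  measurable E -> measurable_fun setT f -> (forall z, 0 <= f z) ->
  measurable_fun setT (fun w => \int[leb]_(s in E) f (w, s)).
Proof.
move=> mE mf f0.
exact: (measurable_tonelli_in (@lebesgue_measure R) (@measurableT _ pt) mE mf f0).
Qed.

Lemma measurable_tonelli_line_xt (D : set pt) (E : set (measurableTypeR R))
    (f : pt * measurableTypeR R -> \bar R) :
  measurable D -> measurable E -> measurable_fun setT f -> (forall z, 0 <= f z) ->
  measurable_fun E (fun s => \int[muxt]_(w in D) f (w, s)).
Proof.
move=> mD mE mf f0.
exact: (measurable_tonelli_in2 (@slebesgue_xt R n) mD mE mf f0).
Qed.

Lemma tonelli_xt_xt (D E : set pt) (f : pt * pt -> \bar R) :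
  measurable D -> measurable E -> measurable_fun setT f -> (forall z, 0 <= f z) ->
  \int[muxt]_(w in D) \int[muxt]_(z in E) f (w, z) =
  \int[muxt]_(z in E) \int[muxt]_(w in D) f (w, z).
Proof. by move=> mD mE mf f0; exact: (tonelli_in (@slebesgue_xt R n) (@slebesgue_xt R n) mD mE mf f0). Qed.

Lemma tonelli_x_xt (E : set pt) (f : 'rV[R]_n * pt -> \bar R) :
  measurable E -> measurable_fun setT f -> (forall z, 0 <= f z) ->
  measurable_fun setT (fun w => \int[muxt]_(z in E) f (w, z)).
Proof.
move=> mE mf f0.
exact: (measurable_tonelli_in (@slebesgue_xt R n) (@measurableT _ 'rV[R]_n) mE mf f0).
Qed.

Lemma integral_xt_iterated (f : pt -> \bar R) : measurable_fun setT f ->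
  (forall z, 0 <= f z) ->
  \int[muxt]_z f z = \int[mux]_x \int[leb]_t f (x, t).
Proof.
exact: (@fubini_tonelli1 _ _ _ _ R (@slebesgue_rV R n) (@lebesgue_measure R)).
Qed.

Lemma measurable_vertical (f : pt -> \bar R) : measurable_fun setT f ->
  (forall z, 0 <= f z) -> measurable_fun setT (fun x => \int[leb]_t f (x, t)).
Proof.
exact: (@measurable_fun_fubini_tonelli_F _ _ 'rV[R]_n (measurableTypeR R) R (@lebesgue_measure R)).
Qed.

Lemma integral_translate (v : pt) (f : pt -> \bar R) : measurable_fun setT f ->
  \int[muxt]_z f z = \int[muxt]_z f (translate v z).
Proof.
move=> mf; rewrite integralE [RHS]integralE.
have H g : measurable_fun setT g -> (forall z, 0 <= g z) ->
    \int[muxt]_z g z = \int[muxt]_z g (translate v z).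
  by move=> mg g0; rewrite (@ge0_integral_translate _ _ v setT g)//; exact: measurableT.
have -> : (fun z => f (translate v z)) = f \o translate v by [].
rewrite (funepos_comp f (translate v)) (funeneg_comp f (translate v)); congr (_ - _).
  by rewrite (H f^\+)//; exact: measurable_funepos.
by rewrite (H f^\-)//; exact: measurable_funeneg.
Qed.

End tonelli_spacetime.

(** * Functions determined by their integrals against products *)

Section fundamental_lemma.
Context {R : realType} {n : nat}.
Local Notation pt := ('rV[R]_n * measurableTypeR R)%type.
Local Notation muxt := (lebesgue_xt R n).
Implicit Types (a b : 'I_n.+1 -> R) (f : pt -> R).

(** Local integrability in the open upper half space, for a function defined
    everywhere: the boxes stay away from time 0. *)
Definition locint f := measurable_fun setT f /\
  forall a b, 0 < a ord_max -> muxt.-integrable (box a b) (EFin \o f).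

Definition bumps a b k : 'I_n.+1 -> R -> R := fun i => bump (a i) (b i) k.

Lemma locint_mul f (phi : pt -> R) M a b : locint f -> measurable_fun setT phi ->
  (forall z, `|phi z| <= M) -> (forall z, ~ box a b z -> phi z = 0) ->
  0 < a ord_max -> muxt.-integrable setT (fun z => (f z * phi z)%:E).
Proof.
move=> [mf fi] mphi phiM phi0 a0.
rewrite (_ : (fun z => _) = (EFin \o (f \* phi)) \_ (box a b)); last first.
  apply/funext => z; rewrite /patch; case: ifPn => // zab.
  by rewrite phi0 ?mulr0//= => /mem_set; rewrite (negPf zab).
apply/(integrable_mkcond _ (measurable_box a b)).
apply: (@le_integrable _ _ _ muxt (box a b) (measurable_box a b) _
    (fun z => M%:E * (EFin \o f) z)%E).
- by apply/measurable_EFinP; apply: measurable_funTS; apply: measurable_funM.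
- move=> z _ /=; rewrite lee_fin normrM mulrC [leRHS]normrM.
  by rewrite ler_wpM2r// (le_trans (phiM z))// ler_norm.
- by apply: integrableZl; [exact: measurable_box|exact: fi].
Qed.

Lemma measurable_prodf (e : 'I_n.+1 -> R -> R) :
  (forall i, measurable_fun setT (e i)) -> measurable_fun setT (prodf e : pt -> R).
Proof.
move=> me; apply: measurable_prod => i _.
exact: (measurableT_comp (me i) (measurable_crd i)).
Qed.

Lemma prodf_bumps_ge0 a b k z : 0 <= prodf (bumps a b k) z.
Proof. by apply: prodr_ge0 => i _; exact: bump_ge0. Qed.

Lemma prodf_bumps_le1 a b k z : prodf (bumps a b k) z <= 1.
Proof. by apply: prodr_ile1 => i _; rewrite bump_ge0 bump_le1. Qed.

Lemma prodf_bumps_out a b k z :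
  ~ box a (fun i => b i + 1) z -> prodf (bumps a b k) z = 0.
Proof.
move=> /existsNP[i /negP zi]; rewrite /prodf (bigD1 i)//= /bumps bump_out ?mul0r//.
by apply: contra zi => /andP[-> /ltW ->].
Qed.

Lemma measurable_bumps a b k : measurable_fun setT (prodf (bumps a b k) : pt -> R).
Proof.
apply: measurable_prodf => i; apply: continuous_measurable_line.
exact/smooth1_continuous/smooth1_bump.
Qed.

Lemma cvg_prodf_bumps a b (z : pt) :
  prodf (bumps a b k) z @[k --> \oo] --> (\1_(box a b) z : R).
Proof.
have H (s : seq 'I_n.+1) : \prod_(i <- s) bumps a b k i (crd i z) @[k --> \oo] -->
    (\prod_(i <- s) (a i < crd i z <= b i)%R%:R : R).
  elim: s => [|i s IH].
    under eq_fun do rewrite big_nil.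
    by rewrite big_nil; exact: cvg_cst.
  rewrite (_ : (fun k => _) = (fun k => bumps a b k i (crd i z) *
      \prod_(j <- s) bumps a b k j (crd j z))); last first.
    by apply/funext => k; rewrite big_cons.
  by rewrite big_cons; apply: cvgM; [exact: cvg_bump|exact: IH].
have -> : \1_(box a b) z = \prod_(i < n.+1) (a i < crd i z <= b i)%R%:R :> R.
  rewrite indicE; have [|] := pselect (box a b z).
    move=> zab; rewrite mem_set// big1// => i _.
    by rewrite zab.
  move=> zab; rewrite memNset//; move/existsNP : zab => [i /negP/negPf zi].
  by rewrite (bigD1 i)//= zi mul0r.
exact: H.
Qed.

(** The bumps converge boundedly to the indicator of the box. *)
Lemma tests_integral_box f : locint f ->
  (forall a b k, 0 < a ord_max -> (\int[muxt]_z (f z * prodf (bumps a b k) z)%:E = 0)%E) ->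
  forall a b, 0 < a ord_max -> (\int[muxt]_(z in box a b) (f z)%:E = 0)%E.
Proof.
move=> lf f0 a b a0; have [mf fi] := lf.
pose b1 i := b i + 1.
have [] := @dominated_convergence _ _ _ muxt setT measurableT
  (fun k z => (f z * prodf (bumps a b k) z)%:E) (fun z => (f z * \1_(box a b) z)%:E)
  (fun z => (`|f z| * \1_(box a b1) z)%:E).
- move=> k; apply/measurable_EFinP; apply: measurable_funM => //; exact: measurable_bumps.
- apply/measurable_EFinP; apply: measurable_funM => //.
  apply: measurable_indic; exact: measurable_box.
- apply/aeW => z _; apply: cvg_EFin; first exact: nearW.
  by apply: cvgMr; exact: cvg_prodf_bumps.
- apply: (@locint_mul (fun z => `|f z|) (\1_(box a b1)) 1 a b1) => //.
  + split; first exact: measurableT_comp.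
    by move=> c d c0; have := integrable_norm (fi _ d c0).
  + apply: measurable_indic; exact: measurable_box.
  + by move=> z; rewrite indicE; case: (_ \in _); rewrite ?normr1 ?normr0.
  + by move=> z zab; rewrite indicE memNset.
- apply/aeW => z k _; rewrite lee_fin normrM indicE.
  case: (boolP (z \in box a b1)) => zab.
    by rewrite mulr1 [`|prodf _ _|]ger0_norm ?prodf_bumps_ge0// ler_piMr// prodf_bumps_le1.
  rewrite prodf_bumps_out ?normr0 ?mulr0//.
  by move/negP : zab; apply: contra_not; exact: mem_set.
move=> _ _; rewrite (_ : [sequence _]_ _ = cst 0%E); last first.
  by apply/funext => k; exact: f0.
move=> H; have := cvg_unique (@ereal_hausdorff R) H (cvg_cst 0%E).
move=> <-; rewrite [LHS]integral_mkcond.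
apply: eq_integral => z _; rewrite /patch indicE.
by case: ifP => _; rewrite ?mulr1 ?mulr0.
Qed.

(** The sets over whose trace in [box c d] the integral vanishes form a
    lambda-system containing the boxes, hence all measurable sets. *)
Lemma integral_box_ae0 f : locint f ->
  (forall a b, 0 < a ord_max -> (\int[muxt]_(z in box a b) (f z)%:E = 0)%E) ->
  forall c d, 0 < c ord_max -> ae_eq muxt (box c d) (EFin \o f) (cst 0%E).
Proof.
move=> lf f0 c d c0; have [mf fi] := lf.
have mD := measurable_box c d.
apply: integral_ae_eq => //; first exact: fi.
have fiS (S : set pt) : measurable S -> muxt.-integrable (S `&` box c d) (EFin \o f).
  move=> mS; apply: integrableS (fi c d c0) => //; exact: measurableI.
suff H S : measurable S -> (\int[muxt]_(x in S `&` box c d) (EFin \o f) x = 0)%E.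
  by move=> E ED mE; rewrite integral0; have := H E mE; rewrite setIidl.
move=> mS; move: (mS); rewrite measurable_ptE => sS.
have H0 : (\int[muxt]_(x in box c d) (EFin \o f) x = 0)%E by exact: f0.
apply: (dynkin_induction measurable_ptE (@boxes_setI R n) _ _ _ _ sS
  (P := fun S => (\int[muxt]_(x in S `&` box c d) (EFin \o f) x = 0)%E)).
- by rewrite setTI.
- move=> _ [a [b ->]].
  rewrite box_setI; apply: f0.
  by rewrite lt_max c0 orbT.
- move=> T mT T0.
  have := H0; rewrite -[in X in X -> _](setTI (box c d)) -(setUv T) setIUl.
  rewrite integral_setU//; last 4 first.
  + exact: measurableI.
  + by apply: measurableI => //; exact: measurableC.
  + apply: measurable_funTS; exact/measurable_EFinP.
  + by apply/disj_setPS => z [[Tz _] []].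
  by rewrite T0 add0e.
- move=> F mF tF F0; rewrite setI_bigcupl integral_bigcup.
  + by apply: eseries0 => i _ _; exact: F0.
  + by apply: trivIset_setIr.
  + by move=> k; exact: measurableI.
  + by rewrite -setI_bigcupl; apply: fiS; exact: bigcup_measurable.
Qed.

End fundamental_lemma.

(** * Translates of a function with a weak derivative *)

Section cauchy_schwarz.
Local Open Scope ereal_scope.
Context d (T : measurableType d) (R : realType) (mu : {measure set T -> \bar R}).

(** Cauchy-Schwarz against the constant 1: integrate 2 l h <= h^2 + l^2 with l
    the mean value of [h]. *)
Lemma integral_sqr_le (D : set T) (m : R) (h : T -> R) :
  measurable D -> mu D <= m%:E -> measurable_fun D h ->
  (forall x, D x -> 0 <= h x)%R ->
  (\int[mu]_(x in D) (h x)%:E) * (\int[mu]_(x in D) (h x)%:E) <=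
  m%:E * \int[mu]_(x in D) (h x ^+ 2)%:E.
Proof.
move=> mD Dm mh h0.
have mh' : measurable_fun D (EFin \o h) by exact/measurable_EFinP.
have mh2 : measurable_fun D (fun x => (h x ^+ 2)%:E).
  by apply/measurable_EFinP; exact: measurable_funX.
set I := \int[mu]_(x in D) (h x)%:E; set J := \int[mu]_(x in D) _.
have I0 : 0 <= I by apply: integral_ge0 => x Dx; rewrite lee_fin h0.
have J0 : 0 <= J by apply: integral_ge0 => x Dx; rewrite lee_fin sqr_ge0.
have m0 : (0 <= m)%R by rewrite -lee_fin; exact: le_trans (measure_ge0 _ _) Dm.
move: m0; rewrite le_eqVlt => /predU1P[m0|m0].
  have I00 : I = 0.
    apply: null_set_integral => //.
    by apply/eqP; rewrite eq_le measure_ge0 andbT; rewrite -m0 in Dm.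
  by rewrite I00 mule0 mule_ge0// -m0.
have [->|Joo] := eqVneq J +oo; first by rewrite gt0_muley ?lte_fin// leey.
have Jfin : J \is a fin_num by rewrite ge0_fin_numE// lt_neqAle Joo leey.
have key (l : R) : (0 <= l)%R -> (2 * l)%:E * I <= J + (l ^+ 2 * m)%:E.
  move=> l0; rewrite -ge0_integralZl_EFin//; last by rewrite mulr_ge0.
  rewrite [X in _ + X]EFinM; apply: (@le_trans _ _ (J + (l ^+ 2)%:E * mu D)); last first.
    by rewrite leeD2l// lee_wpmul2l// lee_fin sqr_ge0.
  rewrite -integral_cst// -ge0_integralD//; last 2 first.
    - by move=> x Dx; rewrite lee_fin sqr_ge0.
    - by move=> x _; rewrite lee_fin sqr_ge0.
  apply: ge0_le_integral => //.
  - by move=> x Dx; rewrite mule_ge0// lee_fin ?h0// mulr_ge0.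
  - exact: measurable_funeM.
  - by apply: emeasurable_funD => //; exact: measurable_cst.
  - move=> x Dx /=; rewrite -EFinM -EFinD lee_fin -subr_ge0.
    by rewrite (_ : _ - _ = (h x - l) ^+ 2)%R ?sqr_ge0//; ring.
have Ifin : I \is a fin_num.
  have := key 1%R ler01; rewrite mulr1 ge0_fin_numE// => K.
  have : 2%:E * I < +oo by rewrite (le_lt_trans K)// lte_add_pinfty ?ltry// -ge0_fin_numE.
  by apply: le_lt_trans; rewrite -[leLHS]mul1e lee_wpmul2r// lee_fin ler1n.
have /key : (0 <= fine I / m)%R by rewrite divr_ge0 ?fine_ge0// ltW.
rewrite -(fineK Ifin) -(fineK Jfin) /= -!EFinM -EFinD !lee_fin => K.
have := K; rewrite -(ler_pM2l m0); set i := fine I; set j := fine J.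
have -> : (m * (2 * (i / m) * i) = 2 * (i * i))%R by field; rewrite gt_eqF.
have -> : (m * (j + (i / m) ^+ 2 * m) = m * j + i * i)%R by field; rewrite gt_eqF.
by lra.
Qed.

End cauchy_schwarz.

Section translate_axis.
Context {R : realType} {n : nat}.
Local Notation pt := ('rV[R]_n * measurableTypeR R)%type.
Local Notation muxt := (lebesgue_xt R n).
Implicit Types (a b : 'I_n.+1 -> R) (f : pt -> R) (i : 'I_n.+1).

Lemma ge0_integral_translate_le (v : pt) (A B : set pt) (g : pt -> \bar R) :
  measurable A -> measurable B -> measurable_fun setT g -> (forall z, (0 <= g z)%E) ->
  (forall w, A w -> B (translate v w)) ->
  (\int[muxt]_(w in A) g (translate v w) <= \int[muxt]_(w in B) g w)%E.
Proof.
move=> mA mB mg g0 AB.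
have mtB : measurable (translate v @^-1` B).
  by rewrite -[X in measurable X]setTI; exact: measurable_translate.
rewrite (@ge0_integral_translate R n v B g)//; last exact: measurable_funTS.
apply: ge0_subset_integral => //.
apply: measurable_funTS; apply: measurableT_comp => //; exact: measurable_translate.
Qed.

Definition slideto i (s : R) (w : pt) : pt := translate (s *: xt_basis i) w.

Lemma crd_slideto i s j w : crd j (slideto i s w) = crd j w + s * (j == i)%:R.
Proof. by rewrite crd_translate crdZ crd_xt_basis. Qed.

Lemma slidetoK i s w : slideto i (- s) (slideto i s w) = w.
Proof. by apply: crd_inj => j; rewrite !crd_slideto mulNr addrK. Qed.

Lemma measurable_slideto d (T : measurableType d) i (f : T -> R) (g : T -> pt) :
  measurable_fun setT f -> measurable_fun setT g ->
  measurable_fun setT (fun x => slideto i (f x) (g x)).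
Proof.
move=> mf mg; apply: measurable_to_pt => j.
rewrite (_ : _ \o _ = (fun x => crd j (g x) + f x * (j == i)%:R)); last first.
  by apply/funext => x /=; rewrite crd_slideto.
apply: measurable_funD; first exact: (measurableT_comp (measurable_crd j) mg).
exact: measurable_funM.
Qed.

Lemma preimage_box_slideto i s a b : slideto i s @^-1` box a b =
  box (fun j => a j - s * (j == i)%:R) (fun j => b j - s * (j == i)%:R).
Proof.
by apply/seteqP; split=> w /= + j => /(_ j); rewrite crd_slideto ltrBlDr lerBrDr.
Qed.

Lemma locint_slideto i s f : 0 <= s -> locint f -> locint (f \o slideto i s).
Proof.
move=> s0 [mf fi]; split.
  by apply: measurableT_comp => //; exact: measurable_translate.
move=> a b a0; apply/integrableP; split.
  apply/measurable_EFinP/measurable_funTS/measurableT_comp => //.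
  exact: measurable_translate.
pose a' j := a j + s * (j == i)%:R; pose b' j := b j + s * (j == i)%:R.
have a'0 : 0 < a' ord_max by rewrite ltr_wpDr// mulr_ge0.
have /integrableP[_] := fi a' b' a'0.
rewrite (@ge0_integral_translate R n (s *: xt_basis i) _ (fun z => `|(f z)%:E|)%E)//.
- rewrite -[translate _ @^-1` _]/(slideto i s @^-1` _) preimage_box_slideto.
  rewrite (_ : box _ _ = box a b)//.
  by congr box; apply/funext => j; rewrite /a' /b' addrK.
- exact: measurable_box.
- by apply/measurableT_comp => //; apply/measurable_EFinP/measurable_funTS.
Qed.

Lemma locintB f g : locint f -> locint g -> locint (f \- g).
Proof.
move=> [mf fi] [mg gi]; split; first exact: measurable_funB.
move=> a b a0; have := integrableB (measurable_box a b) (fi _ b a0) (gi _ b a0).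
by apply: eq_integrable; [exact: measurable_box|move=> z _ /=; rewrite EFinB].
Qed.

Lemma locint_le f g : measurable_fun setT f -> (forall z, `|f z| <= `|g z|) ->
  locint g -> locint f.
Proof.
move=> mf fg [mg gi]; split=> // a b a0.
apply: (le_integrable _ _ _ (gi _ b a0)); first exact: measurable_box.
- exact/measurable_EFinP/measurable_funTS.
- by move=> z _; rewrite /= lee_fin.
Qed.

End translate_axis.

Section translation_identity.
Context {R : realType} {n : nat}.
Local Notation pt := ('rV[R]_n * measurableTypeR R)%type.
Local Notation muxt := (lebesgue_xt R n).
Local Notation leb := (@lebesgue_measure R).
Implicit Types (a b : 'I_n.+1 -> R) (f F H : pt -> R) (i : 'I_n.+1).

Definition admissible (e : 'I_n.+1 -> R -> R) (a b : 'I_n.+1 -> R) :=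
  [/\ forall i, smooth1 (e i), forall i x, ~~ (a i <= x <= b i) -> e i x = 0 &
      0 < a ord_max].

(** [H] is the weak derivative of [F] in the direction [i], tested on products
    only. *)
Definition product_deriv i F H := forall e a b, admissible e a b ->
  (\int[muxt]_z (F z * partials (@xt_basis R n) [:: i] (prodf e) z)%:E =
   - \int[muxt]_z (H z * prodf e z)%:E)%E.

Lemma bounded_of_support (e : R -> R) (x y : R) : continuous e ->
  (forall t, ~~ (x <= t <= y) -> e t = 0) ->
  exists2 M, 0 <= M & forall t, `|e t| <= M.
Proof.
move=> ce e0; have [xy|yx] := leP x y; last first.
  exists 0 => // t; rewrite e0 ?normr0//.
  by apply/negP => /andP[xt ty]; have := le_trans xt ty; rewrite leNgt yx.
have cne : {within `[x, y], continuous (fun t => `|e t|)}.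
  apply: continuous_subspaceT => t.
  by apply: (@continuous_comp _ _ _ e Num.norm); [exact: ce|exact: norm_continuous].
have [c cxy H] := EVT_max xy cne.
exists `|e c| => // t; have [txy|txy] := boolP (x <= t <= y).
  by apply: H; rewrite in_itv.
by rewrite e0// normr0.
Qed.

Lemma bounded_admissible e a b : admissible e a b ->
  exists2 M, 0 <= M & forall z, `|prodf e z| <= M.
Proof.
move=> [se e0 _].
have /choice[M HM] i : exists M, 0 <= M /\ forall t, `|e i t| <= M.
  have [M M0 HM] := bounded_of_support (smooth1_continuous (se i)) (e0 i).
  by exists M.
exists (\prod_(i < n.+1) M i).
  by apply: prodr_ge0 => i _; case: (HM i).
move=> z; rewrite /prodf normr_prod; apply: ler_prod => i _.
by rewrite normr_ge0 /=; case: (HM i).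
Qed.

Lemma measurable_admissible e a b : admissible e a b ->
  measurable_fun setT (prodf e : pt -> R).
Proof.
move=> [se _ _]; apply: measurable_prodf => i; apply: continuous_measurable_line.
exact: smooth1_continuous.
Qed.

Lemma integrable_admissible g e a b : locint g -> admissible e a b ->
  muxt.-integrable setT (fun z => (g z * prodf e z)%:E).
Proof.
move=> lg adm; have [M M0 HM] := bounded_admissible adm.
have [se e0 a0] := adm.
pose a' i := if i == ord_max then a i / 2 else a i - 1.
apply: (@locint_mul _ _ g (prodf e) M a' b) => //.
- exact: measurable_admissible adm.
- move=> z zab; apply: prodf_out e0 _; apply: contra_not zab => zab i.
  have /andP[z1 ->] := zab i; rewrite andbT; apply: lt_le_trans z1.
  rewrite /a'; case: eqP => [->|_]; last by lra.
  by lra.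
- by rewrite /a' eqxx divr_gt0.
Qed.

Definition slide_bumps i tau a b k : 'I_n.+1 -> R -> R :=
  fun j => if j == i then slide tau (bumps a b k j) else bumps a b k j.

Lemma admissible_slide_bumps i tau a b k : 0 < tau -> 0 < a ord_max ->
  admissible (slide_bumps i tau a b k) a (fun i => b i + 1 + tau).
Proof.
move=> tau0 a0; split=> // [j|j x abx]; rewrite /slide_bumps; case: ifP => _.
- exact: smooth1_slide.
- exact: smooth1_bump.
- by rewrite slide_out//; apply: contra abx => /andP[/ltW -> /ltW ->].
- rewrite /bumps bump_out//; apply: contra abx => /andP[/ltW -> xb] /=.
  by rewrite (le_trans (ltW xb))// lerDl ltW.
Qed.

(** Against the [i]-th derivative of this test function, [F] is paired with
    the difference between a product of bumps and its translate. *)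
Lemma partial_slide_bumps i tau a b k (z : pt) : 0 < tau ->
  partials (@xt_basis R n) [:: i] (prodf (slide_bumps i tau a b k)) z =
  prodf (bumps a b k) z - prodf (bumps a b k) (slideto i (- tau) z).
Proof.
move=> tau0 /=.
have de : is_derive (crd i z) 1 (slide_bumps i tau a b k i)
    (bumps a b k i (crd i z) - bumps a b k i (crd i z - tau)).
  by rewrite /slide_bumps eqxx; exact: smooth1_is_derive_slide.
rewrite (@derive_val _ _ _ _ _ _ _ (is_derive_prodf de)) /prodf.
rewrite [in X in _ = X - _](bigD1 i)//= [in X in _ = _ - X](bigD1 i)//= crd_slideto eqxx mulr1.
rewrite [X in _ = _ - _ * X](eq_bigr (fun j => bumps a b k j (crd j z))); last first.
  by move=> j /negPf ji; rewrite crd_slideto ji mulr0 addr0.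
rewrite -mulrBl mulrC; congr (_ * _); apply: eq_bigr => j /negPf ji.
by rewrite /slide_bumps ji.
Qed.

(** The same test function is an integral of translates, so pairing [H] with it
    integrates [H] along segments. *)
Lemma prodf_slide_bumpsE i tau a b k (z : pt) : 0 < tau ->
  ((prodf (slide_bumps i tau a b k) z)%:E =
   \int[leb]_(s in `[0%R, tau]) (prodf (bumps a b k) (slideto i (- s) z))%:E)%E.
Proof.
move=> tau0; pose c := \prod_(j < n.+1 | j != i) bumps a b k j (crd j z).
have c0 : 0 <= c by apply: prodr_ge0 => j _; exact: bump_ge0.
have mb : measurable_fun `[0, tau] (fun s : R => (bumps a b k i (crd i z - s))%:E).
  apply/measurable_EFinP/measurable_funTS/(measurableT_comp (f := bumps a b k i)) => //.
    apply: continuous_measurable_line; exact/smooth1_continuous/smooth1_bump.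
  exact: measurable_funB.
transitivity (\int[leb]_(s in `[0%R, tau]) (c%:E * (bumps a b k i (crd i z - s))%:E))%E.
  rewrite ge0_integralZl_EFin//; last by move=> s _; rewrite lee_fin bump_ge0.
  have -> : prodf (slide_bumps i tau a b k) z = c * slide tau (bumps a b k i) (crd i z).
    rewrite /prodf (bigD1 i)//= mulrC [in X in _ * X]/slide_bumps eqxx; congr (_ * _).
    by apply: eq_bigr => j /negPf ji; rewrite /slide_bumps ji.
  rewrite EFinM; congr (_ * _)%E.
  rewrite /slide /Rintegral fineK// ge0_fin_numE; last first.
    by apply: integral_ge0 => s _; rewrite lee_fin bump_ge0.
  apply: (@le_lt_trans _ _ (\int[leb]_(s in `[0%R, tau]) (cst 1%E s))%E).
    apply: ge0_le_integral => //.
    - by move=> s _; rewrite lee_fin bump_ge0.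
    - by move=> s _; rewrite lee_fin bump_le1.
  by rewrite integral_cst//= mul1e lebesgue_measure_itv /= lte_fin tau0 -EFinD ltry.
apply: eq_integral => s _; rewrite -EFinM /prodf [in RHS](bigD1 i)//= crd_slideto eqxx mulr1 mulrC.
congr (_ * _)%:E; apply: eq_bigr => j /negPf ji.
by rewrite crd_slideto ji mulr0 addr0.
Qed.

Definition segint i tau (h : pt -> R) (w : pt) : \bar R :=
  (\int[leb]_(s in `[0%R, tau]) (h (slideto i s w))%:E)%E.

Lemma measurable_along i (h : pt -> R) : measurable_fun setT h ->
  measurable_fun setT (fun ws : pt * measurableTypeR R => h (slideto i ws.2 ws.1)).
Proof.
move=> mh; apply: (measurableT_comp mh).
by apply: measurable_slideto; [exact: measurable_snd|exact: measurable_fst].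
Qed.

Lemma measurable_seg i (h : pt -> R) : measurable_fun setT h ->
  measurable_fun setT (fun ws : pt * measurableTypeR R => (h (slideto i ws.2 ws.1))%:E).
Proof. by move=> mh; apply/measurable_EFinP; exact: measurable_along. Qed.

Lemma measurable_seg1 i (h : pt -> R) w (E : set (measurableTypeR R)) :
  measurable_fun setT h -> measurable_fun E (fun s => (h (slideto i s w))%:E).
Proof.
move=> mh; apply/measurable_EFinP; apply: measurable_funTS.
apply: (measurableT_comp mh); apply: measurable_slideto; first exact: measurable_id.
exact: measurable_cst.
Qed.

Lemma measurable_segint i tau (h : pt -> R) : measurable_fun setT h ->
  (forall z, 0 <= h z) -> measurable_fun setT (segint i tau h).
Proof.
move=> mh h0.
apply: (@measurable_tonelli_xt_line R n `[0%R, tau]%classic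
  (fun ws => (h (slideto i ws.2 ws.1))%:E)) => //.
  exact: measurable_seg.
by move=> z; rewrite lee_fin.
Qed.

Lemma segint_box i tau (h : pt -> R) a b : 0 < tau -> locint h ->
  (forall z, 0 <= h z) -> 0 < a ord_max ->
  (\int[muxt]_(w in box a b) segint i tau h w < +oo)%E.
Proof.
move=> tau0 [mh hi] h0 a0.
have mD := measurable_box a b.
rewrite (@tonelli_xt_line _ _ (box a b) `[0%R, tau]%classic
  (fun ws => (h (slideto i ws.2 ws.1))%:E))//; last 2 first.
  exact: measurable_seg.
  by move=> z; rewrite lee_fin.
pose b' j := b j + tau.
pose C := (\int[muxt]_(w in box a b') (h w)%:E)%E.
have Coo : (C < +oo)%E.
  have /integrableP[_] := hi a b' a0.
  by under eq_integral do rewrite /= ger0_norm//.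
apply: (@le_lt_trans _ _ (\int[leb]_(s in `[0%R, tau]) (cst C s))%E); last first.
  rewrite integral_cst//= lebesgue_measure_itv /= lte_fin tau0 -EFinD.
  rewrite lte_mul_pinfty//.
    by apply: integral_ge0 => z _; rewrite lee_fin.
  rewrite ge0_fin_numE//.
    by apply: integral_ge0 => z _; rewrite lee_fin.
  by rewrite ltry.
have Cge0 : (0 <= C)%E by apply: integral_ge0 => z _; rewrite lee_fin.
apply: ge0_le_integral => //.
- by move=> s _; apply: integral_ge0 => z _; rewrite lee_fin.
- apply: (@measurable_tonelli_line_xt R n (box a b) `[0%R, tau]%classic
    (fun ws => (h (slideto i ws.2 ws.1))%:E)) => //.
    exact: measurable_seg.
  by move=> z; rewrite lee_fin.
- move=> s; rewrite /= in_itv /= => /andP[s0 st].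
  apply: (@ge0_integral_translate_le R n (s *: xt_basis i) _ _ (fun z => (h z)%:E)) => //.
  - exact: measurable_box.
  - exact/measurable_EFinP.
  - move=> w wab j; have /andP[w1 w2] := wab j.
    rewrite -/(slideto i s w) crd_slideto; apply/andP; split.
      by apply: (lt_le_trans w1); rewrite lerDl mulr_ge0.
    by apply: lerD => //; case: (j == i); rewrite ?mulr1 ?mulr0// ltW.
Qed.

End translation_identity.

Section translation_estimate.
Context {R : realType} {n : nat}.
Local Notation pt := ('rV[R]_n * measurableTypeR R)%type.
Local Notation muxt := (lebesgue_xt R n).
Local Notation leb := (@lebesgue_measure R).
Implicit Types (a b : 'I_n.+1 -> R) (f F H : pt -> R) (i : 'I_n.+1).

Lemma locint_segint i tau (h : pt -> R) : 0 < tau -> locint h ->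
  (forall z, 0 <= h z) -> locint (fun w => fine (segint i tau h w)).
Proof.
move=> tau0 lh h0; have [mh _] := lh.
have mS := measurable_segint i tau mh h0.
have S0 w : (0 <= segint i tau h w)%E.
  by apply: integral_ge0 => s _; rewrite lee_fin.
split; first exact: (measurableT_comp (fine_measurable measurableT) mS).
move=> a b a0; apply/integrableP; split.
  apply/measurable_EFinP/measurable_funTS.
  exact: (measurableT_comp (fine_measurable measurableT) mS).
apply: le_lt_trans (segint_box i b tau0 lh h0 a0).
apply: ge0_le_integral => //; first exact: measurable_box.
- apply: measurableT_comp => //; apply/measurable_EFinP/measurable_funTS.
  exact: (measurableT_comp (fine_measurable measurableT) mS).
- exact: measurable_funTS.
- move=> w _ /=; rewrite ger0_norm ?fine_ge0//.
  by case: (segint i tau h w) (S0 w) => //= _; rewrite leey.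
Qed.

(** Tonelli and a translation in space-time for each [s] move the integration
    along the segment from [h] to the test function. *)
Lemma integral_segint_test i tau (h : pt -> R) a b k : 0 < tau -> locint h ->
  (forall z, 0 <= h z) -> 0 < a ord_max ->
  (\int[muxt]_w (fine (segint i tau h w) * prodf (bumps a b k) w)%:E =
   \int[muxt]_w (h w * prodf (slide_bumps i tau a b k) w)%:E)%E.
Proof.
move=> tau0 lh h0 a0; have [mh _] := lh.
have mS := measurable_segint i tau mh h0.
have S0 w : (0 <= segint i tau h w)%E.
  by apply: integral_ge0 => s _; rewrite lee_fin.
set psi := prodf (bumps a b k) : pt -> R.
have psi0 w : 0 <= psi w by exact: prodf_bumps_ge0.
have mpsi : measurable_fun setT psi by exact: measurable_bumps.
pose g (ws : pt * measurableTypeR R) : \bar R := (psi ws.1 * h (slideto i ws.2 ws.1))%:E.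
have mg : measurable_fun setT g.
  apply/measurable_EFinP/measurable_funM; first exact: measurableT_comp mpsi measurable_fst.
  exact: measurable_along.
pose g' (ws : pt * measurableTypeR R) : \bar R := (psi (slideto i (- ws.2) ws.1) * h ws.1)%:E.
have mg' : measurable_fun setT g'.
  apply/measurable_EFinP/measurable_funM; last exact: measurableT_comp mh measurable_fst.
  apply: (measurableT_comp mpsi); apply: measurable_slideto; last exact: measurable_fst.
  exact: measurableT_comp.
have mE : @measurable _ (measurableTypeR R) `[0%R, tau]%classic by exact: measurable_itv.
transitivity (\int[muxt]_w \int[leb]_(s in `[0%R, tau]) g (w, s))%E.
  transitivity (\int[muxt]_w ((psi w)%:E * segint i tau h w))%E.
    apply: ae_eq_integral => //.
    - apply/measurable_EFinP/measurable_funM => //.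
      exact: (measurableT_comp (fine_measurable measurableT) mS).
    - by apply: emeasurable_funM => //; exact/measurable_EFinP.
    - pose b1 i := b i + 1.
      have iS : muxt.-integrable (box a b1) (segint i tau h).
        apply/integrableP; split; first exact: measurable_funTS.
        under eq_integral do rewrite gee0_abs//.
        exact: segint_box.
      have := integrable_ae (measurable_box a b1) iS.
      apply: filterS => w finS _; rewrite mulrC EFinM.
      have [zab|zab] := pselect (box a b1 w); first by rewrite fineK//; exact: finS.
      by rewrite /psi prodf_bumps_out// !mul0e.
  apply: eq_integral => w _; rewrite /segint -ge0_integralZl_EFin//.
    by move=> s _; rewrite lee_fin.
  exact: measurable_seg1.
transitivity (\int[leb]_(s in `[0%R, tau]) \int[muxt]_w g (w, s))%E.
  apply: (@tonelli_xt_line R n setT _ g) => //.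
  by move=> z; rewrite lee_fin mulr_ge0.
transitivity (\int[leb]_(s in `[0%R, tau]) \int[muxt]_w g' (w, s))%E.
  apply: eq_integral => s _.
  rewrite (@integral_translate R n (- s *: xt_basis i) (fun w => g (w, s))).
    apply: eq_integral => w _; rewrite -/(slideto i (- s) w) /g /g' /=.
    by rewrite -{2}[s]opprK slidetoK.
  exact: (measurableT_comp mg (measurable_pair2 s)).
rewrite -(@tonelli_xt_line R n setT _ g')//; last first.
  by move=> z; rewrite lee_fin mulr_ge0.
apply: eq_integral => w _; rewrite EFinM prodf_slide_bumpsE//.
rewrite -ge0_integralZl_EFin//; last 2 first.
- by move=> s _; rewrite lee_fin.
- apply/measurable_funTS/measurable_EFinP/(measurableT_comp mpsi).
  by apply: measurable_slideto => //; exact: measurableT_comp.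
by apply: eq_integral => s _; rewrite /g' /= mulrC EFinM.
Qed.

Lemma cancel_fin (x y : \bar R) : x \is a fin_num -> y \is a fin_num ->
  (y - x - - (x - y) = 0)%E.
Proof. by case: x y => [x||] [y||]//= _ _; congr EFin; lra. Qed.

(** The difference F(w + tau e_i) - F(w) is the integral of [H] along the
    segment: both have the same integrals against products of bumps, by the
    definition of the weak derivative applied to [slide_bumps]. *)
Lemma translation_ae i tau F H c d : 0 < tau -> locint F -> locint H ->
  product_deriv i F H -> 0 < c ord_max ->
  {ae muxt, forall w, box c d w -> (`|F (slideto i tau w) - F w|%:E <=
    segint i tau (fun z => `|H z|%R) w)%E}.
Proof.
move=> tau0 lF lH FH c0; have [mF _] := lF; have [mH _] := lH.
(* Tonelli applies to the positive and the negative part of H separately. *)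
pose Hp z := Num.max (H z) 0; pose Hn z := Num.max (- H z) 0.
have Hp0 z : 0 <= Hp z by rewrite le_max lexx orbT.
have Hn0 z : 0 <= Hn z by rewrite le_max lexx orbT.
have HE z : H z = Hp z - Hn z.
  by rewrite /Hp /Hn; case: (leP (H z) 0); case: (leP (- H z) 0); lra.
have HaE z : `|H z| = Hp z + Hn z.
  rewrite /Hp /Hn; case: (leP (H z) 0) => H0; case: (leP (- H z) 0) => H1;
    rewrite ?(ler0_norm H0) ?(gtr0_norm H0); lra.
have lp : locint Hp.
  apply: (locint_le _ _ lH).
    by apply: measurable_maxr => //; exact: measurable_cst.
  by move=> z; rewrite HaE ger0_norm// lerDl.
have ln : locint Hn.
  apply: (locint_le _ _ lH).
    by apply: measurable_maxr => //; exact: measurableT_comp.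
  by move=> z; rewrite HaE ger0_norm// lerDr.
pose qp w := fine (segint i tau Hp w); pose qn w := fine (segint i tau Hn w).
have lqp : locint qp by exact: locint_segint.
have lqn : locint qn by exact: locint_segint.
pose f := (F \o slideto i tau \- F) \- (qp \- qn).
have lf : locint f.
  by do 2 (apply: locintB => //); apply: locint_slideto => //; exact: ltW.
have f0 a b k : 0 < a ord_max -> (\int[muxt]_z (f z * prodf (bumps a b k) z)%:E = 0)%E.
  move=> a0.
  set psi := prodf (bumps a b k) : pt -> R.
  pose b1 j := b j + 1 + tau.
  have mpsi : measurable_fun setT psi by exact: measurable_bumps.
  have psi1 z : `|psi z| <= 1 by rewrite ger0_norm ?prodf_bumps_ge0 ?prodf_bumps_le1.
  have psi_out z : ~ box a (fun j => b j + 1) z -> psi z = 0 by exact: prodf_bumps_out.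
  have I1 g : locint g -> muxt.-integrable setT (fun z => (g z * psi z)%:E).
    by move=> lg; exact: (locint_mul lg mpsi psi1 psi_out a0).
  pose psi' z := psi (slideto i (- tau) z).
  have mpsi' : measurable_fun setT psi'.
    by apply: (measurableT_comp mpsi); exact: measurable_translate.
  have psi'_out z : ~ box a b1 z -> psi' z = 0.
    move=> zab; apply: psi_out; apply: contra_not zab => zab j.
    have := zab j; rewrite crd_slideto => /andP[z1 z2].
    have : 0 <= tau * (j == i)%:R <= tau.
      by case: (j == i); rewrite ?mulr1 ?mulr0 lexx ltW.
    by rewrite /b1; lra.
  have I2 g : locint g -> muxt.-integrable setT (fun z => (g z * psi' z)%:E).
    by move=> lg; exact: (locint_mul lg mpsi' (fun z => psi1 _) psi'_out a0).
  set Phi := prodf (slide_bumps i tau a b k) : pt -> R.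
  have adm := admissible_slide_bumps i b k tau0 a0.
  have IPhi g : locint g -> muxt.-integrable setT (fun z => (g z * Phi z)%:E).
    by move=> lg; exact: (integrable_admissible lg adm).
  have FPhi : (\int[muxt]_z (F z * psi z - F z * psi' z)%:E = - \int[muxt]_z (H z * Phi z)%:E)%E.
    rewrite -(FH _ _ _ adm).
    by apply: eq_integral => z _; rewrite partial_slide_bumps// mulrBr.
  have lHp : (\int[muxt]_z (H z * Phi z)%:E =
      \int[muxt]_z (qp z * psi z)%:E - \int[muxt]_z (qn z * psi z)%:E)%E.
    rewrite !integral_segint_test// -(integralB_EFin measurableT (IPhi _ lp) (IPhi _ ln)).
    by apply: eq_integral => z _; rewrite -EFinD HE mulrBl.
  have lF' : (\int[muxt]_z (F (slideto i tau z) * psi z)%:E = \int[muxt]_z (F z * psi' z)%:E)%E.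
    rewrite (@integral_translate R n (- tau *: xt_basis i)).
      apply: eq_integral => z _; rewrite -/(slideto i (- tau) z).
      by rewrite -{1}[tau]opprK slidetoK.
    apply/measurable_EFinP/measurable_funM => //.
    by apply: (measurableT_comp mF); exact: measurable_translate.
  have lFs : locint (F \o slideto i tau) := locint_slideto i (ltW tau0) lF.
  rewrite (_ : (fun z => _) = (fun z => ((F (slideto i tau z) * psi z)%:E - (F z * psi z)%:E) -
     ((qp z * psi z)%:E - (qn z * psi z)%:E))%E); last first.
    by apply/funext => z; rewrite -!EFinB; congr EFin; rewrite /f /=; ring.
  have IA : muxt.-integrable setT (fun z => (F (slideto i tau z) * psi z)%:E) := I1 _ lFs.
  have IB := I1 _ lF; have IC := I1 _ lqp; have ID := I1 _ lqn.
  rewrite (integralB measurableT (integrableB measurableT IA IB) (integrableB measurableT IC ID)).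
  rewrite (integralB measurableT IA IB) (integralB measurableT IC ID).
  have IB' := I2 _ lF.
  have FPhi' := integralB_EFin measurableT IB IB'.
  have HB : (\int[muxt]_z (qp z * psi z)%:E - \int[muxt]_z (qn z * psi z)%:E =
      - (\int[muxt]_z (F z * psi z)%:E - \int[muxt]_z (F z * psi' z)%:E))%E.
    by rewrite -lHp -FPhi' -[LHS]oppeK; congr (- _)%E; rewrite -FPhi.
  refine (etrans (f_equal2 (fun u v => u - v)%E (f_equal (fun u => u - _)%E lF') HB) _).
  exact: (cancel_fin (integrable_fin_num measurableT IB) (integrable_fin_num measurableT IB')).
have := integral_box_ae0 lf (tests_integral_box lf f0) d c0.
have iS h : locint h -> (forall z, 0 <= h z) ->
    {ae muxt, forall w, box c d w -> segint i tau h w \is a fin_num}.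
  move=> lh h0; have S0 w : (0 <= segint i tau h w)%E.
    by apply: integral_ge0 => s _; rewrite lee_fin.
  apply: integrable_ae; first exact: measurable_box.
  apply/integrableP; split; first by apply: measurable_funTS; apply: measurable_segint => //; case: lh.
  under eq_integral do rewrite gee0_abs//.
  exact: segint_box.
have := iS _ ln Hn0; apply: filterS2 => w finn + wcd.
move=> /(_ wcd) [] /eqP; rewrite subr_eq0 => /eqP /= ->.
have -> : segint i tau (fun z => `|H z|) w = (segint i tau Hp w + segint i tau Hn w)%E.
  rewrite /segint -ge0_integralD//.
  - by apply: eq_integral => s _; rewrite HaE EFinD.
  - by move=> s _; rewrite lee_fin.
  - exact: measurable_seg1 lp.1.
  - by move=> s _; rewrite lee_fin.
  - exact: measurable_seg1 ln.1.
have Sp0 : (0 <= segint i tau Hp w)%E by apply: integral_ge0 => s _; rewrite lee_fin.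
have Sn0 : (0 <= segint i tau Hn w)%E by apply: integral_ge0 => s _; rewrite lee_fin.
rewrite /qp /qn; move: (finn wcd) Sp0 Sn0.
case: (segint i tau Hn w) => // y _; case: (segint i tau Hp w) => //= [x|_ _].
  rewrite -EFinD !lee_fin => x0 y0.
  by rewrite (le_trans (ler_normB _ _))// !ger0_norm.
by rewrite addye// leey.
Qed.

End translation_estimate.

Section translation_L2.
Context {R : realType} {n : nat}.
Local Notation pt := ('rV[R]_n * measurableTypeR R)%type.
Local Notation muxt := (lebesgue_xt R n).
Local Notation leb := (@lebesgue_measure R).
Implicit Types (a b : 'I_n.+1 -> R) (f F : pt -> R) (i : 'I_n.+1).

Lemma slideto0 i (w : pt) : slideto i 0 w = w.
Proof. by apply: crd_inj => j; rewrite crd_slideto mul0r addr0. Qed.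

(** Cauchy-Schwarz on the segments, then Tonelli in their starting point. *)
Lemma slide_L2 i tau F (H : pt -> R) (A B : set pt) c d :
  0 <= tau -> locint F -> locint H -> product_deriv i F H -> 0 < c ord_max ->
  measurable A -> measurable B -> A `<=` box c d ->
  (forall w s, A w -> 0 <= s <= tau -> B (slideto i s w)) ->
  (\int[muxt]_(w in A) ((F (slideto i tau w) - F w) ^+ 2)%:E <=
   (tau ^+ 2)%:E * \int[muxt]_(w in B) (H w ^+ 2)%:E)%E.
Proof.
move=> + lF lH FH c0 mA mB AD AB.
rewrite le_eqVlt => /predU1P[<-|tau0].
  rewrite expr0n /= mul0e integral0_eq// => w _.
  by rewrite slideto0 subrr expr0n.
have [mF _] := lF; have [mH _] := lH.
pose H2 := fun z => H z ^+ 2.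
have mH2 : measurable_fun setT H2 by exact: measurable_funX.
have H20 z : 0 <= H2 z by exact: sqr_ge0.
have mE : @measurable _ (measurableTypeR R) `[0%R, tau]%classic by exact: measurable_itv.
apply: (@le_trans _ _ (\int[muxt]_(w in A) (tau%:E * segint i tau H2 w))%E).
  apply: ae_ge0_le_integral => //.
  - by move=> w _; rewrite lee_fin sqr_ge0.
  - apply/measurable_EFinP/measurable_funTS/measurable_funX/measurable_funB => //.
    by apply: (measurableT_comp mF); exact: measurable_translate.
  - move=> w _; rewrite mule_ge0 ?lee_fin ?(ltW tau0)//.
    by apply: integral_ge0 => s _; rewrite lee_fin.
  - apply: measurable_funTS; apply: emeasurable_funM; first exact: measurable_cst.
    exact: measurable_segint.
  - have := translation_ae d tau0 lF lH FH c0; apply: filterS => w + Aw.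
    move=> /(_ (AD _ Aw)) Fw.
    have leb_tau : (leb `[0%R, tau] <= tau%:E)%E.
      by rewrite lebesgue_measure_itv /= lte_fin tau0 oppr0 adde0.
    have := @integral_sqr_le _ _ R leb `[0%R, tau]%classic tau (fun s => `|H (slideto i s w)|)
       mE leb_tau _ _.
    have mh : measurable_fun `[0%R, tau] (fun s => `|H (slideto i s w)|).
      apply/measurable_EFinP.
      apply: (@measurable_seg1 R n i (fun z => `|H z|)); exact: measurableT_comp.
    move=> /(_ mh) K; have {}K := K (fun _ _ => normr_ge0 _).
    apply: (@le_trans _ _ (`|F (slideto i tau w) - F w|%:E * `|F (slideto i tau w) - F w|%:E)%E).
      by rewrite -EFinM lee_fin -expr2 real_normK ?num_real.
    apply: (@le_trans _ _ (segint i tau (fun z => `|H z|%R) w * segint i tau (fun z => `|H z|%R) w)%E).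
      by apply: lee_pmul => //; rewrite lee_fin.
    apply: (le_trans K); rewrite lee_wpmul2l ?lee_fin ?(ltW tau0)//.
    rewrite le_eqVlt; apply/orP; left; apply/eqP; apply: eq_integral => s _.
    by rewrite real_normK ?num_real.
rewrite ge0_integralZl_EFin//; last 3 first.
- by move=> w _; apply: integral_ge0 => s _; rewrite lee_fin.
- by apply: measurable_funTS; exact: measurable_segint.
- exact: ltW.
rewrite expr2 EFinM -muleA lee_wpmul2l ?lee_fin ?(ltW tau0)//.
rewrite (@tonelli_xt_line _ _ A `[0%R, tau]%classic (fun ws => (H2 (slideto i ws.2 ws.1))%:E))//; last 2 first.
- exact: measurable_seg.
- by move=> z; rewrite lee_fin.
set J := (\int[muxt]_(w in B) _)%E.
have J0 : (0 <= J)%E by apply: integral_ge0 => w _; rewrite lee_fin sqr_ge0.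
apply: (@le_trans _ _ (\int[leb]_(s in `[0%R, tau]) (cst J s))%E).
  apply: ge0_le_integral => //.
  - by move=> s _; apply: integral_ge0 => w _; rewrite lee_fin.
  - apply: (@measurable_tonelli_line_xt R n A `[0%R, tau]%classic
      (fun ws => (H2 (slideto i ws.2 ws.1))%:E)) => //.
      exact: measurable_seg.
    by move=> z; rewrite lee_fin.
  - move=> s; rewrite /= in_itv /= => stau.
    apply: (@ge0_integral_translate_le R n (s *: xt_basis i) A B (fun z => (H2 z)%:E)) => //.
    + exact/measurable_EFinP.
    + by move=> w Aw; exact: AB.
by rewrite integral_cst//= lebesgue_measure_itv /= lte_fin tau0 oppr0 adde0 muleC.
Qed.

(** The displacement made by the shifts in the first [k] coordinates. *)
Definition vtrunc (z : 'I_n.+1 -> R) (k : nat) : pt :=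
  vec (fun j => if (j < k)%N then z j else 0).

Lemma translate_vtruncS z (k : 'I_n.+1) w :
  translate (vtrunc z k.+1) w = slideto k (z k) (translate (vtrunc z k) w).
Proof.
apply: crd_inj => j; rewrite crd_slideto !crd_translate !crd_vec ltnS leq_eqVlt -addrA.
congr (_ + _); case: (eqVneq j k) => [->|jk].
  by rewrite eqxx ltnn add0r mulr1.
by rewrite (_ : (j == k :> nat) = false) ?mulr0 ?addr0//; apply/negbTE.
Qed.

(** One coordinate is shifted at a time, and each step costs a factor 2 from
    (a + b)^2 <= 2 a^2 + 2 b^2. All intermediate positions are in [B]. *)
Lemma translate_L2 F (H : 'I_n.+1 -> pt -> R) (A B : set pt) c d (h : R)
    (z : 'I_n.+1 -> R) :
  locint F -> (forall i, locint (H i)) -> (forall i, product_deriv i F (H i)) ->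
  0 < c ord_max -> measurable A -> measurable B -> B `<=` box c d ->
  (forall i, 0 <= z i <= h) ->
  (forall w v, A w -> (forall i, 0 <= v i <= h) -> B (translate (vec v) w)) ->
  (\int[muxt]_(w in A) ((F (translate (vec z) w) - F w) ^+ 2)%:E <=
   (2 ^+ n.+2 * h ^+ 2)%:E * \int[muxt]_(w in B) (\sum_i H i w ^+ 2)%:E)%E.
Proof.
move=> lF lH FH c0 mA mB BD zh AB; have [mF _] := lF.
have h0 : 0 <= h by have /andP[z0] := zh ord0; exact: le_trans.
set J := (\int[muxt]_(w in B) _)%E.
have J0 : (0 <= J)%E.
  by apply: integral_ge0 => w _; rewrite lee_fin sumr_ge0// => i _; exact: sqr_ge0.
have mFt v : measurable_fun setT (fun w => F (translate v w)).
  by apply: (measurableT_comp mF); exact: measurable_translate.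
have tele k : (k <= n.+1)%N ->
  (\int[muxt]_(w in A) ((F (translate (vtrunc z k) w) - F w) ^+ 2)%:E <=
    (2 ^+ k.+1 * h ^+ 2 - 2 * h ^+ 2)%:E * J)%E.
  elim: k => [_|k IH kn].
    rewrite expr1 subrr mul0e integral0_eq// => w _.
    rewrite (_ : translate _ w = w) ?subrr ?expr0n//.
    by apply: crd_inj => j; rewrite crd_translate crd_vec ltn0 addr0.
  pose k' := Ordinal kn.
  pose g1 w := (F (slideto k' (z k') w) - F w) ^+ 2.
  pose g2 w := (F (translate (vtrunc z k) w) - F w) ^+ 2.
  have mg1 : measurable_fun setT g1.
    apply: measurable_funX; apply: measurable_funB => //.
    exact: mFt.
  have mg2 : measurable_fun setT g2 by apply: measurable_funX; exact: measurable_funB.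
  have mg1t : measurable_fun setT (fun w => g1 (translate (vtrunc z k) w)).
    by apply: (measurableT_comp mg1); exact: measurable_translate.
  have tr_k : (forall i : 'I_n.+1, 0 <= (if (i < k)%N then z i else 0) <= h).
    by move=> i; case: ifP => // _; rewrite lexx.
  have step1 : (\int[muxt]_(w in A) (g1 (translate (vtrunc z k) w))%:E <= (h ^+ 2)%:E * J)%E.
    pose A' : set pt := translate (- (vtrunc z k : 'rV[R]_n * R)) @^-1` A.
    have mA' : measurable A'.
      by rewrite -[X in measurable X]setTI; exact: measurable_translate.
    have trK v w : translate (- (v : 'rV[R]_n * R)) (translate v w) = w by rewrite /translate addrK.
    have trK' v w : translate v (translate (- (v : 'rV[R]_n * R)) w) = w by rewrite /translate subrK.
    apply: (@le_trans _ _ (\int[muxt]_(w in A') (g1 w)%:E)%E).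
      apply: (@ge0_integral_translate_le R n (vtrunc z k) A A' (fun w => (g1 w)%:E)) => //.
      + exact/measurable_EFinP.
      + by move=> w; rewrite lee_fin sqr_ge0.
      + by move=> w Aw; rewrite /A' /preimage /= trK.
    have A'B w s : A' w -> 0 <= s <= z k' -> B (slideto k' s w).
      move=> A'w /andP[s0 sz]; rewrite -(trK' (vtrunc z k) w).
      pose v (j : 'I_n.+1) := if (j < k)%N then z j else if j == k' then s else 0.
      rewrite (_ : slideto _ _ _ = translate (vec v) (translate (- (vtrunc z k : 'rV[R]_n * R)) w)).
        apply: AB => // i; rewrite /v; case: ifP => // _; case: ifP => [_|_]; last by rewrite lexx.
        by rewrite s0 (le_trans sz)//; case/andP: (zh k').
      apply: crd_inj => j; rewrite crd_slideto !crd_translate !crd_vec -addrA; congr (_ + _).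
      rewrite /v; case: (eqVneq j k') => [->|jk]; first by rewrite ltnn add0r mulr1.
      by rewrite mulr0 addr0.
    have A'D : A' `<=` box c d.
      by move=> w A'w; apply: BD; rewrite -(slideto0 k' w); apply: A'B => //; rewrite lexx; case/andP: (zh k').
    have := slide_L2 (proj1 (andP (zh k'))) lF (lH k') (FH k') c0 mA' mB A'D A'B.
    move=> /le_trans; apply; apply: lee_pmul.
    + by rewrite lee_fin sqr_ge0.
    + by apply: integral_ge0 => w _; rewrite lee_fin sqr_ge0.
    + by rewrite lee_fin; have /andP[z0 zh'] := zh k'; rewrite lerXn2r// nnegrE.
    + apply: ge0_le_integral => //.
      * by move=> w _; rewrite lee_fin sqr_ge0.
      * by apply/measurable_EFinP/measurable_funTS/measurable_funX; case: (lH k').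
      * apply/measurable_EFinP/measurable_funTS/measurable_sum => i.
        by apply: measurable_funX; case: (lH i).
      * move=> w _; rewrite lee_fin (bigD1 k')//= lerDl sumr_ge0// => i _.
        exact: sqr_ge0.
  apply: (@le_trans _ _ (\int[muxt]_(w in A)
      (2%:E * (g1 (translate (vtrunc z k) w))%:E + 2%:E * (g2 w)%:E))%E).
    apply: ge0_le_integral => //.
    - by move=> w _; rewrite lee_fin sqr_ge0.
    - by apply/measurable_EFinP/measurable_funTS/measurable_funX/measurable_funB.
    - apply: measurable_funTS; apply: emeasurable_funD; apply: measurable_funeM; exact/measurable_EFinP.
    - move=> w _; rewrite -!EFinM -EFinD lee_fin /g1 /g2 (@translate_vtruncS z k').
      set x := F (slideto _ _ _); set y := F (translate _ _); set u := F w.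
      rewrite -subr_ge0.
      have -> : 2 * (x - y) ^+ 2 + 2 * (y - u) ^+ 2 - (x - u) ^+ 2 = (x - y - (y - u)) ^+ 2 by ring.
      exact: sqr_ge0.
  rewrite ge0_integralD//; last 4 first.
  - by move=> w _; rewrite mule_ge0// lee_fin sqr_ge0.
  - by apply: measurable_funTS; apply: measurable_funeM; exact/measurable_EFinP.
  - by move=> w _; rewrite mule_ge0// lee_fin sqr_ge0.
  - by apply: measurable_funTS; apply: measurable_funeM; exact/measurable_EFinP.
  rewrite !ge0_integralZl_EFin//; last 4 first.
  - by move=> w _; rewrite lee_fin sqr_ge0.
  - by apply: measurable_funTS; exact/measurable_EFinP.
  - by move=> w _; rewrite lee_fin sqr_ge0.
  - by apply: measurable_funTS; exact/measurable_EFinP.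
  have {}IH := IH (ltnW kn).
  apply: (@le_trans _ _ (2%:E * ((h ^+ 2)%:E * J) + 2%:E * ((2 ^+ k.+1 * h ^+ 2 - 2 * h ^+ 2)%:E * J))%E).
    by apply: leeD; rewrite lee_wpmul2l// lee_fin.
  have h20 : 0 <= 2 ^+ k.+1 * h ^+ 2 - 2 * h ^+ 2.
    rewrite -mulrBl mulr_ge0 ?sqr_ge0// subr_ge0 exprS ler_peMr//.
    by rewrite exprn_ege1// ler1n.
  rewrite !muleA -ge0_muleDl//; last 2 first.
  - by rewrite -EFinM lee_fin mulr_ge0// sqr_ge0.
  - by rewrite -EFinM lee_fin mulr_ge0.
  rewrite lee_wpmul2r// -!EFinM -EFinD lee_fin [2 ^+ k.+2]exprS; lra.
have := tele n.+1 (leqnn _).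
rewrite (_ : vtrunc z n.+1 = vec z); last first.
  by apply: crd_inj => j; rewrite !crd_vec ltn_ord.
move=> /le_trans; apply; rewrite lee_wpmul2r// lee_fin gerBl.
by rewrite mulr_ge0// sqr_ge0.
Qed.

End translation_L2.

(** * Smoothing kernels *)

Section kernel.
Context {R : realType} {n : nat}.
Local Notation pt := ('rV[R]_n * measurableTypeR R)%type.
Local Notation muxt := (lebesgue_xt R n).

Definition theta : R -> R := bump 0 0 0.

Lemma theta_ge0 x : 0 <= theta x. Proof. exact: bump_ge0. Qed.

Lemma theta_le1 x : theta x <= 1. Proof. exact: bump_le1. Qed.

Lemma theta_out x : ~~ (0 < x < 1) -> theta x = 0.
Proof. by move=> x01; rewrite /theta bump_out// add0r. Qed.

Lemma smooth1_theta : smooth1 theta. Proof. exact: smooth1_bump. Qed.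

Lemma expinv1_ge (x : R) : 3^-1 <= x -> expR (- 3) <= expinv 1 x.
Proof.
move=> x3; have x0 : 0 < x by apply: lt_le_trans x3; rewrite invr_gt0.
rewrite expinv1E x0 ler_expR lerN2 -[leRHS]invrK lef_pV2 ?posrE ?invr_gt0//.
Qed.

Lemma theta_ge (x : R) : 3^-1 <= x <= 2 / 3 -> expR (- 6) <= theta x.
Proof.
move=> /andP[x1 x2]; rewrite /theta /bump.
rewrite (_ : - 6 = - 3 + - 3); last by lra.
rewrite expRD ler_pM ?expR_ge0//; apply: expinv1_ge.
  by rewrite subr0 mul1r.
rewrite expr1n mul1r add0r invr1; lra.
Qed.

Lemma derive1_out (f : R -> R) (a b : R) : (forall x, ~~ (a <= x <= b) -> f x = 0) ->
  forall x, ~~ (a <= x <= b) -> derive1 f x = 0.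
Proof.
move=> f0 x xab; rewrite derive1E; apply: (@derive_val _ _ _ _ _ _ _).
apply: near_eq_is_derive (is_derive_cst 0 x 1).
move: xab; rewrite negb_and -!ltNge => /orP[xa|bx].
  near=> y; rewrite f0// negb_and -!ltNge; apply/orP; left; near: y; exact: lt_nbhsl.
near=> y; rewrite f0// negb_and -!ltNge; apply/orP; right; near: y; exact: lt_nbhsr.
Unshelve. all: by end_near. Qed.

Lemma derive1n_out k (f : R -> R) (a b : R) : (forall x, ~~ (a <= x <= b) -> f x = 0) ->
  forall x, ~~ (a <= x <= b) -> derive1n k f x = 0.
Proof.
by move=> f0; elim: k => [//|k IH] x xab; rewrite derive1nS; exact: derive1_out IH _ xab.
Qed.

Lemma derive1n_affine k (f : R -> R) (c d : R) : smooth1 f ->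
  derive1n k (fun x => f (c * x + d)) = (fun x => c ^+ k * derive1n k f (c * x + d)).
Proof.
move=> sf; elim: k => [|k IH]; first by apply/funext => x; rewrite /= expr0 mul1r.
rewrite derive1nS IH; apply/funext => x; rewrite derive1E.
have dl : is_derive x 1 (fun x : R => c * x + d) c.
  have := is_deriveD (is_deriveZ c (is_derive_id x (1 : R))) (is_derive_cst d x 1).
  by rewrite addr0 scaler1.
have df := smooth1_is_derive (c * x + d) (smooth1_derive1n k sf).
have := is_deriveZ (c ^+ k) (@is_derive1_comp _ (derive1n k f) (fun x => c * x + d) x _ _ df dl).
move=> dfc; rewrite (@derive_val _ _ _ _ _ _ _ dfc) -derive1nS /GRing.scale /= exprSr.
by rewrite mulrCA mulrA [in RHS]mulrC mulrA.
Qed.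

Lemma derive1n_theta_bound k : exists2 M, 0 <= M & forall x, `|derive1n k theta x| <= M.
Proof.
apply: (@bounded_of_support R (derive1n k theta) 0 1).
  exact/smooth1_continuous/smooth1_derive1n/smooth1_theta.
apply: derive1n_out => x x01; apply: theta_out.
by apply: contra x01 => /andP[/ltW -> /ltW ->].
Qed.

Definition kern (h : R) (w : pt) : 'I_n.+1 -> R -> R :=
  fun i x => theta (h^-1 * x + - (h^-1 * crd i w)).

Lemma kern_out h w i x : 0 < h ->
  ~~ (crd i w < x < crd i w + h) -> kern h w i x = 0.
Proof.
move=> h0 xw; rewrite /kern -mulrBr theta_out//; apply: contra xw.
rewrite mulrC pmulr_lgt0 ?invr_gt0// subr_gt0 => /andP[-> /=].
by rewrite ltr_pdivrMr// mul1r ltrBlDl.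
Qed.

Lemma admissible_kern h w : 0 < h -> 0 < crd ord_max w ->
  admissible (kern h w) (crd^~ w) (fun i => crd i w + h).
Proof.
move=> h0 w0; split=> //.
  by move=> i k; apply: Ck_affine; exact: smooth1_theta.
by move=> i x xw; rewrite kern_out//; apply: contra xw => /andP[/ltW -> /ltW ->].
Qed.

(** Each derivative in time costs a factor [h^-1], by scaling. *)
Lemma partials_kern k : exists2 M, 0 <= M & forall h w, 0 < h ->
  forall z, `|partials (@xt_basis R n) (nseq k ord_max) (prodf (kern h w)) z| <= M * (h^-1) ^+ k /\
   (~ (forall i, crd i w <= crd i z <= crd i w + h) ->
    partials (@xt_basis R n) (nseq k ord_max) (prodf (kern h w)) z = 0).
Proof.
have [M M0 HM] := derive1n_theta_bound k; exists M => // h w h0 z.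
have sk i : smooth1 (kern h w i) by move=> j; apply: Ck_affine; exact: smooth1_theta.
rewrite partials_prodf//; split; last first.
  apply: prodf_out => i x xw; apply: derive1n_out xw => y yw.
  by rewrite kern_out//; apply: contra yw => /andP[/ltW -> /ltW ->].
rewrite /prodf normr_prod (bigD1 ord_max)//= mulrC -[leRHS]mul1r.
have cnt (i : 'I_n.+1) : count_mem i (nseq k ord_max) = if i == ord_max then k else 0%N.
  by rewrite count_nseq /= eq_sym; case: eqP => _; rewrite ?mul1n ?mul0n.
apply: ler_pM => //.
- by apply: prodr_ge0 => i _.
- apply: prodr_ile1 => i /negPf imax; rewrite normr_ge0 cnt imax /=.
  by rewrite ger0_norm ?theta_ge0 ?theta_le1.
- rewrite cnt eqxx /kern derive1n_affine; last exact: smooth1_theta.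
  have hV0 : 0 <= h^-1 by rewrite invr_ge0 ltW.
  by rewrite normrM normrX (ger0_norm hV0) mulrC ler_wpM2r// exprn_ge0.
Qed.

Definition cell (h : R) : set pt := box (fun=> 0) (fun=> h).

Lemma muxt_cell h : 0 <= h -> muxt (cell h) = (h ^+ n.+1)%:E.
Proof.
move=> h0; rewrite muxt_box//; congr EFin.
by rewrite prodr_const subr0 card_ord.
Qed.

Definition phik (h : R) : pt -> R := prodf (fun _ x => theta (h^-1 * x)).

Lemma prodf_kern_translate h w z : prodf (kern h w) (translate w z) = phik h z.
Proof.
apply: eq_bigr => i _; rewrite /kern crd_translate; congr theta; ring.
Qed.

Lemma phik_ge0 h z : 0 <= phik h z.
Proof. by apply: prodr_ge0 => i _; exact: theta_ge0. Qed.

Lemma phik_le1 h z : phik h z <= 1.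
Proof. by apply: prodr_ile1 => i _; rewrite theta_ge0 theta_le1. Qed.

Lemma phik_out h z : 0 < h -> ~ cell h z -> phik h z = 0.
Proof.
move=> h0 /existsNP[i /negP zi]; rewrite /phik /prodf (bigD1 i)//= theta_out ?mul0r//.
apply: contra zi; rewrite pmulr_rgt0 ?invr_gt0// => /andP[-> /=].
by rewrite mulrC ltr_pdivrMr// mul1r => /ltW.
Qed.

Lemma measurable_phik h : measurable_fun setT (phik h).
Proof.
apply: measurable_prodf => i; apply: continuous_measurable_line.
move=> x; apply: (@continuous_comp _ _ _ (fun x : R => h^-1 * x) theta).
  by apply: cvgMr; exact: cvg_id.
exact/smooth1_continuous/smooth1_theta.
Qed.

(** A lower bound for the mass of the kernel: [theta] is at least exp(-6) on
    the middle third of its support. *)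
Definition c0 : R := (expR (- 6) / 3) ^+ n.+1.

Lemma c0_gt0 : 0 < c0. Proof. by rewrite exprn_gt0// divr_gt0// expR_gt0. Qed.

Lemma integral_phik h : 0 < h ->
  ((c0 * h ^+ n.+1)%:E <= \int[muxt]_(z in cell h) (phik h z)%:E)%E.
Proof.
move=> h0; pose Q : set pt := box (fun=> h / 3) (fun=> h * (2 / 3)).
have QD : Q `<=` cell h.
  move=> z zQ i; have /andP[z1 z2] := zQ i; apply/andP; split.
    by apply: lt_trans z1; rewrite divr_gt0.
  by apply: (le_trans z2); rewrite ler_piMr ?ltW//; lra.
have mQ : measurable Q by exact: measurable_box.
have mphi := measurable_phik h.
apply: (@le_trans _ _ (\int[muxt]_(z in Q) (phik h z)%:E)%E); last first.
  apply: ge0_subset_integral => //; first exact: measurable_box.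
  - exact/measurable_EFinP/measurable_funTS.
  - by move=> z _; rewrite lee_fin phik_ge0.
apply: (@le_trans _ _ (\int[muxt]_(z in Q) (cst (expR (- 6) ^+ n.+1)%:E z))%E); last first.
  apply: ge0_le_integral => //.
  - by move=> z _; rewrite lee_fin exprn_ge0// expR_ge0.
  - exact/measurable_EFinP/measurable_funTS.
  - move=> z zQ; rewrite lee_fin -[in leLHS](card_ord n.+1) -prodr_const.
    apply: ler_prod => i _; rewrite expR_ge0 /=; apply: theta_ge.
    have /andP[z1 z2] := zQ i; rewrite mulrC ler_pdivlMr// ler_pdivrMr//.
    by rewrite mulrC (ltW z1) mulrC.
rewrite integral_cst// muxt_box; last by move=> i; rewrite ler_wpM2l ?ltW//; lra.
rewrite -EFinM lee_fin prodr_const card_ord /c0 -exprMn -mulrBr -exprMn.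
by rewrite le_eqVlt; apply/orP; left; apply/eqP; congr (_ ^+ _); field.
Qed.

End kernel.

(** * A mean-square bound at a fixed scale *)

Section L2_bound.
Context {R : realType} {n : nat}.
Local Notation pt := ('rV[R]_n * measurableTypeR R)%type.
Local Notation muxt := (lebesgue_xt R n).
Implicit Types (F g : pt -> R) (A B : set pt).

Lemma vec_crd (z : pt) : vec (crd^~ z) = z.
Proof. by apply: crd_inj => i; rewrite crd_vec. Qed.

Lemma mule_swap (x y : R) (I : \bar R) : (x%:E * I * y%:E = (y * x)%:E * I)%E.
Proof. by rewrite muleC muleA EFinM. Qed.

Definition shifts_into (h : R) A B := forall w v, A w ->
  (forall i, 0 <= v i <= h) -> B (translate (vec v) w).

Lemma shifts_into_sub h A B : 0 <= h -> shifts_into h A B -> A `<=` B.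
Proof.
move=> h0 AB w Aw; have := AB w (fun=> 0) Aw.
rewrite (_ : translate _ w = w); last first.
  by apply: crd_inj => i; rewrite crd_translate crd_vec addr0.
by apply => i; rewrite lexx.
Qed.

Lemma shifts_into_cell h A B w z : shifts_into h A B -> A w -> cell h z ->
  B (translate z w).
Proof.
move=> AB Aw zh; rewrite -(vec_crd z); apply: AB => // i.
by have /andP[/ltW -> ->] := zh i.
Qed.

(** [F] is the [k]-th weak time derivative of [g]. Only absolute values of
    these integrals are used, so the sign is left out. *)
Definition deriv_upto_sign (k : nat) g F := forall e a b, admissible e a b ->
  (`|\int[muxt]_z (F z * prodf e z)%:E| =
   `|\int[muxt]_z (g z * partials (@xt_basis R n) (nseq k ord_max) (prodf e) z)%:E|)%E.

Lemma translateC (z w : pt) : translate z w = translate w z.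
Proof. by rewrite /translate addrC. Qed.

Lemma measurable_partials (e : 'I_n.+1 -> R -> R) alpha : (forall i, smooth1 (e i)) ->
  measurable_fun setT (partials (@xt_basis R n) alpha (prodf e) : pt -> R).
Proof.
move=> se; rewrite partials_prodf//; apply: measurable_prodf => i.
apply: continuous_measurable_line; apply: smooth1_continuous.
exact: smooth1_derive1n.
Qed.

Lemma measurable_incr F : measurable_fun setT F ->
  measurable_fun setT (fun wz : pt * pt => F (translate wz.2 wz.1) - F wz.1).
Proof.
move=> mF; apply: measurable_funB; last exact: measurableT_comp mF measurable_fst.
apply: (measurableT_comp mF); apply: measurable_to_pt => i.
rewrite (_ : _ \o _ = (fun wz : pt * pt => crd i wz.1 + crd i wz.2)).
  by apply: measurable_funD; apply: (measurableT_comp (measurable_crd i)).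
by apply/funext => wz /=; rewrite crd_translate.
Qed.

Lemma mean_oscillation F (H : 'I_n.+1 -> pt -> R) A B c d (h : R) :
  locint F -> (forall i, locint (H i)) -> (forall i, product_deriv i F (H i)) ->
  0 < c ord_max -> measurable A -> measurable B -> B `<=` box c d ->
  0 < h -> shifts_into h A B ->
  (\int[muxt]_(w in A) \int[muxt]_(z in cell h) ((F (translate z w) - F w) ^+ 2)%:E <=
   (h ^+ n.+1 * (2 ^+ n.+2 * h ^+ 2))%:E * \int[muxt]_(w in B) (\sum_i H i w ^+ 2)%:E)%E.
Proof.
move=> lF lH FH c_0 mA mB BD h0 AB; have [mF _] := lF.
have mcell : measurable (cell h : set pt) by exact: measurable_box.
have mincr : measurable_fun setT (fun wz : pt * pt => ((F (translate wz.2 wz.1) - F wz.1) ^+ 2)%:E).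
  by apply/measurable_EFinP; apply: measurable_funX; exact: measurable_incr.
rewrite (@tonelli_xt_xt R n A (cell h)
  (fun wz => ((F (translate wz.2 wz.1) - F wz.1) ^+ 2)%:E))//; last first.
  by move=> z; rewrite lee_fin sqr_ge0.
set J := (\int[muxt]_(w in B) _)%E.
have J0 : (0 <= J)%E.
  by apply: integral_ge0 => w _; rewrite lee_fin sumr_ge0// => i _; exact: sqr_ge0.
apply: (@le_trans _ _ (\int[muxt]_(z in cell h) (cst ((2 ^+ n.+2 * h ^+ 2)%:E * J) z))%E).
  apply: ge0_le_integral => //.
  - by move=> z _; apply: integral_ge0 => w _; rewrite lee_fin sqr_ge0.
  - apply: (measurable_tonelli_in2 (@slebesgue_xt R n) mA mcell mincr).
    by move=> z; rewrite lee_fin sqr_ge0.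
  - move=> z zh /=; rewrite -(vec_crd z).
    apply: (translate_L2 lF lH FH c_0 mA mB BD) => // i.
    by have /andP[/ltW -> ->] := zh i.
by rewrite integral_cst// (muxt_cell (ltW h0)) mule_swap.
Qed.

Lemma sqr_split_le (x e : R) (T V : \bar R) : 0 <= x -> 0 <= e -> (0 <= T)%E ->
  (x%:E <= T + e%:E)%E -> (T * T <= V)%E -> ((x ^+ 2)%:E <= 2%:E * V + (2 * e ^+ 2)%:E)%E.
Proof.
case: T => [t||]// x0 e0 t0; last first.
  move=> _; rewrite mulyy leye_eq => /eqP ->.
  by rewrite gt0_muley ?lte_fin// addye// leey.
rewrite -EFinD lee_fin -EFinM => xte tV; rewrite lee_fin in t0.
apply: (@le_trans _ _ (2%:E * (t * t)%:E + (2 * e ^+ 2)%:E)%E).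
  rewrite -EFinM -EFinD lee_fin (@le_trans _ _ ((t + e) ^+ 2))//.
    by rewrite lerXn2r// nnegrE addr_ge0.
  rewrite -subr_ge0 (_ : _ - _ = (t - e) ^+ 2) ?sqr_ge0//; ring.
by rewrite leeD2r// lee_wpmul2l// lee_fin.
Qed.

Lemma lee_div (c X : R) (I : \bar R) : 0 < c -> (c%:E * I <= X%:E -> I <= (X / c)%:E)%E.
Proof.
move=> c_gt0; case: I => [x||]; last by rewrite leNye.
  by rewrite -EFinM !lee_fin ler_pdivlMr// mulrC.
by rewrite gt0_muley ?lte_fin.
Qed.

(** The mass of the kernel times F(w) is the integral of F(w) - F(w + z)
    against the kernel plus the integral of [F] against the kernel placed at
    w. The former is an oscillation; the latter is, up to sign, the integral
    of [g] against [k] derivatives of the kernel, which have size h^-k. *)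
Lemma L2_bound (k : nat) : exists2 M : R, 0 <= M &
  forall F g (H : 'I_n.+1 -> pt -> R) A B c d (h L kap : R),
  locint F -> locint g -> (forall i, locint (H i)) ->
  (forall i, product_deriv i F (H i)) -> deriv_upto_sign k g F ->
  0 < c ord_max -> measurable A -> measurable B -> B `<=` box c d ->
  0 < h -> 0 <= L -> shifts_into h A B ->
  (muxt A <= (kap * h ^+ n.+1)%:E)%E ->
  ((h ^+ 2)%:E * \int[muxt]_(w in B) (\sum_i H i w ^+ 2)%:E <= (h ^+ n.+1 * L ^+ 2)%:E)%E ->
  (\int[muxt]_(w in B) `|g w|%:E <= (L * h ^+ k * h ^+ n.+1)%:E)%E ->
  (\int[muxt]_(w in A) (F w ^+ 2)%:E <=
   ((2 * 2 ^+ n.+2 + 2 * M ^+ 2 * kap) / (@c0 R n) ^+ 2 * h ^+ n.+1 * L ^+ 2)%:E)%E.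
Proof.
have [M M0 HM] := @partials_kern R n k; exists M => //.
move=> F g H A B c d h L kap lF lg lH FH gF c_0 mA mB BD h0 L0 AB Akap HJ gB.
have [mF _] := lF; have [mg _] := lg.
have AB' := shifts_into_sub (ltW h0) AB.
have mcell : measurable (cell h : set pt) by exact: measurable_box.
have hd0 : 0 < h ^+ n.+1 by rewrite exprn_gt0.
have mphi := @measurable_phik R n h.
pose U w : \bar R := (\int[muxt]_(z in cell h) ((F (translate z w) - F w) ^+ 2)%:E)%E.
have U0 w : (0 <= U w)%E by apply: integral_ge0 => z _; rewrite lee_fin sqr_ge0.
have mincr := measurable_incr mF.
have mDel w : measurable_fun setT (fun z => F (translate z w) - F w).
  exact: (measurableT_comp mincr (measurable_pair1 w)).
have mU : measurable_fun setT U.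
  apply: (measurable_tonelli_in (@slebesgue_xt R n) (@measurableT _ pt) mcell
   (f := fun wz : pt * pt => ((F (translate wz.2 wz.1) - F wz.1) ^+ 2)%:E)).
    by apply/measurable_EFinP/measurable_funX.
  by move=> z; rewrite lee_fin sqr_ge0.
have ptw w : A w -> (((@c0 R n * h ^+ n.+1) ^+ 2 * F w ^+ 2)%:E <=
    (2 * h ^+ n.+1)%:E * U w + (2 * (M * L * h ^+ n.+1) ^+ 2)%:E)%E.
  move=> Aw; have w0 : 0 < crd ord_max w.
    by have /andP[cw _] := BD _ (AB' _ Aw) ord_max; exact: lt_trans cw.
  pose T := (\int[muxt]_(z in cell h) (`|F (translate z w) - F w| * phik h z)%:E)%E.
  have T0 : (0 <= T)%E.
    by apply: integral_ge0 => z _; rewrite lee_fin mulr_ge0// phik_ge0.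
  have adm := admissible_kern h0 w0.
  have ib : muxt.-integrable setT (fun z => (F (translate w z) * phik h z)%:E).
    apply/integrableP; split.
      apply/measurable_EFinP/measurable_funM => //.
      apply: (measurableT_comp mF); apply: measurable_to_pt => i.
      rewrite (_ : _ \o _ = (fun z => crd i w + crd i z)).
        by apply: measurable_funD => //; exact: measurable_crd.
      by apply/funext => z /=; rewrite crd_translate addrC.
    have /integrableP[mk] := integrable_admissible lF adm.
    rewrite (@integral_translate R n w (fun z => `|(F z * prodf (kern h w) z)%:E|%E)).
      by under eq_integral do rewrite prodf_kern_translate.
    exact: measurableT_comp.
  have claim1 : ((@c0 R n * h ^+ n.+1 * `|F w|)%:E <= T + (M * L * h ^+ n.+1)%:E)%E.
    have ibc : muxt.-integrable (cell h) (fun z => (F (translate z w) * phik h z)%:E).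
      apply: (@integrableS _ _ _ muxt setT) => //.
      by move: ib; apply: eq_integrable => // z _; rewrite translateC.
    have iphi : muxt.-integrable (cell h) (EFin \o phik h).
      apply: measurable_bounded_integrable => //.
      - exact: muxt_box_lty.
      - exact: measurable_funTS.
      - exists 1; split=> // x x1 z _; apply: le_trans (ltW x1).
        by rewrite ger0_norm ?phik_ge0 ?phik_le1.
    have iac : muxt.-integrable (cell h) (fun z => (F w * phik h z)%:E).
      exact: (integrableZl mcell (F w) iphi).
    have iab : muxt.-integrable (cell h) (fun z => ((F w - F (translate z w)) * phik h z)%:E).
      have := integrableB mcell iac ibc; apply: eq_integrable => // z _.
      by rewrite mulrBl EFinB.
    have Fphi : (`|\int[muxt]_(z in cell h) (F (translate z w) * phik h z)%:E| <=
        (M * L * h ^+ n.+1)%:E)%E.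
      rewrite (_ : (\int[muxt]_(z in cell h) _ = \int[muxt]_z (F z * prodf (kern h w) z)%:E)%E).
        rewrite (gF _ _ _ adm).
        set P := partials _ _ _.
        have mP : measurable_fun setT (P : pt -> R).
          by apply: measurable_partials; case: adm.
        apply: (@le_trans _ _ (\int[muxt]_z `|(g z * P z)%:E|)%E).
          apply: le_abse_integral => //; apply/measurable_EFinP; exact: measurable_funM.
        apply: (@le_trans _ _ (\int[muxt]_(z in B) ((M * h^-1 ^+ k)%:E * `|g z|%:E))%E).
          rewrite [leRHS]integral_mkcond; apply: ge0_le_integral => //.
          - by apply: measurableT_comp => //; apply/measurable_EFinP; exact: measurable_funM.
          - apply/(measurable_restrictT _ mB); apply: measurable_funTS.
            apply: measurable_funeM; apply/measurable_EFinP; exact: measurableT_comp.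
          - move=> z _ /=; rewrite /patch; have [P1 P2] := HM h w h0 z.
            case: ifPn => zB; first by rewrite -EFinM lee_fin normrM mulrC ler_wpM2r.
            rewrite /P P2 ?mulr0 ?normr0// => zw; move/negP: zB; apply; apply: mem_set.
            have := AB w (fun i => crd i z - crd i w) Aw.
            rewrite (_ : translate _ w = z).
              by apply => i; have := zw i; lra.
            by apply: crd_inj => i; rewrite crd_translate crd_vec addrC subrK.
        rewrite ge0_integralZl_EFin//; last 2 first.
        - apply/measurable_EFinP/measurable_funTS; exact: measurableT_comp.
        - by rewrite mulr_ge0// exprn_ge0// invr_ge0 ltW.
        apply: (@le_trans _ _ ((M * h^-1 ^+ k)%:E * (L * h ^+ k * h ^+ n.+1)%:E)%E).
          by rewrite lee_wpmul2l// lee_fin mulr_ge0// exprn_ge0// invr_ge0 ltW.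
        rewrite -EFinM lee_fin le_eqVlt; apply/orP; left; apply/eqP.
        rewrite exprVn; field; rewrite expf_neq0// gt_eqF//.
      rewrite (@integral_translate R n w).
        rewrite [LHS]integral_mkcond; apply: eq_integral => z _; rewrite /patch.
        rewrite prodf_kern_translate translateC; case: ifPn => // zD.
        rewrite phik_out ?mulr0//; move/negP: zD; apply: contra_not; exact: mem_set.
      by apply/measurable_EFinP/measurable_funM => //; exact: measurable_admissible adm.
    apply: (@le_trans _ _ (`|\int[muxt]_(z in cell h) (F w * phik h z)%:E|)%E).
      rewrite (integralZl mcell iphi) abseM mulrC EFinM lee_wpmul2l//.
      by apply: (le_trans (integral_phik h0)); rewrite lee_abs.
    rewrite (_ : (\int[muxt]_(z in cell h) (F w * phik h z)%:E =
      \int[muxt]_(z in cell h) ((F w - F (translate z w)) * phik h z)%:E +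
      \int[muxt]_(z in cell h) (F (translate z w) * phik h z)%:E)%E); last first.
      rewrite -integralD//; apply: eq_integral => z _.
      by rewrite -EFinD mulrBl subrK.
    apply: (le_trans (lee_abs_add _ _)); apply: leeD => //.
    apply: (le_trans (le_abse_integral _ _ _)) => //; first by case/integrableP: iab.
    rewrite le_eqVlt; apply/orP; left; apply/eqP; apply: eq_integral => z _.
    by rewrite /= normrM distrC (ger0_norm (phik_ge0 _ _)).
  have claim2 : (T * T <= (h ^+ n.+1)%:E * U w)%E.
    have cell_le : (muxt (cell h) <= (h ^+ n.+1)%:E)%E by rewrite (muxt_cell (ltW h0)).
    have mh : measurable_fun (cell h) (fun z => `|F (translate z w) - F w| * phik h z).
      by apply: measurable_funTS; apply: measurable_funM => //; exact: measurableT_comp.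
    have := integral_sqr_le mcell cell_le mh => K.
    apply: (le_trans (K _)); first by move=> z _; rewrite mulr_ge0// phik_ge0.
    rewrite lee_wpmul2l ?lee_fin ?(ltW hd0)//; apply: ge0_le_integral => //.
    - by move=> z _; rewrite lee_fin sqr_ge0.
    - by apply/measurable_EFinP; exact: measurable_funX.
    - by apply/measurable_EFinP; apply: measurable_funTS; exact: measurable_funX.
    - move=> z _; rewrite lee_fin exprMn real_normK ?num_real// ler_piMr ?sqr_ge0//.
      by rewrite expr_le1 ?phik_ge0 ?phik_le1.
  have := sqr_split_le _ _ T0 claim1 claim2.
  rewrite exprMn real_normK ?num_real// muleA -EFinM; apply.
  - by rewrite mulr_ge0// mulr_ge0 ?ltW// c0_gt0.
  - by rewrite !mulr_ge0// ltW.
have kap0 : 0 <= kap.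
  by rewrite -(pmulr_lge0 _ hd0) -lee_fin (le_trans _ Akap).
have C0 : 0 < (@c0 R n * h ^+ n.+1) ^+ 2 by rewrite exprn_gt0// mulr_gt0// c0_gt0.
set J := (\int[muxt]_(w in B) _)%E in HJ.
have main : (((@c0 R n * h ^+ n.+1) ^+ 2)%:E * \int[muxt]_(w in A) (F w ^+ 2)%:E <=
   ((2 * 2 ^+ n.+2 + 2 * M ^+ 2 * kap) * (h ^+ n.+1) ^+ 3 * L ^+ 2)%:E)%E.
  rewrite -ge0_integralZl_EFin//; last 3 first.
  - by move=> w _; rewrite lee_fin sqr_ge0.
  - by apply/measurable_EFinP; apply: measurable_funTS; exact: measurable_funX.
  - exact: ltW.
  apply: (@le_trans _ _ (\int[muxt]_(w in A) ((2 * h ^+ n.+1)%:E * U w + cst (2 * (M * L * h ^+ n.+1) ^+ 2)%:E w))%E).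
    apply: ge0_le_integral => //.
    - by move=> w _; rewrite -EFinM lee_fin mulr_ge0 ?sqr_ge0.
    - apply/measurable_EFinP; apply: measurable_funTS; apply: measurable_funM => //.
      exact: measurable_funX.
    - apply: measurable_funTS; apply: emeasurable_funD => //.
      exact: measurable_funeM.
  rewrite ge0_integralD//; last 3 first.
  - by move=> w _; rewrite mule_ge0// lee_fin mulr_ge0// ltW.
  - by apply: measurable_funTS; exact: measurable_funeM.
  - by move=> w _; rewrite lee_fin mulr_ge0// sqr_ge0.
  rewrite integral_cst// ge0_integralZl_EFin//; last 2 first.
  - exact: measurable_funTS.
  - by rewrite mulr_ge0// ltW.
  apply: (@le_trans _ _ ((2 * h ^+ n.+1)%:E * ((h ^+ n.+1 * 2 ^+ n.+2)%:E * (h ^+ n.+1 * L ^+ 2)%:E) +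
     (2 * (M * L * h ^+ n.+1) ^+ 2)%:E * (kap * h ^+ n.+1)%:E)%E).
    apply: leeD; last by rewrite lee_wpmul2l// lee_fin mulr_ge0// sqr_ge0.
    rewrite lee_wpmul2l ?lee_fin ?mulr_ge0 ?(ltW hd0)//.
    apply: (le_trans (mean_oscillation lF lH FH c_0 mA mB BD h0 AB)).
    by rewrite mulrA EFinM -muleA lee_wpmul2l// lee_fin mulr_ge0// ltW.
  rewrite -!EFinM -EFinD lee_fin le_eqVlt; apply/orP; left; apply/eqP.
  set x := h ^+ n.+1; ring.
have := lee_div C0 main; move=> /le_trans; apply.
rewrite lee_fin le_eqVlt; apply/orP; left; apply/eqP.
set x := h ^+ n.+1 in hd0 *.
have := @c0_gt0 R n => c00; field.
by rewrite !gt_eqF.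
Qed.

End L2_bound.

(** * A gain of integrability *)

Section level_sets.
Local Open Scope ereal_scope.
Context d (T : measurableType d) (R : realType) (mu : {measure set T -> \bar R}).

Lemma powR_levels (N : nat) (x : R) : (0 < N)%N -> (1 < x)%R ->
  exists k, ((2 ^+ (k * N)) < x)%R /\ (x `^ (1 + N%:R^-1) <= 2 ^+ k.+1 * x)%R.
Proof.
move=> N0 x1.
have exk : exists k, (x <= 2 ^+ (k * N))%R.
  exists (Num.truncn x).+1; apply: (@le_trans _ _ ((Num.truncn x).+1%:R)%R).
    by rewrite ltW// truncnS_gt.
  rewrite -natrX ler_nat (leq_trans (ltnW (ltn_expl _ (ltnSn 1))))//.
  by rewrite leq_exp2l// leq_pmulr.
have [] := ex_minnP exk => -[|k] xk mink.
  by move: xk; rewrite mul0n expr0 leNgt x1.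
exists k; split.
  by rewrite ltNge; apply/negP => /mink; rewrite ltnn.
have x0 : (0 <= x)%R by apply: ltW; exact: lt_trans x1.
have NR : (0 < N%:R :> R)%R by rewrite ltr0n.
rewrite powRD; last by rewrite (gt_eqF (lt_trans ltr01 x1)) implybT.
rewrite powRr1// mulrC ler_wpM2r//.
apply: (@le_trans _ _ ((2 ^+ (k.+1 * N)) `^ N%:R^-1)%R).
  by apply: ge0_ler_powR; rewrite ?nnegrE ?invr_ge0 ?exprn_ge0.
rewrite -powR_mulrn// natrM -powRrM mulfK ?gt_eqF//.
by rewrite powR_mulrn.
Qed.

(** Where 2^(k N) < X <= 2^((k + 1) N) one has X^(1 + 1/N) <= 2^(k + 1) X, so
    the decay 4^-k of the integrals over the superlevel sets is summable. *)
Lemma level_sum (A : set T) (X : T -> R) (N : nat) (C : R) : (0 < N)%N ->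
  measurable A -> measurable_fun A X -> (forall x, A x -> 0 <= X x)%R -> (0 <= C)%R ->
  (forall k, \int[mu]_(x in A `&` [set x | (2 ^+ (k * N) < X x)%R]) (X x)%:E <=
     (C / 4 ^+ k)%:E) ->
  \int[mu]_(x in A) (X x `^ (1 + N%:R^-1))%:E <= mu A + (4 * C)%:E.
Proof.
move=> N0 mA mX X0 C0 HC.
pose S k := A `&` [set x | (2 ^+ (k * N) < X x)%R].
have mS k : measurable (S k).
  rewrite /S (_ : [set x | _] = X @^-1` [set` Interval (BRight (2 ^+ (k * N))%R) +oo%O]); last first.
    by apply/seteqP; split=> x /=; rewrite in_itv /= andbT.
  by apply: mX => //; exact: measurable_itv.
pose f k x := (2 ^+ k.+1)%:E * ((EFin \o X) \_ (S k)) x.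
have mXS k : measurable_fun A ((EFin \o X) \_ (S k)).
  apply: measurable_funTS; apply/(measurable_restrictT _ (mS k)).
  apply/measurable_EFinP; apply: measurable_funS mX => //.
  exact: subIsetl.
have mf k : measurable_fun A (f k) by apply: measurable_funeM.
have XS0 k x : A x -> 0 <= ((EFin \o X) \_ (S k)) x.
  by move=> Ax; rewrite /patch; case: ifP => // _; rewrite lee_fin X0.
have f0 k x : A x -> 0 <= f k x.
  by move=> Ax; rewrite /f mule_ge0// XS0.
have mpow : measurable_fun A (fun x => (X x `^ (1 + N%:R^-1))%:E).
  apply/measurable_EFinP; apply: (measurableT_comp (f := fun y => y `^ (1 + N%:R^-1))%R) => //.
apply: (@le_trans _ _ (\int[mu]_(x in A) (cst 1 x + \sum_(0 <= k <oo) f k x))).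
  apply: ge0_le_integral => //.
  - by move=> x _; rewrite lee_fin powR_ge0.
  - by apply: emeasurable_funD => //; apply: ge0_emeasurable_sum => //; move=> k x Ax _; exact: f0.
  - move=> x Ax; have [x1|x1] := leP (X x) 1%R.
      rewrite -[leLHS]adde0; apply: leeD.
        have e0 : (0 <= 1 + N%:R^-1 :> R)%R by rewrite addr_ge0 ?invr_ge0.
        have := @ge0_ler_powR R _ e0 (X x) 1%R; rewrite powR1 /= => K.
        by rewrite lee_fin; apply: K; rewrite ?nnegrE ?ler01//; exact: X0.
      by apply: nneseries_ge0 => k _ _; exact: f0.
    have [k [xk xk2]] := powR_levels N0 x1.
    have fk : (X x `^ (1 + N%:R^-1))%:E <= f k x.
      rewrite /f /patch mem_set; last by split.
      by rewrite /= -EFinM lee_fin.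
    apply: (le_trans fk); rewrite -[leLHS]add0e; apply: leeD => //.
    rewrite (nneseries_split 0%N k.+1); last by move=> *; exact: f0.
    rewrite add0n big_nat_recr//=.
    apply: (@le_trans _ _ (\sum_(0 <= i < k) f i x + f k x)).
      by rewrite leeDr//; apply: sume_ge0 => i _; exact: f0.
    by rewrite leeDl//; apply: nneseries_ge0 => i _ _; exact: f0.
rewrite ge0_integralD//; last 2 first.
- by move=> x Ax; apply: nneseries_ge0 => k _ _; exact: f0.
- by apply: ge0_emeasurable_sum => //; move=> k x Ax _; exact: f0.
rewrite integral_cst// mul1e leeD2l// integral_nneseries//.
apply: (@le_trans _ _ (\sum_(0 <= k <oo) (0 + (4 * C / (2 ^ k.+1)%:R)%:E))).
  apply: lee_nneseries => [k _ _|k _].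
    by apply: integral_ge0 => x Ax; exact: f0.
  rewrite add0e /f ge0_integralZl_EFin//; last by move=> x Ax; exact: XS0.
  rewrite -integral_mkcondr (setIidr (@subIsetl _ A _)).
  apply: (@le_trans _ _ ((2 ^+ k.+1)%:E * (C / 4 ^+ k)%:E)).
    by rewrite lee_wpmul2l//; exact: HC.
  rewrite -EFinM lee_fin natrX (_ : 4 = 2 * 2)%R; last by lra.
  rewrite exprMn le_eqVlt; apply/orP; left; apply/eqP; rewrite !exprS; field.
  by rewrite expf_neq0.
have := @epsilon_trick R (fun=> 0) (4 * C)%R xpredT (fun=> lexx _) (mulr_ge0 (ler0n _ 4) C0).
by rewrite [X in _ <= X + _]eseries0 ?add0e.
Qed.

End level_sets.

Section self_improvement.
Context {R : realType} {n : nat}.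
Local Notation pt := ('rV[R]_n * measurableTypeR R)%type.
Local Notation muxt := (lebesgue_xt R n).
Implicit Types (F g : pt -> R) (A B : set pt).

(** Average F(w)^2 <= 2 (F(w + z) - F(w))^2 + 2 F(w + z)^2 over z in the cell:
    when F(w)^2 is large the last term is at most half of the left side. *)
Lemma oscillation_on_large F A A1 (h I : R) (w : pt) : locint F -> 0 < h ->
  measurable A1 -> shifts_into h A A1 ->
  (\int[muxt]_(w in A1) (F w ^+ 2)%:E <= I%:E)%E -> A w ->
  4 * I <= h ^+ n.+1 * F w ^+ 2 ->
  ((h ^+ n.+1 * F w ^+ 2)%:E <=
    4%:E * \int[muxt]_(z in cell h) ((F (translate z w) - F w) ^+ 2)%:E)%E.
Proof.
move=> lF h0 mA1 AA1 IA1 Aw Fbig; have [mF _] := lF.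
have mcell : measurable (cell h : set pt) by exact: measurable_box.
have mFt : measurable_fun setT (fun z => F (translate z w)).
  rewrite (_ : (fun z => _) = (fun z => F (translate w z))).
    by apply: (measurableT_comp mF); exact: measurable_translate.
  by apply/funext => z; rewrite translateC.
set U := (\int[muxt]_(z in cell h) _)%E.
have U0 : (0 <= U)%E by apply: integral_ge0 => z _; rewrite lee_fin sqr_ge0.
have hF : ((h ^+ n.+1 * F w ^+ 2)%:E <= 2%:E * U + (2 * I)%:E)%E.
  apply: (@le_trans _ _ (\int[muxt]_(z in cell h) (cst (F w ^+ 2)%:E z))%E).
    by rewrite integral_cst// (muxt_cell (ltW h0)) -EFinM mulrC.
  apply: (@le_trans _ _ (\int[muxt]_(z in cell h) (2%:E * ((F (translate z w) - F w) ^+ 2)%:E +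
      2%:E * (F (translate z w) ^+ 2)%:E))%E).
    apply: ge0_le_integral => //.
    - by move=> z _; rewrite lee_fin sqr_ge0.
    - by apply: measurable_funTS; apply: emeasurable_funD; apply: measurable_funeM;
        apply/measurable_EFinP; apply: measurable_funX => //; exact: measurable_funB.
    - move=> z _; rewrite -!EFinM -EFinD lee_fin; set x := F _; set y := F _.
      rewrite -subr_ge0 (_ : _ - _ = (x - 2 * y) ^+ 2) ?sqr_ge0//; ring.
  rewrite ge0_integralD//; last 4 first.
  - by move=> z _; rewrite mule_ge0// lee_fin sqr_ge0.
  - by apply: measurable_funTS; apply: measurable_funeM;
      apply/measurable_EFinP; apply: measurable_funX => //; exact: measurable_funB.
  - by move=> z _; rewrite mule_ge0// lee_fin sqr_ge0.
  - by apply: measurable_funTS; apply: measurable_funeM;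
      apply/measurable_EFinP; exact: measurable_funX.
  rewrite !ge0_integralZl_EFin//; last 4 first.
  - by move=> z _; rewrite lee_fin sqr_ge0.
  - by apply: measurable_funTS; apply/measurable_EFinP; exact: measurable_funX.
  - by move=> z _; rewrite lee_fin sqr_ge0.
  - by apply: measurable_funTS; apply/measurable_EFinP; apply: measurable_funX => //; exact: measurable_funB.
  rewrite leeD2l// EFinM lee_wpmul2l//; apply: le_trans IA1.
  rewrite (_ : (\int[muxt]_(z in cell h) _ = \int[muxt]_(z in cell h) (F (translate w z) ^+ 2)%:E)%E).
    apply: (@ge0_integral_translate_le R n w (cell h) A1 (fun z => (F z ^+ 2)%:E)) => //.
    - by apply/measurable_EFinP; exact: measurable_funX.
    - by move=> z; rewrite lee_fin sqr_ge0.
    - by move=> z zh; rewrite translateC; exact: (shifts_into_cell AA1).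
  by apply: eq_integral => z _; rewrite translateC.
move: U0 hF; case: (U) => [u||]// u0; last by rewrite !gt0_muley ?lte_fin// leey.
rewrite -!EFinM -EFinD !lee_fin => hF; lra.
Qed.

(** On the level 2^(k (n + 1)) of the normalised square of [F] the cell of size
    h / 2^k is used in [oscillation_on_large]: its volume h^(n + 1) / 2^(k (n + 1))
    matches the level, and [mean_oscillation] gives the decay 4^-k. *)
Lemma self_improvement F (H : 'I_n.+1 -> pt -> R) A A1 B c d (h L K1 kap : R) :
  locint F -> (forall i, locint (H i)) -> (forall i, product_deriv i F (H i)) ->
  0 < c ord_max -> measurable A -> measurable A1 -> measurable B -> B `<=` box c d ->
  0 < h -> 0 < L -> 1 <= K1 -> shifts_into h A A1 -> shifts_into h A B ->
  (muxt A <= (kap * h ^+ n.+1)%:E)%E ->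
  ((h ^+ 2)%:E * \int[muxt]_(w in B) (\sum_i H i w ^+ 2)%:E <= (h ^+ n.+1 * L ^+ 2)%:E)%E ->
  (\int[muxt]_(w in A1) (F w ^+ 2)%:E <= (K1 * h ^+ n.+1 * L ^+ 2)%:E)%E ->
  (\int[muxt]_(w in A) ((F w ^+ 2 / (4 * K1 * L ^+ 2)) `^ (1 + n.+1%:R^-1))%:E <=
   ((kap + 2 ^+ n.+4) * h ^+ n.+1)%:E)%E.
Proof.
move=> lF lH FH c_0 mA mA1 mB BD h0 L0 K11 AA1 AB Akap HJ FA1; have [mF _] := lF.
have K10 : 0 < K1 by exact: lt_le_trans K11.
have hd0 : 0 < h ^+ n.+1 by rewrite exprn_gt0.
have D0 : 0 < 4 * K1 * L ^+ 2 by rewrite !mulr_gt0// exprn_gt0.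
pose X w := F w ^+ 2 / (4 * K1 * L ^+ 2).
have X0 w : 0 <= X w by rewrite divr_ge0 ?sqr_ge0// ltW.
have mX : measurable_fun setT X by apply: measurable_funM => //; exact: measurable_funX.
have := @level_sum _ _ R muxt A X n.+1 (2 ^+ n.+2 * h ^+ n.+1) isT mA
   (measurable_funTS mX) (fun w _ => X0 w).
have C0 : 0 <= 2 ^+ n.+2 * h ^+ n.+1 by rewrite mulr_ge0 ?exprn_ge0// ltW.
move=> /(_ C0) K; apply: (le_trans (K _)); last first.
  apply: (@le_trans _ _ ((kap * h ^+ n.+1)%:E + (4 * (2 ^+ n.+2 * h ^+ n.+1))%:E)%E).
    exact: leeD.
  rewrite -EFinD lee_fin [leRHS]mulrDl mulrA.
  by rewrite (_ : 4 * 2 ^+ n.+2 = 2 ^+ n.+4)// !exprS; ring.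
move=> k; pose hk := h / 2 ^+ k.
have hk0 : 0 < hk by rewrite divr_gt0// exprn_gt0.
have hkh : hk <= h by rewrite ler_pdivrMr ?exprn_gt0// ler_peMr ?(ltW h0)// exprn_ege1// ler1n.
have AA1k : shifts_into hk A A1.
  move=> w v Aw v0; apply: AA1 => // i; have /andP[-> /=] := v0 i.
  by move/le_trans; apply.
have ABk : shifts_into hk A B.
  move=> w v Aw v0; apply: AB => // i; have /andP[-> /=] := v0 i.
  by move/le_trans; apply.
set S := A `&` _.
have mS : measurable S.
  rewrite /S (_ : [set w | _] = X @^-1` [set` Interval (BRight (2 ^+ (k * n.+1))) +oo%O]).
    apply: measurableI => //; rewrite -[X in measurable X]setTI.
    by apply: mX => //; exact: measurable_itv.
  by apply/seteqP; split=> w /=; rewrite in_itv /= andbT.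
have hdk0 : 0 < hk ^+ n.+1 by rewrite exprn_gt0.
have hkE : hk ^+ n.+1 * 2 ^+ (k * n.+1) = h ^+ n.+1.
  by rewrite exprM -exprMn /hk divfK// expf_neq0.
have mincr := measurable_incr mF.
pose U w : \bar R := (\int[muxt]_(z in cell hk) ((F (translate z w) - F w) ^+ 2)%:E)%E.
have U0 w : (0 <= U w)%E by apply: integral_ge0 => z _; rewrite lee_fin sqr_ge0.
have mU : measurable_fun setT U.
  apply: (measurable_tonelli_in (@slebesgue_xt R n) (@measurableT _ pt) (@measurable_box R n _ _)
   (f := fun wz : pt * pt => ((F (translate wz.2 wz.1) - F wz.1) ^+ 2)%:E)).
    by apply/measurable_EFinP; exact: measurable_funX.
  by move=> z; rewrite lee_fin sqr_ge0.
pose e := hk ^+ n.+1 * (4 * K1 * L ^+ 2).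
have e0 : 0 < e by rewrite mulr_gt0.
have step : (e%:E * \int[muxt]_(w in S) (X w)%:E <=
    4%:E * \int[muxt]_(w in A) U w)%E.
  rewrite -ge0_integralZl_EFin//; last 3 first.
  - by move=> w _; rewrite lee_fin.
  - by apply/measurable_EFinP; exact: measurable_funTS.
  - exact: ltW.
  rewrite -ge0_integralZl_EFin//; last exact: measurable_funTS.
  apply: (@le_trans _ _ (\int[muxt]_(w in S) (4%:E * U w))%E); last first.
    apply: ge0_subset_integral => //.
    - by apply: measurable_funeM; exact: measurable_funTS.
    - by move=> w _; rewrite mule_ge0.
    - exact: subIsetl.
  apply: ge0_le_integral => //.
  - by move=> w _; rewrite -EFinM lee_fin (mulr_ge0 (ltW e0) (X0 w)).
  - by apply: measurable_funeM; apply/measurable_EFinP; exact: measurable_funTS.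
  - by apply: measurable_funeM; exact: measurable_funTS.
  - move=> w [Aw /= Xw].
    have -> : (e%:E * (X w)%:E = (hk ^+ n.+1 * F w ^+ 2)%:E)%E.
      by rewrite -EFinM; congr EFin; rewrite /e /X; field; rewrite !gt_eqF.
    apply: (oscillation_on_large lF hk0 mA1 AA1k FA1 Aw).
    move: Xw; rewrite /X ltr_pdivlMr// => Xw.
    apply: (@le_trans _ _ (hk ^+ n.+1 * (2 ^+ (k * n.+1) * (4 * K1 * L ^+ 2)))); last first.
      by rewrite ler_wpM2l ?(ltW hdk0)// ltW.
    by rewrite [leRHS]mulrA hkE le_eqVlt; apply/orP; left; apply/eqP; ring.
have osc := mean_oscillation lF lH FH c_0 mA mB BD hk0 ABk.
have tot : (e%:E * \int[muxt]_(w in S) (X w)%:E <=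
    (4 * (hk ^+ n.+1 * (2 ^+ n.+2 * (h ^+ n.+1 * L ^+ 2 / 4 ^+ k))))%:E)%E.
  apply: (le_trans step); rewrite EFinM lee_wpmul2l//; apply: (le_trans osc).
  pose c1 := hk ^+ n.+1 * 2 ^+ n.+2 / 4 ^+ k.
  have c1_0 : (0 <= c1%:E)%E.
    by rewrite lee_fin divr_ge0 ?exprn_ge0// mulr_ge0 ?(ltW hdk0)// exprn_ge0.
  have hk2 : hk ^+ 2 = h ^+ 2 / 4 ^+ k.
    by rewrite /hk exprMn exprVn -exprM mulnC exprM (_ : 2 ^+ 2 = 4)//; rewrite expr2; lra.
  rewrite (_ : hk ^+ n.+1 * (2 ^+ n.+2 * hk ^+ 2) = c1 * h ^+ 2); last first.
    by rewrite hk2 /c1; ring.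
  rewrite EFinM -muleA; apply: (le_trans (lee_wpmul2l c1_0 HJ)).
  by rewrite -EFinM lee_fin le_eqVlt; apply/orP; left; apply/eqP; rewrite /c1; ring.
have := lee_div e0 tot; move=> /le_trans; apply.
rewrite lee_fin /e.
have -> : 4 * (hk ^+ n.+1 * (2 ^+ n.+2 * (h ^+ n.+1 * L ^+ 2 / 4 ^+ k))) / (hk ^+ n.+1 * (4 * K1 * L ^+ 2)) =
   (2 ^+ n.+2 * h ^+ n.+1 / 4 ^+ k) / K1.
  field; rewrite !gt_eqF// exprn_gt0//.
by rewrite ler_pdivrMr// ler_peMr// divr_ge0 ?exprn_ge0.
Qed.

End self_improvement.

Section local_average.
Context {R : realType} {n : nat}.
Local Notation pt := ('rV[R]_n * measurableTypeR R)%type.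
Local Notation muxt := (lebesgue_xt R n).
Implicit Types (F g : pt -> R) (A B : set pt).

Lemma powR_interp (x q r : R) : 0 <= x -> 0 < q -> q <= r ->
  x `^ q <= q / r * x `^ r + (1 - q / r).
Proof.
move=> x0 q0; rewrite le_eqVlt => /predU1P[<-|qr].
  by rewrite divff ?gt_eqF// mul1r subrr addr0.
have r0 : 0 < r by exact: lt_trans qr.
have rq0 : 0 < r - q by rewrite subr_gt0.
have := @conjugate_powR R (x `^ q) 1 (r / q) (r / (r - q)) (powR_ge0 _ _) ler01
  (divr_gt0 r0 q0) (divr_gt0 r0 rq0).
rewrite -powRrM powR1 mulr1 !invf_div => K.
apply: (le_trans (K _)); first by field; rewrite gt_eqF.
rewrite (_ : q * (r / q) = r); last by field; rewrite gt_eqF.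
rewrite le_eqVlt; apply/orP; left; apply/eqP; field; rewrite gt_eqF//.
Qed.

Lemma powR_mean_le (a b s : R) : 0 <= a -> 0 <= b -> 0 <= s ->
  ((a + b) / 2) `^ s <= a `^ s + b `^ s.
Proof.
wlog ab : a b / a <= b.
  move=> wl a0 b0 s0; have [ab|/ltW ba] := leP a b; first exact: wl.
  by rewrite addrC [leRHS]addrC; exact: wl.
move=> a0 b0 s0; apply: (@le_trans _ _ (b `^ s)); last by rewrite lerDr powR_ge0.
by apply: ge0_ler_powR; rewrite ?nnegrE//; lra.
Qed.

Lemma powR_shrink (x N s : R) : 0 <= x -> 1 <= N -> 1 <= s ->
  (x / N) `^ s <= x `^ s / N.
Proof.
move=> x0 N1 s1; have N0 : 0 < N by exact: lt_le_trans N1.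
rewrite powRM ?invr_ge0 ?(ltW N0)// ler_wpM2l ?powR_ge0//.
by apply: ge1r_powR => //; rewrite invr_gt0 N0 invf_le1.
Qed.

Definition weak_system (k : nat) F g (H : 'I_n.+1 -> pt -> R) :=
  [/\ locint F, locint g, forall i, locint (H i),
      forall i, product_deriv i F (H i) & deriv_upto_sign k g F].

(** The output of [L2_bound] is the input of [self_improvement]. Two systems are
    treated together, for the real and the imaginary part of one function. *)
Lemma local_average (k : nat) (kap : R) : 0 <= kap -> exists2 K : R, 0 < K &
  forall F1 F2 g1 g2 (H1 H2 : 'I_n.+1 -> pt -> R) W A1 B c d (h L q : R),
  weak_system k F1 g1 H1 -> weak_system k F2 g2 H2 ->
  0 < c ord_max -> measurable W -> measurable A1 -> measurable B -> B `<=` box c d ->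
  0 < h -> 0 < L -> shifts_into h W A1 -> shifts_into h A1 B ->
  (muxt A1 <= (kap * h ^+ n.+1)%:E)%E -> ((h ^+ n.+1)%:E <= muxt W)%E ->
  ((h ^+ 2)%:E * \int[muxt]_(w in B) (\sum_i H1 i w ^+ 2)%:E <= (h ^+ n.+1 * L ^+ 2)%:E)%E ->
  ((h ^+ 2)%:E * \int[muxt]_(w in B) (\sum_i H2 i w ^+ 2)%:E <= (h ^+ n.+1 * L ^+ 2)%:E)%E ->
  (\int[muxt]_(w in B) `|g1 w|%:E <= (L * h ^+ k * h ^+ n.+1)%:E)%E ->
  (\int[muxt]_(w in B) `|g2 w|%:E <= (L * h ^+ k * h ^+ n.+1)%:E)%E ->
  0 < q <= 2 * (1 + n.+1%:R^-1) ->
  (\int[muxt]_(w in W) ((Num.sqrt (F1 w ^+ 2 + F2 w ^+ 2) / (K * L)) `^ q)%:E <= muxt W)%E.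
Proof.
move=> kap0; have [M M0 L2] := @L2_bound R n k.
pose K1 := 1 + (2 * 2 ^+ n.+2 + 2 * M ^+ 2 * kap) / (@c0 R n) ^+ 2.
have K0 : 0 <= (2 * 2 ^+ n.+2 + 2 * M ^+ 2 * kap) / (@c0 R n) ^+ 2.
  have A0 : 0 <= 2 * 2 ^+ n.+2 :> R by rewrite mulr_ge0 ?exprn_ge0.
  have B0 : 0 <= 2 * M ^+ 2 * kap by rewrite !mulr_ge0 ?sqr_ge0.
  exact: divr_ge0 (addr_ge0 A0 B0) (sqr_ge0 _).
have K11 : 1 <= K1 by rewrite lerDl.
pose N : R := 2 * (kap + 2 ^+ n.+4).
have p2 m : 1 <= 2 ^+ m :> R by rewrite exprn_ege1// ler1n.
have N1 : 1 <= N by have := p2 n.+4; rewrite /N; lra.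
have N0 : 0 < N by exact: lt_le_trans N1.
have K10 : 0 < K1 by exact: lt_le_trans K11.
pose K := Num.sqrt (8 * N * K1).
have NK0 : 0 < 8 * N * K1 by apply: mulr_gt0 => //; apply: mulr_gt0.
have K2 : K ^+ 2 = 8 * N * K1 by rewrite /K sqr_sqrtr// ltW.
have Kgt0 : 0 < K by rewrite sqrtr_gt0.
exists K => // F1 F2 g1 g2 H1 H2 W A1 B c d h L q.
move=> [lF1 lg1 lH1 FH1 gF1] [lF2 lg2 lH2 FH2 gF2] c_0 mW mA1 mB BD h0 L0 WA1 A1B.
move=> A1kap Wh HJ1 HJ2 gB1 gB2 /andP[q0 qs].
have hd0 : 0 < h ^+ n.+1 by rewrite exprn_gt0.
have A1B' := shifts_into_sub (ltW h0) A1B.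
have WB : shifts_into h W B by move=> w v Ww v0; apply: A1B'; exact: WA1.
have Wkap : (muxt W <= (kap * h ^+ n.+1)%:E)%E.
  apply: le_trans A1kap; apply: le_measure; rewrite ?inE//.
  exact: shifts_into_sub (ltW h0) WA1.
have L2' F g H : locint F -> locint g -> (forall i, locint (H i)) ->
  (forall i, product_deriv i F (H i)) -> deriv_upto_sign k g F ->
  ((h ^+ 2)%:E * \int[muxt]_(w in B) (\sum_i H i w ^+ 2)%:E <= (h ^+ n.+1 * L ^+ 2)%:E)%E ->
  (\int[muxt]_(w in B) `|g w|%:E <= (L * h ^+ k * h ^+ n.+1)%:E)%E ->
  (\int[muxt]_(w in A1) (F w ^+ 2)%:E <= (K1 * h ^+ n.+1 * L ^+ 2)%:E)%E.
  move=> lF lg lH FH gF HJ gB.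
  apply: (le_trans (L2 F g H A1 B c d h L kap lF lg lH FH gF c_0 mA1 mB BD h0 (ltW L0) A1B A1kap HJ gB)).
  by rewrite lee_fin !ler_wpM2r ?sqr_ge0 ?(ltW hd0)// lerDr.
have I1 := L2' _ _ _ lF1 lg1 lH1 FH1 gF1 HJ1 gB1.
have I2 := L2' _ _ _ lF2 lg2 lH2 FH2 gF2 HJ2 gB2.
(* The squares of F1 and F2 are now controlled with exponent s = 1 + 1 / (n + 1). *)
have S1 := self_improvement lF1 lH1 FH1 c_0 mW mA1 mB BD h0 L0 K11 WA1 WB Wkap HJ1 I1.
have S2 := self_improvement lF2 lH2 FH2 c_0 mW mA1 mB BD h0 L0 K11 WA1 WB Wkap HJ2 I2.
set s : R := 1 + n.+1%:R^-1 in S1 S2 qs.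
have s1 : 1 <= s by rewrite lerDl invr_ge0.
have s0 : 0 < s by exact: lt_le_trans s1.
set D := 4 * K1 * L ^+ 2 in S1 S2.
have D0 : 0 < D by rewrite !mulr_gt0// exprn_gt0.
have [mF1 _] := lF1; have [mF2 _] := lF2.
pose X w := Num.sqrt (F1 w ^+ 2 + F2 w ^+ 2) / (K * L).
have X0 w : 0 <= X w by rewrite divr_ge0 ?sqrtr_ge0// mulr_ge0 ?ltW.
have mX : measurable_fun setT X.
  apply: measurable_funM => //.
  apply: (measurableT_comp (f := @Num.sqrt R)).
    apply: continuous_measurable_fun; exact: sqrt_continuous.
  by apply: measurable_funD; exact: measurable_funX.
have mpow F r : measurable_fun setT F -> measurable_fun W (fun w => (F w `^ r)%:E).
  move=> mF; apply/measurable_EFinP; apply: measurable_funTS.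
  exact: (measurableT_comp (f := fun y => y `^ r)).
have Xs w : X w `^ (2 * s) <= ((F1 w ^+ 2 / D) `^ s + (F2 w ^+ 2 / D) `^ s) / N.
  have a0 F : 0 <= F w ^+ 2 / D by rewrite divr_ge0 ?sqr_ge0// ltW.
  rewrite powRrM powR_mulrn//.
  have -> : X w ^+ 2 = ((F1 w ^+ 2 / D + F2 w ^+ 2 / D) / 2) / N.
    rewrite /X expr_div_n exprMn sqr_sqrtr ?addr_ge0 ?sqr_ge0// K2 /D.
    by field; rewrite !gt_eqF.
  have ab0 : 0 <= (F1 w ^+ 2 / D + F2 w ^+ 2 / D) / 2.
    by rewrite divr_ge0// addr_ge0.
  apply: (le_trans (powR_shrink ab0 N1 s1)); rewrite ler_wpM2r ?invr_ge0 ?(ltW N0)//.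
  exact: powR_mean_le (ltW s0).
have mXs : (\int[muxt]_(w in W) (X w `^ (2 * s))%:E <= muxt W)%E.
  apply: (@le_trans _ _ (\int[muxt]_(w in W) (N^-1%:E * ((F1 w ^+ 2 / D) `^ s)%:E + N^-1%:E * ((F2 w ^+ 2 / D) `^ s)%:E))%E).
    apply: ge0_le_integral => //.
    - by move=> w _; rewrite lee_fin powR_ge0.
    - exact: mpow.
    - apply: emeasurable_funD; apply: measurable_funeM; apply: mpow; apply: measurable_funM => //; exact: measurable_funX.
    - by move=> w _; rewrite -!EFinM -EFinD lee_fin -mulrDr [leRHS]mulrC; exact: Xs.
  have NV0 : 0 <= N^-1 by rewrite invr_ge0 ltW.
  rewrite ge0_integralD//; last 4 first.
  - by move=> w _; rewrite -EFinM lee_fin mulr_ge0// powR_ge0.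
  - by apply: measurable_funeM; apply: mpow; apply: measurable_funM => //; exact: measurable_funX.
  - by move=> w _; rewrite -EFinM lee_fin mulr_ge0// powR_ge0.
  - by apply: measurable_funeM; apply: mpow; apply: measurable_funM => //; exact: measurable_funX.
  rewrite !ge0_integralZl_EFin//; last 4 first.
  - by move=> w _; rewrite lee_fin powR_ge0.
  - by apply: mpow; apply: measurable_funM => //; exact: measurable_funX.
  - by move=> w _; rewrite lee_fin powR_ge0.
  - by apply: mpow; apply: measurable_funM => //; exact: measurable_funX.
  apply: le_trans Wh.
  apply: (@le_trans _ _ (N^-1%:E * ((kap + 2 ^+ n.+4) * h ^+ n.+1)%:E + N^-1%:E * ((kap + 2 ^+ n.+4) * h ^+ n.+1)%:E)%E).
    have NV0' : (0%R <= N^-1%:E)%E by rewrite lee_fin.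
    exact: (leeD (lee_wpmul2l NV0' S1) (lee_wpmul2l NV0' S2)).
  rewrite -EFinM -EFinD lee_fin le_eqVlt; apply/orP; left; apply/eqP.
  have kapN : kap + 2 ^+ n.+4 = N / 2 by rewrite /N; field.
  by rewrite kapN; field; rewrite gt_eqF.
(* Young's inequality lowers the exponent from 2 s to q. *)
have s20 : 0 < 2 * s by rewrite mulr_gt0.
have r0 : 0 <= q / (2 * s) by rewrite divr_ge0 ?ltW.
have r1 : 0 <= 1 - q / (2 * s) by rewrite subr_ge0 ler_pdivrMr// mul1r.
apply: (@le_trans _ _ (\int[muxt]_(w in W) ((q / (2 * s))%:E * (X w `^ (2 * s))%:E + cst (1 - q / (2 * s))%:E w))%E).
  apply: ge0_le_integral => //.
  - by move=> w _; rewrite lee_fin powR_ge0.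
  - exact: mpow.
  - by apply: emeasurable_funD => //; apply: measurable_funeM; exact: mpow.
  - by move=> w _; rewrite -EFinM -EFinD lee_fin; exact: (powR_interp (X0 w) q0 qs).
rewrite ge0_integralD//; last 2 first.
- by move=> w _; rewrite -EFinM lee_fin mulr_ge0// powR_ge0.
- by apply: measurable_funeM; exact: mpow.
rewrite integral_cst// ge0_integralZl_EFin//; last 2 first.
- by move=> w _; rewrite lee_fin powR_ge0.
- exact: mpow.
apply: (@le_trans _ _ ((q / (2 * s))%:E * muxt W + (1 - q / (2 * s))%:E * muxt W)%E).
  by rewrite leeD2r// lee_wpmul2l.
by rewrite -ge0_muleDl ?lee_fin// -EFinD subrKC mul1e.
Qed.

End local_average.

(** * Weak derivatives of complex functions *)

Section weak_derivatives.
Context {R : realType} {n : nat}.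
Local Notation C := R[i].
Local Notation pt := ('rV[R]_n * measurableTypeR R)%type.
Local Notation muxt := (lebesgue_xt R n).
Implicit Types (F G u : pt -> C) (b : bool) (e : 'I_n.+1 -> R -> R).

Definition part b (z : C) : R := if b then complex.Re z else complex.Im z.

Definition zpart b F : pt -> R := (fun z => part b (F z)) \_ upper.

Lemma part_scale b (z : C) (r : R) : part b (z * r%:C%C) = part b z * r.
Proof. by case: b z => -[x y] /=; rewrite mulr0 ?subr0 ?add0r // addrC. Qed.

Lemma part_le b (z : C) : `|part b z| <= cmod z.
Proof.
case: z => x y; rewrite /cmod /= -sqrtr_sqr; case: b => /=; apply: ler_wsqrtr.
  by rewrite lerDl sqr_ge0.
by rewrite lerDr sqr_ge0.
Qed.

Lemma measurable_upper : measurable (upper : set pt).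
Proof.
rewrite (_ : upper = crd ord_max @^-1` `]0, +oo[%classic).
  by rewrite -[X in measurable X]setTI; apply: measurable_crd.
by apply/seteqP; split=> z; rewrite /upper /= crd_max in_itv /= andbT.
Qed.

Lemma upper_box (a c : 'I_n.+1 -> R) : 0 < a ord_max -> (box a c : set pt) `<=` upper.
Proof.
by move=> a0 z /(_ ord_max); rewrite crd_max => /andP[az _]; exact: lt_trans az.
Qed.

Lemma measurable_cmod F D : measurable D -> cmeasurable D F ->
  measurable_fun D (fun z => cmod (F z)).
Proof.
move=> mD [mr mi].
rewrite (_ : (fun z => _) = (fun z =>
    Num.sqrt (complex.Re (F z) ^+ 2 + complex.Im (F z) ^+ 2))); last first.
  by apply/funext => z; rewrite /cmod; case: (F z).
apply: (measurableT_comp (f := @Num.sqrt R)).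
  apply: continuous_measurable_fun; exact: sqrt_continuous.
by apply: measurable_funD; exact: measurable_funX.
Qed.

Lemma locint_zpart b F : loc_integrable upper F -> locint (zpart b F).
Proof.
move=> [mF FK]; have mU := measurable_upper.
have mP : measurable_fun upper (fun z => part b (F z)).
  by case: mF; case: b.
have mzF : measurable_fun setT (zpart b F).
  by apply/(measurable_restrictT _ mU).
split=> // a c a0; have mB : measurable (box a c : set pt) by exact: measurable_box.
pose K : set pt := [set z | forall i, a i <= crd i z <= c i].
have KU : K `<=` upper.
  by move=> z /(_ ord_max); rewrite crd_max => /andP[az _]; exact: lt_le_trans az.
have mK : measurable K.
  rewrite (_ : K = \bigcap_(i in [set: 'I_n.+1]) (crd i @^-1` `[a i, c i]%classic)).
    apply: fin_bigcap_measurable => // i _.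
    by rewrite -[X in measurable X]setTI; apply: measurable_crd.
  apply/seteqP; split=> z H i; first by move=> _; rewrite /= in_itv; exact: H.
  by have := H i Logic.I; rewrite /= in_itv.
have BK : box a c `<=` K by move=> z H i; have /andP[/ltW -> ->] := H i.
apply/integrableP; split; first exact/measurable_EFinP/measurable_funTS.
have FKoo := FK K (@compact_cbox R n a c) KU; apply: (le_lt_trans _ FKoo).
have mcK : measurable_fun K (fun z => (cmod (F z))%:E).
  apply/measurable_EFinP; apply: measurable_cmod => //.
  by case: mF => m1 m2; split; apply: (measurable_funS mU KU).
apply: (@le_trans _ _ (\int[muxt]_(z in box a c) (cmod (F z))%:E)%E).
  apply: ge0_le_integral => //.
  - apply: measurableT_comp => //; exact/measurable_EFinP/measurable_funTS.
  - exact: measurable_funS mcK.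
  - move=> z zB /=; rewrite lee_fin /zpart patchT ?part_le//.
    by rewrite inE; exact: upper_box zB.
apply: ge0_subset_integral => //.
by move=> z _; rewrite lee_fin; case: (F z) => x y; rewrite sqrtr_ge0.
Qed.

Lemma admissible_derive e a c (k : 'I_n.+1 -> nat) : admissible e a c ->
  admissible (fun i => derive1n (k i) (e i)) a c.
Proof.
move=> [se e0 a0]; split=> // i; first exact: smooth1_derive1n.
exact: derive1n_out (e0 i).
Qed.

Lemma part_cintegral b D F : part b (cintegral muxt D F) =
  Rintegral muxt D (fun z => part b (F z)).
Proof. by case: b. Qed.

Definition pairing b F alpha e :=
  Rintegral muxt setT (fun z => zpart b F z * partials (@xt_basis R n) alpha (prodf e) z).

Lemma pairing_fin b F alpha e a c : loc_integrable upper F -> admissible e a c ->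
  ((pairing b F alpha e)%:E =
   \int[muxt]_z (zpart b F z * partials (@xt_basis R n) alpha (prodf e) z)%:E)%E.
Proof.
move=> lF adm; have [se _ _] := adm.
rewrite /pairing /Rintegral fineK// partials_prodf//.
apply: integrable_fin_num => //; apply: integrable_admissible (locint_zpart b lF) _.
exact: admissible_derive adm.
Qed.

Lemma pairing_cat b F alpha beta e a c : admissible e a c ->
  pairing b F (alpha ++ beta) e =
  pairing b F alpha (fun i => derive1n (count_mem i beta) (e i)).
Proof.
move=> [se _ _]; rewrite /pairing !partials_prodf//; last first.
  by move=> i; exact: smooth1_derive1n.
congr Rintegral; apply/funext => z; congr (_ * _); congr (prodf _ z).
apply/funext => i; rewrite count_cat.
by elim: (count_mem i alpha) => [//|j IH]; rewrite addSn !derive1nS IH.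
Qed.

Lemma pairing_perm b F alpha beta e a c : admissible e a c -> perm_eq alpha beta ->
  pairing b F alpha e = pairing b F beta e.
Proof.
move=> [se _ _] /permP ab; rewrite /pairing !partials_prodf//.
by congr Rintegral; apply/funext => z; congr (_ * prodf _ z); apply/funext => i; rewrite ab.
Qed.

Lemma Rintegral_zpart b F alpha e :
  Rintegral muxt upper (fun z => part b (F z * (partials (@xt_basis R n) alpha (prodf e) z)%:C%C)) =
  pairing b F alpha e.
Proof.
rewrite /pairing /Rintegral integral_mkcond; congr (fine (integral _ _ _)).
apply/funext => z; rewrite /zpart !patchE; case: ifP => _; last by rewrite mul0r.
by rewrite part_scale.
Qed.

Lemma weak_deriv_pairing b alpha F G e a c : weak_deriv upper alpha F G ->
  admissible e a c ->
  pairing b F alpha e = (-1) ^+ size alpha * pairing b G [::] e.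
Proof.
move=> [lF lG FG] adm; have [se e0 a0] := adm.
have /(congr1 (part b)) := FG _ (test_function_prodf se e0 a0).
rewrite -Rintegral_zpart part_cintegral => ->.
rewrite (_ : (-1) ^+ size alpha = ((-1) ^+ size alpha : R)%:C%C); last first.
  by rewrite rmorphXn rmorphN1.
by rewrite mulrC part_scale part_cintegral (Rintegral_zpart b G [::]) mulrC.
Qed.

End weak_derivatives.

Section weak_system.
Context {R : realType} {n : nat}.
Local Notation C := R[i].
Local Notation pt := ('rV[R]_n * measurableTypeR R)%type.
Local Notation muxt := (lebesgue_xt R n).

(** On products the partial derivatives commute, so that the gradient of dt^m u
    is dt^m of the gradient of u, and dt^m u is dt^(m - 1) of dt u. *)
Lemma weak_system_zpart b (m : nat) (u dtm_u : pt -> C) (grad_u dtm_grad_u : pt -> 'cV[C]_n.+1) :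
  (1 <= m)%N ->
  weak_dt upper m u dtm_u -> weak_grad upper u grad_u ->
  weak_dt_vec upper m grad_u dtm_grad_u ->
  weak_system m.-1 (zpart b dtm_u) (zpart b (fun z => grad_u z ord_max 0))
    (fun i => zpart b (fun z => dtm_grad_u z i 0)).
Proof.
move=> m1 um gu gum.
have [_ lum _] := um; have lg i : loc_integrable upper (fun z => grad_u z i 0).
  by have [] := gu i.
have lgm i : loc_integrable upper (fun z => dtm_grad_u z i 0) by have [] := gum i.
have lu : loc_integrable upper u by have [] := um.
split; [exact: locint_zpart|exact: locint_zpart|move=> i; exact: locint_zpart| |].
- move=> i e a c adm.
  have admk alpha := admissible_derive (fun i => count_mem i alpha) adm.
  have := pairing_fin b [:: i] lum adm.
  have := pairing_fin b [::] (lgm i) adm => /= <- <-.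
  rewrite -EFinN; congr EFin.
  have := weak_deriv_pairing b um (admk [:: i]).
  rewrite -(pairing_cat _ _ _ _ adm) (@pairing_perm _ _ b _ _ ([:: i] ++ nseq m ord_max) _ _ _ adm); last first.
    by rewrite perm_catC.
  rewrite (pairing_cat _ _ _ _ adm) (weak_deriv_pairing b (gu i) (admk (nseq m ord_max))).
  rewrite -!(pairing_cat _ _ _ _ adm) !cat0s (weak_deriv_pairing b (gum i) adm).
  rewrite size_nseq expr1 mulN1r -mulrN => /mulfI <- //.
  by rewrite signr_eq0.
- move=> e a c adm.
  have admk alpha := admissible_derive (fun i => count_mem i alpha) adm.
  have := pairing_fin b [::] lum adm.
  have := pairing_fin b (nseq m.-1 ord_max) (lg ord_max) adm => /= <- <-.
  rewrite !abse_EFin; congr EFin.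
  have := weak_deriv_pairing b um adm.
  rewrite -[in X in pairing b u X](prednK m1) [nseq _ _]/= -cat1s (pairing_cat _ _ _ _ adm).
  rewrite (weak_deriv_pairing b (gu ord_max) (admk (nseq m.-1 ord_max))).
  rewrite -(pairing_cat _ _ _ _ adm) cat0s size_nseq /= expr1 mulN1r => /(congr1 Num.norm).
  by rewrite normrN normrM normrX normrN1 expr1n mul1r => ->.
Qed.

End weak_system.

(** * Whitney regions *)

Section whitney_geometry.
Context {R : realType} {n : nat}.
Local Notation C := R[i].
Local Notation pt := ('rV[R]_n * measurableTypeR R)%type.
Local Notation muxt := (lebesgue_xt R n).
Implicit Types (z w : pt) (r s t : R).

Definition dist2 z w : R := \sum_(i < n) (w.1 0 i - z.1 0 i) ^+ 2.

(** Cylinders measured with squared distances: the inequality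
    (a + b)^2 <= 2 a^2 + 2 b^2 then does the work of the triangle inequality. *)
Definition drum r s z : set pt :=
  [set w | dist2 z w < r * z.2 ^+ 2 /\ `|w.2 - z.2| < s * z.2].

Lemma enorm_lt (x : 'rV[R]_n) r : 0 < r ->
  (enorm x < r) = (\sum_(i < n) x 0 i ^+ 2 < r ^+ 2).
Proof.
move=> r0; have S0 : 0 <= \sum_(i < n) x 0 i ^+ 2 by apply: sumr_ge0 => i _; exact: sqr_ge0.
rewrite -[in RHS](sqr_sqrtr S0) -/(enorm x) ltr_sqr ?nnegrE ?sqrtr_ge0//; exact: ltW.
Qed.

Lemma dist2E z w : \sum_(i < n) (z.1 - w.1) 0 i ^+ 2 = dist2 z w.
Proof. by apply: eq_bigr => i _; rewrite !mxE -sqrrN opprB. Qed.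

Lemma whitney_drum z : 0 < z.2 -> whitney z = drum (1 / 64) (1 / 8) z.
Proof.
move=> t0; have t8 : 0 < z.2 / 8 by rewrite divr_gt0.
apply/seteqP; split=> w; rewrite /whitney /drum /= enorm_lt// dist2E.
  move=> [H1 H2]; split; first by apply: (lt_le_trans H1); rewrite le_eqVlt; apply/orP; left; apply/eqP; field.
  by rewrite distrC mulrC mul1r.
move=> [H1 H2]; split; first by apply: (lt_le_trans H1); rewrite le_eqVlt; apply/orP; left; apply/eqP; field.
by rewrite distrC; rewrite mulrC mul1r in H2.
Qed.

Lemma measurable_drum r s z : measurable (drum r s z).
Proof.
have m1 (i : 'I_n) : measurable_fun setT (fun w : pt => w.1 0 i).
  rewrite (_ : (fun w => _) = crd (lift ord_max i)); first exact: measurable_crd.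
  by apply/funext => w; rewrite crd_lift.
have m2 : measurable_fun setT (fun w : pt => w.2) by exact: measurable_snd.
rewrite (_ : drum r s z = dist2 z @^-1` `]-oo, r * z.2 ^+ 2[%classic `&`
   (fun w => `|w.2 - z.2|) @^-1` `]-oo, s * z.2[%classic); last first.
  by apply/seteqP; split=> w; rewrite /drum /= !in_itv.
apply: measurableI.
  rewrite -[X in measurable X]setTI; apply: (_ : measurable_fun setT (dist2 z)) => //.
  apply: measurable_sum => i; apply: measurable_funX.
  by apply: measurable_funB.
rewrite -[X in measurable X]setTI; apply: (_ : measurable_fun setT (fun w : pt => `|w.2 - z.2|)) => //.
by apply: measurableT_comp => //; exact: measurable_funB.
Qed.

Lemma drum_upper r s z : s <= 1 -> 0 < z.2 -> drum r s z `<=` upper.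
Proof.
move=> s1 t0 w [_]; rewrite ltr_norml /upper /= => /andP[H _].
rewrite -ltrBlDl in H; have : s * z.2 <= z.2 by rewrite ler_piMl// ltW.
by move=> H2; move: H; rewrite -subr_gt0; lra.
Qed.

(** A shift of size [h] in each coordinate has squared length at most
    n h^2 <= t^2 / 256 in space, and doubling it gives 1 / 128. *)
Lemma shifts_into_drum r s r' s' h z : (0 < n)%N -> 0 < z.2 -> h = z.2 / (16 * n%:R) ->
  2 * r + 1 / 128 <= r' -> s + 1 / 16 <= s' ->
  shifts_into h (drum r s z) (drum r' s' z).
Proof.
move=> n0 t0 hE rr' ss' w v [H1 H2] vh.
have n1 : 1 <= n%:R :> R by rewrite ler1n.
have h0 : 0 <= h by rewrite hE divr_ge0 ?mulr_ge0// ltW.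
have hn : h * n%:R = z.2 / 16 by rewrite hE; field; rewrite pnatr_eq0 -lt0n.
have ht : h <= z.2 / 16 by rewrite -hn ler_peMr.
have nh2 : n%:R * h ^+ 2 <= z.2 ^+ 2 / 256.
  rewrite (_ : n%:R * _ = (z.2 / 16) * h); last by rewrite -hn; ring.
  rewrite (_ : z.2 ^+ 2 / 256 = (z.2 / 16) * (z.2 / 16)); last by field.
  by rewrite ler_wpM2l// divr_ge0// ltW.
split.
  apply: (@le_lt_trans _ _ (2 * dist2 z w + 2 * (n%:R * h ^+ 2))).
    rewrite (_ : n%:R * h ^+ 2 = \sum_(i < n) h ^+ 2); last first.
      by rewrite sumr_const card_ord mulr_natl.
    rewrite /dist2 !mulr_sumr -big_split /=.
    apply: ler_sum => i _.
    have -> : (translate (vec v) w).1 0 i = w.1 0 i + v (lift ord_max i).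
      by rewrite -!crd_lift crd_translate crd_vec.
    have /andP[v0 vh'] := vh (lift ord_max i).
    have : v (lift ord_max i) ^+ 2 <= h ^+ 2 by rewrite lerXn2r// nnegrE.
    set a := w.1 0 i - z.1 0 i; set b := v _.
    rewrite (_ : w.1 0 i + b - z.1 0 i = a + b); last by rewrite /a; ring.
    have : 0 <= (a - b) ^+ 2 by exact: sqr_ge0.
    by nra.
  apply: (@lt_le_trans _ _ ((2 * r + 1 / 128) * z.2 ^+ 2)).
    have : dist2 z w < r * z.2 ^+ 2 by [].
    by lra.
  by rewrite ler_wpM2r ?sqr_ge0.
have -> : (translate (vec v) w).2 = w.2 + v ord_max.
  by rewrite -!crd_max crd_translate crd_vec.
have /andP[v0 vh'] := vh ord_max.
have H3 : (s + 1 / 16) * z.2 <= s' * z.2 by rewrite ler_pM2r.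
move: H2; rewrite !ltr_norml => /andP[H4 H5]; apply/andP; split; lra.
Qed.

Lemma drum_box z : 0 < z.2 -> drum (1 / 6) (1 / 4) z `<=`
  box (fun i => crd i z - z.2 / 2) (fun i => crd i z + z.2 / 2).
Proof.
move=> t0 w [H1 H2] i.
suff : `|crd i w - crd i z| < z.2 / 2.
  by rewrite ltr_norml => /andP[H3 H4]; apply/andP; split; lra.
case: (unliftP ord_max i) => [j ->|->]; last first.
  by rewrite !crd_max; apply: (lt_trans H2); lra.
rewrite !crd_lift -(@ltr_pXn2r _ 2)// ?nnegrE//; last by rewrite divr_ge0// ltW.
rewrite real_normK ?num_real//; apply: (@le_lt_trans _ _ (dist2 z w)).
  by rewrite /dist2 (bigD1 j)//= lerDl sumr_ge0// => k _; exact: sqr_ge0.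
apply: (lt_trans H1); rewrite expr_div_n mulrC ltr_pM2l ?exprn_gt0//; lra.
Qed.

Lemma muxt_drum z : 0 < z.2 -> (muxt (drum (1 / 6) (1 / 4) z) <= (z.2 ^+ n.+1)%:E)%E.
Proof.
move=> t0; set a := fun i => crd i z - z.2 / 2; set b := fun i => crd i z + z.2 / 2.
apply: (@le_trans _ _ (muxt (box a b))).
  by apply: le_measure; rewrite ?inE; [exact: measurable_drum|exact: measurable_box|exact: drum_box].
rewrite muxt_box; last by move=> i; rewrite /a /b; lra.
rewrite (eq_bigr (fun=> z.2)); last by move=> i _; rewrite /a /b; field.
by rewrite prodr_const card_ord.
Qed.

Lemma muxt_whitney h z : (0 < n)%N -> 0 < z.2 -> h = z.2 / (16 * n%:R) ->
  ((h ^+ n.+1)%:E <= muxt (whitney z))%E.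
Proof.
move=> n0 t0 hE; rewrite whitney_drum//.
have n1 : 1 <= n%:R :> R by rewrite ler1n.
have h0 : 0 <= h by rewrite hE divr_ge0 ?mulr_ge0// ltW.
have hn : h * n%:R = z.2 / 16 by rewrite hE; field; rewrite pnatr_eq0 -lt0n.
have -> : ((h ^+ n.+1)%:E = muxt (box (crd^~ z) (fun i => (crd i z + h)%R)))%E.
  rewrite muxt_box; last by move=> i; rewrite lerDl.
  rewrite (eq_bigr (fun=> h)); last by move=> i _; rewrite addrAC subrr add0r.
  by rewrite prodr_const card_ord.
apply: le_measure; rewrite ?inE; [exact: measurable_box|exact: measurable_drum|].
move=> w wz.
have -> : w = translate (vec (fun i => crd i w - crd i z)) z.
  by apply: crd_inj => i; rewrite crd_translate crd_vec addrC subrK.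
apply: (@shifts_into_drum (1 / 512) (1 / 64) _ _ h z n0 t0 hE); [lra|lra| |].
  have c1 : 0 < 1 / 512 :> R by lra.
  have c2 : 0 < 1 / 64 :> R by lra.
  split; last by rewrite subrr normr0; exact: mulr_gt0.
  have -> : dist2 z z = 0 by apply: big1 => i _; rewrite subrr expr0n.
  by apply: mulr_gt0 => //; exact: exprn_gt0.
by move=> i; have /andP[H1 H2] := wz i; apply/andP; split; lra.
Qed.

End whitney_geometry.

Section whitney_mean.
Context {R : realType} {n : nat}.
Local Notation C := R[i].
Local Notation pt := ('rV[R]_n * measurableTypeR R)%type.
Local Notation muxt := (lebesgue_xt R n).
Implicit Types (z w : pt) (b : bool).

Lemma cmod_ge0 (a : C) : 0 <= cmod a.
Proof. by case: a => x y; exact: sqrtr_ge0. Qed.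

Lemma cmod_zpart (F : pt -> C) w : upper w ->
  cmod (F w) = Num.sqrt (zpart true F w ^+ 2 + zpart false F w ^+ 2).
Proof.
by move=> Uw; rewrite /zpart !patchT ?inE// /cmod; case: (F w).
Qed.

Lemma zpart_le b (F : pt -> C) w : `|zpart b F w| <= cmod (F w).
Proof.
rewrite /zpart patchE; case: ifP => _; first exact: part_le.
by rewrite normr0 cmod_ge0.
Qed.

Lemma vnorm_sqr k (v : 'cV[C]_k) : vnorm v ^+ 2 = \sum_(i < k) cmod (v i 0) ^+ 2.
Proof. by rewrite sqr_sqrtr// sumr_ge0// => i _; exact: sqr_ge0. Qed.

Lemma measurable_cmod_upper (F : pt -> C) (D : set pt) : measurable D -> D `<=` upper ->
  loc_integrable upper F -> measurable_fun D (fun w => cmod (F w)).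
Proof.
move=> mD DU [[mr mi] _]; have mU := @measurable_upper R n.
by apply: measurable_cmod => //; split; apply: (measurable_funS mU DU).
Qed.

Lemma measurable_vnorm2 (G : pt -> 'cV[C]_n.+1) (D : set pt) : measurable D -> D `<=` upper ->
  (forall i, loc_integrable upper (fun w => G w i 0)) ->
  measurable_fun D (fun w => vnorm (G w) ^+ 2).
Proof.
move=> mD DU lG; rewrite (_ : (fun w => _) = (fun w => \sum_(i < n.+1) cmod (G w i 0) ^+ 2)).
  apply: measurable_sum => i; apply: measurable_funX.
  exact: measurable_cmod_upper (lG i).
by apply/funext => w; rewrite vnorm_sqr.
Qed.

Lemma zpart_energy b (H : pt -> 'cV[C]_n.+1) D : measurable D -> D `<=` upper ->
  (forall i, loc_integrable upper (fun w => H w i 0)) ->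
  (\int[muxt]_(w in D) (\sum_i zpart b (fun w => H w i 0%R) w ^+ 2)%:E <=
   \int[muxt]_(w in D) (vnorm (H w) ^+ 2)%:E)%E.
Proof.
move=> mD DU lH; apply: ge0_le_integral => //.
- by move=> w _; rewrite lee_fin sumr_ge0// => i _; exact: sqr_ge0.
- apply/measurable_EFinP; apply: measurable_sum => i; apply: measurable_funX.
  by apply: measurable_funTS; have [] := locint_zpart b (lH i).
- by apply/measurable_EFinP; apply: measurable_vnorm2.
- move=> w _; rewrite lee_fin vnorm_sqr; apply: ler_sum => i _.
  by rewrite -[leLHS]real_normK ?num_real// lerXn2r ?nnegrE ?cmod_ge0//; exact: zpart_le.
Qed.

(** The regions are nested as whitney z = drum (1/64) (1/8), drum (1/16) (3/16),
    drum (1/6) (1/4), each with room for shifts of size h = t / (16 n) into the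
    next. The constant does not depend on [q]. *)
Lemma whitney_mean_le (m : nat) : (0 < n)%N -> (1 <= m)%N ->
  exists2 K : R, 0 < K & forall (u dtm_u : pt -> C) (grad_u dtm_grad_u : pt -> 'cV[C]_n.+1),
  weak_dt upper m u dtm_u -> weak_grad upper u grad_u ->
  weak_dt_vec upper m grad_u dtm_grad_u ->
  forall (z : pt) (Lam q : R), 0 < z.2 -> 0 < Lam ->
  ((z.2 ^+ 2)%:E * \int[muxt]_(w in drum (1 / 6) (1 / 4) z) (vnorm (dtm_grad_u w) ^+ 2)%:E <=
    (z.2 ^+ n.+1 * Lam ^+ 2)%:E)%E ->
  (\int[muxt]_(w in drum (1 / 6) (1 / 4) z) (cmod (grad_u w ord_max 0%R))%:E <=
    (Lam * z.2 ^+ m.-1 * z.2 ^+ n.+1)%:E)%E ->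
  0 < q <= 2 * (1 + n.+1%:R^-1) ->
  (((fine (muxt (whitney z)))^-1%:E *
    \int[muxt]_(w in whitney z) ((w.2 ^+ m * cmod (dtm_u w)) `^ q)%:E) `^ q^-1 <=
   (K * z.2 ^+ m * Lam)%:E)%E.
Proof.
move=> n0 m1; have [N NE] : exists N : R, N = 16 * n%:R by exists (16 * n%:R).
have c1 : 2 * (1 / 64) + 1 / 128 <= 1 / 16 :> R by lra.
have c2 : 2 * (1 / 16) + 1 / 128 <= 1 / 6 :> R by lra.
have c3 : 1 / 8 + 1 / 16 <= 3 / 16 :> R by lra.
have c4 : 3 / 16 + 1 / 16 <= 1 / 4 :> R by lra.
have half_gt0 (x : R) : 0 < x -> 0 < x - x / 2 by move=> ?; lra.
have below_double (x t : R) : 0 < t -> x - t < t / 8 -> x <= 2 * t by move=> ? ?; lra.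
have n1 : 1 <= n%:R :> R by rewrite ler1n.
have N1 : 1 <= N by rewrite NE; lra.
have N0 : 0 < N by exact: lt_le_trans N1.
have [K0 K00 HK0] := @local_average R n m.-1 (N ^+ n.+1) (exprn_ge0 _ (ltW N0)).
(* Absorbs the powers of t / h into the size L of the data. *)
pose C1 := N ^+ (m.-1 + n.+1).
have C10 : 0 < C1 by exact: exprn_gt0.
have C11 j : 1 <= N ^+ j by exact: exprn_ege1.
exists (2 ^+ m * (K0 * C1)); first by rewrite mulr_gt0 ?exprn_gt0// mulr_gt0.
move=> u dtm_u grad_u dtm_grad_u um gu gum z Lam q t0 Lam0 HE gE qs.
have /andP[q0 _] := qs.
have [h hE] : exists h, h = z.2 / N by exists (z.2 / N).
have h0 : 0 < h by rewrite hE divr_gt0.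
have tE : z.2 = N * h by rewrite hE mulrC divfK ?gt_eqF.
rewrite NE in hE.
pose L := C1 * Lam.
have L0 : 0 < L by exact: mulr_gt0.
set B := drum (1 / 6) (1 / 4) z in HE gE.
pose A1 : set pt := drum (1 / 16) (3 / 16) z.
set W := whitney z.
have mB : measurable B by exact: measurable_drum.
have mA1 : measurable A1 by exact: measurable_drum.
have mW : measurable W by rewrite /W whitney_drum//; exact: measurable_drum.
have WA1 : shifts_into h W A1.
  rewrite /W whitney_drum//; exact: shifts_into_drum n0 t0 hE c1 c3.
have A1B : shifts_into h A1 B by exact: shifts_into_drum n0 t0 hE c2 c4.
have BU : B `<=` upper by apply: drum_upper => //; lra.
have A1B' := shifts_into_sub (ltW h0) A1B.
have WU : W `<=` upper.
  by move=> w Ww; apply: BU; apply: A1B'; exact: shifts_into_sub (ltW h0) WA1 _ Ww.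
have muA1 : (muxt A1 <= (N ^+ n.+1 * h ^+ n.+1)%:E)%E.
  rewrite -exprMn -tE; apply: le_trans (muxt_drum t0).
  by apply: le_measure; rewrite ?inE.
have muW : ((h ^+ n.+1)%:E <= muxt W)%E by exact: muxt_whitney hE.
have lH i : loc_integrable upper (fun z => dtm_grad_u z i 0) by have [] := gum i.
have lg : loc_integrable upper (fun z => grad_u z ord_max 0) by have [] := gu ord_max.
have lF : loc_integrable upper dtm_u by have [] := um.
have HB b : ((h ^+ 2)%:E * \int[muxt]_(w in B) (\sum_i zpart b (fun z => dtm_grad_u z i 0%R) w ^+ 2)%:E <=
    (h ^+ n.+1 * L ^+ 2)%:E)%E.
  apply: (@le_trans _ _ ((h ^+ 2)%:E * \int[muxt]_(w in B) (vnorm (dtm_grad_u w) ^+ 2)%:E)%E).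
    by apply: lee_wpmul2l; [rewrite lee_fin sqr_ge0|exact: zpart_energy].
  apply: (@le_trans _ _ ((z.2 ^+ 2)%:E * \int[muxt]_(w in B) (vnorm (dtm_grad_u w) ^+ 2)%:E)%E).
    apply: lee_wpmul2r; first by apply: integral_ge0 => w _; rewrite lee_fin sqr_ge0.
    by rewrite lee_fin tE exprMn ler_peMl ?sqr_ge0.
  apply: (le_trans HE); rewrite lee_fin tE exprMn -mulrA mulrCA.
  rewrite ler_wpM2l ?exprn_ge0 ?(ltW h0)// /L exprMn ler_wpM2r ?sqr_ge0//.
  rewrite /C1 exprD exprMn -[leLHS]mul1r ler_pM ?exprn_ge0 ?(ltW N0)//.
    by rewrite exprn_ege1.
  by rewrite -[leLHS]mulr1 expr2 ler_wpM2l ?exprn_ge0 ?(ltW N0).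
have gB b : (\int[muxt]_(w in B) `|zpart b (fun z => grad_u z ord_max 0%R) w|%:E <=
    (L * h ^+ m.-1 * h ^+ n.+1)%:E)%E.
  apply: (@le_trans _ _ (\int[muxt]_(w in B) (cmod (grad_u w ord_max 0%R))%:E)%E).
    apply: ge0_le_integral => //.
    - apply/measurable_EFinP; apply: measurableT_comp => //.
      by apply: measurable_funTS; have [] := locint_zpart b lg.
    - by apply/measurable_EFinP; apply: measurable_cmod_upper.
    - by move=> w _; rewrite lee_fin zpart_le.
  apply: (le_trans gE); rewrite lee_fin le_eqVlt; apply/orP; left; apply/eqP.
  by rewrite tE !exprMn /L /C1 exprD; ring.
have muWfin : (muxt W < +oo)%E.
  apply: le_lt_trans (ltry (N ^+ n.+1 * h ^+ n.+1)); apply: le_trans muA1.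
  by apply: le_measure; rewrite ?inE//; exact: shifts_into_sub (ltW h0) WA1.
have muWE : muxt W = (fine (muxt W))%:E.
  by rewrite fineK// ge0_fin_numE// measure_ge0.
have muW0 : 0 < fine (muxt W).
  by rewrite -lte_fin -muWE; apply: lt_le_trans muW; rewrite lte_fin exprn_gt0.
have wsys b := weak_system_zpart b m1 um gu gum.
pose X w := Num.sqrt (zpart true dtm_u w ^+ 2 + zpart false dtm_u w ^+ 2) / (K0 * L).
have K0L : 0 < K0 * L by exact: mulr_gt0.
have X0 w : 0 <= X w by rewrite divr_ge0 ?sqrtr_ge0// ltW.
have XW : (\int[muxt]_(w in W) (X w `^ q)%:E <= muxt W)%E.
  have c0 : 0 < crd ord_max z - z.2 / 2 by rewrite crd_max half_gt0.
  exact: (HK0 _ _ _ _ _ _ W A1 B _ _ h L q (wsys true) (wsys false) c0 mW mA1 mB (drum_box t0)).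
pose T := (2 * z.2) ^+ m * (K0 * L).
have T0 : 0 < T by rewrite mulr_gt0// exprn_gt0// mulr_gt0.
have mX : measurable_fun W (fun w => (X w `^ q)%:E).
  apply/measurable_EFinP; apply: measurable_funTS.
  apply: (measurableT_comp (f := fun y => y `^ q)) => //.
  apply: measurable_funM => //; apply: (measurableT_comp (f := @Num.sqrt R)).
    apply: continuous_measurable_fun; exact: sqrt_continuous.
  by apply: measurable_funD; apply: measurable_funX;
    [have [] := locint_zpart true lF|have [] := locint_zpart false lF].
have m2 : measurable_fun setT (fun w : pt => w.2) by exact: measurable_snd.
have HI : (\int[muxt]_(w in W) ((w.2 ^+ m * cmod (dtm_u w)) `^ q)%:E <= (T `^ q)%:E * muxt W)%E.
  apply: (@le_trans _ _ (\int[muxt]_(w in W) ((T `^ q)%:E * (X w `^ q)%:E))%E).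
    apply: ge0_le_integral => //.
    - by move=> w _; rewrite lee_fin powR_ge0.
    - apply/measurable_EFinP; apply: (measurableT_comp (f := fun y => y `^ q)) => //.
      apply: measurable_funM; last exact: measurable_cmod_upper.
      by apply: measurable_funTS; exact: measurable_funX.
    - exact: measurable_funeM.
    - move=> w Ww; rewrite -EFinM lee_fin -powRM ?(ltW T0)//.
      have w0 : 0 < w.2 by exact: WU.
      apply: ge0_ler_powR; rewrite ?nnegrE ?(ltW q0)//.
      + by rewrite mulr_ge0 ?cmod_ge0// exprn_ge0// ltW.
      + by rewrite mulr_ge0// ltW.
      rewrite (cmod_zpart dtm_u (WU _ Ww)) /T /X -mulrA [K0 * L * _]mulrC divfK ?gt_eqF//.
      rewrite ler_wpM2r ?sqrtr_ge0// lerXn2r ?nnegrE ?(ltW w0)// ?mulr_ge0 ?(ltW t0)//.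
      have [_] := Ww; rewrite distrC => /ltr_normlP[_]; exact: below_double.
  rewrite ge0_integralZl_EFin//; last 2 first.
  - by move=> w _; rewrite lee_fin powR_ge0.
  - by rewrite powR_ge0.
  by apply: lee_wpmul2l => //; rewrite lee_fin powR_ge0.
rewrite (_ : 2 ^+ m * (K0 * C1) * z.2 ^+ m * Lam = T); last by rewrite /T /L exprMn; ring.
rewrite -[leRHS]/(T%:E).
have -> : (T%:E = (T `^ q)%:E `^ q^-1)%E.
  by rewrite poweR_EFin -powRrM mulfV ?gt_eqF// powRr1// ltW.
apply: gt0_ler_poweR; rewrite ?invr_ge0 ?(ltW q0)// ?in_itv /=.
- rewrite leey andbT mule_ge0// ?lee_fin ?invr_ge0 ?(ltW muW0)//.
  by apply: integral_ge0 => w _; rewrite lee_fin powR_ge0.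
- by rewrite leey lee_fin powR_ge0.
rewrite -/W.
apply: (@le_trans _ _ ((fine (muxt W))^-1%:E * ((T `^ q)%:E * muxt W))%E).
  by apply: lee_wpmul2l => //; rewrite lee_fin invr_ge0 ltW.
by rewrite [X in (_ * (_ * X))%E]muWE -!EFinM lee_fin mulrCA mulVf ?gt_eqF// mulr1.
Qed.

End whitney_mean.

(** * The square functions *)

Section square_functions.
Context {R : realType} {n : nat}.
Local Notation C := R[i].
Local Notation pt := ('rV[R]_n * measurableTypeR R)%type.
Local Notation mux := (lebesgue_rV R n).
Local Notation muxt := (lebesgue_xt R n).
Local Notation leb := (@lebesgue_measure R).
Implicit Types (z w : pt) (F v : pt -> R) (x : 'rV[R]_n).

Lemma sqrte_le (Q : \bar R) (b : R) : (0 <= Q)%E -> 0 <= b ->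
  (Q `^ 2^-1 <= b%:E -> Q <= (b ^+ 2)%:E)%E.
Proof.
case: Q => [x||]//.
  rewrite !lee_fin => x0 b0; rewrite powR12_sqrt// => xb.
  by rewrite -[leLHS]sqr_sqrtr// lerXn2r ?nnegrE ?sqrtr_ge0.
move=> _ b0; rewrite poweRyr ?invr_eq0// leye_eq; by [].
Qed.

Lemma le_sqrte (A Q : \bar R) : (0 <= A -> A * A <= Q -> A <= Q `^ 2^-1)%E.
Proof.
case: Q => [q||].
- case: A => [a||]//.
  rewrite -EFinM poweR_EFin !lee_fin => a0 aq.
  have q0 : 0 <= q by apply: le_trans aq; rewrite mulr_ge0.
  by rewrite powR12_sqrt// -[leLHS]ger0_norm// -sqrtr_sqr expr2 ler_wsqrtr.
- by move=> _ _; rewrite poweRyr ?invr_eq0// leey.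
- move=> A0; rewrite leeNy_eq => /eqP AA.
  by have := mule_ge0 A0 A0; rewrite AA.
Qed.

Lemma measurable_x0 (i : 'I_n) : measurable_fun setT (fun w : pt => w.1 0 i).
Proof.
rewrite (_ : (fun w => _) = crd (lift ord_max i)); first exact: measurable_crd.
by apply/funext => w; rewrite crd_lift.
Qed.

Lemma measurable_inv_upper (f : pt -> R) : measurable_fun upper f ->
  (forall w, upper w -> 0 < f w) -> measurable_fun upper (fun w => (f w)^-1).
Proof.
move=> mf f0; apply: (@eq_measurable_fun _ _ _ _ upper (fun w => f w `^ (-1))).
  by move=> w /set_mem Uw; rewrite powR_inv1// ltW// f0.
exact: (measurableT_comp (f := fun y => y `^ (-1))).
Qed.

Lemma measurable_density F : measurable_fun upper F ->
  measurable_fun setT ((fun z => (F z ^+ 2 / z.2 ^+ n.+1)%:E) \_ upper).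
Proof.
move=> mF; apply/(measurable_restrictT _ (@measurable_upper R n)).
apply/measurable_EFinP; apply: measurable_funM; first exact: measurable_funX.
apply: measurable_inv_upper => [|w w0]; last exact: exprn_gt0.
by apply: measurable_funX; apply: measurable_funTS; exact: measurable_snd.
Qed.

(** Its measurability makes the conical square function measurable by Tonelli. *)
Definition cone_graph : set ('rV[R]_n * pt) := [set p | cone p.1 p.2].

Lemma measurable_cone_graph : measurable cone_graph.
Proof.
have ms : measurable_fun setT (fun p : 'rV[R]_n * pt => p.2.2).
  exact: (measurableT_comp measurable_snd measurable_snd).
have md : measurable_fun setT (fun p : 'rV[R]_n * pt =>
    p.2.2 ^+ 2 - \sum_(i < n) (p.1 0 i - p.2.1 0 i) ^+ 2).
  apply: measurable_funB; first exact: measurable_funX.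
  apply: measurable_sum => i; apply: measurable_funX; apply: measurable_funB.
    exact: (measurableT_comp (measurable_rV_coord i) measurable_fst).
  exact: (measurableT_comp (measurable_x0 i) measurable_snd).
rewrite (_ : cone_graph = (fun p : 'rV[R]_n * pt => p.2.2) @^-1` `]0, +oo[%classic `&`
  (fun p : 'rV[R]_n * pt => p.2.2 ^+ 2 - \sum_(i < n) (p.1 0 i - p.2.1 0 i) ^+ 2) @^-1` `]0, +oo[%classic).
  by apply: measurableI; rewrite -[X in measurable X]setTI; [apply: ms|apply: md].
apply/seteqP; split=> p; rewrite /cone_graph /cone /= !in_itv /= !andbT => -[p0].
  rewrite enorm_lt// => H; split=> //; rewrite subr_gt0; apply: le_lt_trans H.
  by rewrite le_eqVlt; apply/orP; left; apply/eqP; apply: eq_bigr => i _; rewrite !mxE.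
rewrite subr_gt0 => H; split=> //; rewrite enorm_lt//; apply: le_lt_trans H.
by rewrite le_eqVlt; apply/orP; left; apply/eqP; apply: eq_bigr => i _; rewrite !mxE.
Qed.

Lemma measurable_conical F : measurable_fun upper F ->
  measurable_fun setT (conical_square F).
Proof.
move=> mF; apply: (measurableT_comp (measurable_poweR _)).
set f := (fun p : 'rV[R]_n * pt =>
   ((fun z => (F z ^+ 2 / z.2 ^+ n.+1)%:E) \_ upper) p.2) \_ cone_graph.
have mf : measurable_fun setT f.
  apply/(measurable_restrictT _ measurable_cone_graph); apply: measurable_funTS.
  exact: (measurableT_comp (measurable_density mF) measurable_snd).
have f0 p : (0 <= f p)%E.
  rewrite /f patchE; case: ifP => // _; rewrite patchE; case: ifP => // /set_mem Uz.
  by rewrite lee_fin divr_ge0 ?sqr_ge0// exprn_ge0// ltW.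
rewrite (_ : (fun x => _) = (fun x => \int[muxt]_(z in setT) f (x, z))%E).
  exact: tonelli_x_xt.
apply/funext => x; rewrite integral_mkcond; apply: eq_integral => z _.
rewrite /f !patchE /=; have [xz|xz] := boolP (z \in cone x).
  rewrite ifT; last by rewrite inE; move: xz; rewrite inE.
  by rewrite ifT// inE; move: xz; rewrite inE => -[].
by rewrite ifF//; apply/negbTE; apply: contra xz; rewrite !inE.
Qed.

Lemma measurable_vertical_square F : measurable_fun upper F ->
  measurable_fun setT (vertical_square F).
Proof.
move=> mF; apply: (measurableT_comp (measurable_poweR _)).
set f : pt -> \bar R := (fun z => (F z ^+ 2 / z.2)%:E) \_ upper.
have mf : measurable_fun setT f.
  apply/(measurable_restrictT _ (@measurable_upper R n)).
  apply/measurable_EFinP; apply: measurable_funM; first exact: measurable_funX.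
  apply: measurable_inv_upper => //.
  by apply: measurable_funTS; exact: measurable_snd.
have f0 p : (0 <= f p)%E.
  rewrite /f patchE; case: ifP => // /set_mem Uz.
  by rewrite lee_fin divr_ge0 ?sqr_ge0// ltW.
rewrite (_ : (fun x => _) = (fun x => \int[leb]_t f (x, t))%E).
  exact: measurable_vertical.
apply/funext => x; rewrite integral_mkcond; apply: eq_integral => t _.
by rewrite /f !patchE.
Qed.

Lemma conical_ge0 F x : (0 <= conical_square F x)%E.
Proof. exact: poweR_ge0. Qed.

Lemma vertical_ge0 F x : (0 <= vertical_square F x)%E.
Proof. exact: poweR_ge0. Qed.

Definition disc (r : R) z : set 'rV[R]_n := [set x | dist2 z (x, 0) < r * z.2 ^+ 2].

Lemma measurable_disc r z : measurable (disc r z).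
Proof.
have m1 : measurable_fun setT (fun x : 'rV[R]_n => dist2 z (x, 0)).
  apply: measurable_sum => i; apply: measurable_funX.
  by apply: measurable_funB => //; exact: measurable_rV_coord.
rewrite (_ : disc r z = (fun x : 'rV[R]_n => dist2 z (x, 0)) @^-1` `]-oo, r * z.2 ^+ 2[%classic).
  by rewrite -[X in measurable X]setTI; apply: m1.
by apply/seteqP; split=> x; rewrite /disc /= in_itv.
Qed.

(** Twice 1/6 + 1/16 is less than (3/4)^2. *)
Lemma drum_sub_cone z x : 0 < z.2 -> disc (1 / 16) z x ->
  drum (1 / 6) (1 / 4) z `<=` cone x.
Proof.
move=> t0 xz w [H1 H2]; have w0 : 3 / 4 * z.2 < w.2.
  by move: H2; rewrite ltr_norml => /andP[H2 _]; lra.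
have wpos : 0 < w.2 by apply: lt_trans w0; rewrite mulr_gt0.
split=> //; rewrite enorm_lt//.
apply: (@le_lt_trans _ _ (2 * dist2 z w + 2 * dist2 z (x, 0))).
  rewrite /dist2 !mulr_sumr -big_split /=; apply: ler_sum => i _; rewrite !mxE.
  set a := x 0 i; set b := w.1 0 i; set c := z.1 0 i.
  rewrite -subr_ge0 (_ : _ - _ = (a + b - 2 * c) ^+ 2) ?sqr_ge0//; ring.
apply: (@lt_trans _ _ ((3 / 4 * z.2) ^+ 2)); last by rewrite ltrXn2r ?nnegrE ?mulr_ge0 ?(ltW t0) ?(ltW wpos).
have t20 : 0 < z.2 ^+ 2 by rewrite exprn_gt0.
by rewrite exprMn; move: xz; rewrite /disc /=; lra.
Qed.

End square_functions.

Section square_functions_from_below.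
Context {R : realType} {n : nat}.
Local Notation pt := ('rV[R]_n * measurableTypeR R)%type.
Local Notation mux := (lebesgue_rV R n).
Local Notation muxt := (lebesgue_xt R n).
Local Notation leb := (@lebesgue_measure R).
Implicit Types (z w : pt) (v : pt -> R) (x : 'rV[R]_n).

Lemma lee_poweR (A Q : \bar R) (r : R) : 0 <= r -> (0 <= A -> A <= Q -> A `^ r <= Q `^ r)%E.
Proof.
move=> r0 A0 AQ; apply: gt0_ler_poweR => //; rewrite in_itv /= leey andbT//.
exact: le_trans AQ.
Qed.

Lemma mux_disc z : (0 < n)%N -> 0 < z.2 ->
  (((z.2 / (16 * n%:R)) ^+ n)%:E <= mux (disc (1 / 16) z))%E.
Proof.
move=> n0 t0; set h := z.2 / _.
have n1 : 1 <= n%:R :> R by rewrite ler1n.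
have h0 : 0 < h by rewrite divr_gt0// mulr_gt0// ltr0n.
have hn : h * n%:R = z.2 / 16 by rewrite /h; field; rewrite pnatr_eq0 -lt0n.
pose Q := [set x : 'rV[R]_n | forall i, z.1 0 i < x 0 i <= (z.1 + const_mx h) 0 i].
have -> : ((h ^+ n)%:E = mux Q)%E.
  rewrite lebesgue_rV_box; last by move=> i; rewrite !mxE lerDl ltW.
  rewrite (eq_bigr (fun=> h)); last by move=> i _; rewrite !mxE addrAC subrr add0r.
  by rewrite prodr_const card_ord.
apply: le_measure; rewrite ?inE; [exact: measurable_rV_box|exact: measurable_disc|].
move=> x xz; rewrite /disc /=.
apply: (@le_lt_trans _ _ (n%:R * h ^+ 2)).
  rewrite (_ : n%:R * h ^+ 2 = \sum_(i < n) h ^+ 2); last first.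
    by rewrite sumr_const card_ord mulr_natl.
  apply: ler_sum => i _; have /andP[x1 x2] := xz i; rewrite !mxE in x2.
  by rewrite lerXn2r ?nnegrE/=; lra.
rewrite (_ : n%:R * h ^+ 2 = (z.2 / 16) * h); last by rewrite -hn; ring.
apply: (@le_lt_trans _ _ (z.2 / 16 * (z.2 / 16))).
  by rewrite ler_wpM2l ?divr_ge0 ?(ltW t0)// -hn ler_peMr// ltW.
have : 0 < z.2 ^+ 2 by rewrite exprn_gt0.
by rewrite expr2; lra.
Qed.

(** The cylinder lies in the cone over x and t / 2 <= w.2 <= 2 t on it. *)
Lemma conical_from_below (m : nat) z x v : 0 < z.2 -> measurable_fun upper v ->
  disc (1 / 16) z x ->
  (((z.2 ^+ (2 * m.+1) / (2 ^+ (2 * m.+1 + n.+1) * z.2 ^+ n.+1))%:E *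
     \int[muxt]_(w in drum (1 / 6) (1 / 4) z) (v w ^+ 2)%:E) `^ 2^-1 <=
   conical_square (fun w => w.2 ^+ m.+1 * v w)%R x)%E.
Proof.
move=> t0 mv xz; rewrite /conical_square.
set k := z.2 ^+ _ / _.
have k0 : 0 <= k by rewrite divr_ge0 ?mulr_ge0 ?exprn_ge0 ?(ltW t0).
have mB := measurable_drum (1 / 6) (1 / 4) z.
have b4 : 1 / 4 <= 1 :> R by lra.
have below (a b : R) : - (1 / 4 * b) < a - b -> b / 2 <= a \/ b < 0 by move=> ?; case: (ltP b 0) => ?; [right|left; lra].
have above (a b : R) : 0 < b -> a - b < 1 / 4 * b -> a <= 2 * b by move=> ? ?; lra.
have BU : drum (1 / 6) (1 / 4) z `<=` upper by exact: drum_upper.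
have BC := drum_sub_cone t0 xz.
have mC : measurable (cone x).
  rewrite (_ : cone x = xsection (@cone_graph R n) x).
    by apply: measurable_xsection; exact: measurable_cone_graph.
  by apply/seteqP; split=> w; rewrite /xsection /= inE.
have CU : cone x `<=` upper by move=> w [].
have mw j D : measurable_fun D (fun w : pt => w.2 ^+ j).
  by apply: measurable_funX; apply: measurable_funTS; exact: measurable_snd.
have mF : measurable_fun (cone x) (fun w : pt => ((w.2 ^+ m.+1 * v w) ^+ 2 / w.2 ^+ n.+1)%:E).
  apply/measurable_EFinP; apply: (measurable_funS (@measurable_upper R n) CU).
  apply: measurable_funM; first by apply: measurable_funX; exact: measurable_funM.
  by apply: measurable_inv_upper => // w w0; exact: exprn_gt0.
apply: lee_poweR; first by rewrite invr_ge0.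
  apply: mule_ge0; first by rewrite lee_fin.
  by apply: integral_ge0 => w _; rewrite lee_fin sqr_ge0.
rewrite -ge0_integralZl_EFin//; last 2 first.
- by move=> w _; rewrite lee_fin sqr_ge0.
- by apply/measurable_EFinP; apply: measurable_funX; exact: measurable_funS (@measurable_upper R n) BU mv.
apply: (@le_trans _ _ (\int[muxt]_(w in drum (1 / 6) (1 / 4) z)
    ((w.2 ^+ m.+1 * v w) ^+ 2 / w.2 ^+ n.+1)%:E)%E).
  apply: ge0_le_integral => //.
  - by move=> w _; rewrite -EFinM lee_fin mulr_ge0// sqr_ge0.
  - apply: measurable_funeM; apply/measurable_EFinP; apply: measurable_funX.
    exact: measurable_funS (@measurable_upper R n) BU mv.
  - exact: measurable_funS mC BC mF.
  - move=> w wB; rewrite -EFinM lee_fin exprMn -exprM [X in _ <= X]mulrAC.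
    rewrite ler_wpM2r ?sqr_ge0//; have w0 : 0 < w.2 by exact: BU.
    have [_ ] := wB; rewrite ltr_norml => /andP[w1 w2].
    have w3 : z.2 / 2 <= w.2 by case: (below _ _ w1) => //; rewrite ltNge (ltW t0).
    have w4 : w.2 <= 2 * z.2 by exact: above w2.
    have -> : k = (z.2 / 2) ^+ (2 * m.+1) / (2 * z.2) ^+ n.+1.
      by rewrite /k exprD expr_div_n exprMn; field; rewrite ?expf_neq0 ?gt_eqF.
    rewrite [(m.+1 * 2)%N]mulnC; apply: ler_pM.
    + by rewrite exprn_ge0// divr_ge0// ltW.
    + by rewrite invr_ge0 exprn_ge0// mulr_ge0// ltW.
    + by rewrite lerXn2r ?nnegrE ?divr_ge0 ?(ltW t0) ?(ltW w0).
    + rewrite lef_pV2 ?posrE ?exprn_gt0 ?mulr_gt0//.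
      by rewrite lerXn2r ?nnegrE ?mulr_ge0 ?(ltW t0) ?(ltW w0).
apply: ge0_subset_integral => //.
by move=> w [w0 _]; rewrite lee_fin divr_ge0 ?sqr_ge0// exprn_ge0// ltW.
Qed.

(** Cauchy-Schwarz on the vertical segments of the cylinder, which have length
    t / 2 and stay above height t / 2. *)
Lemma vertical_from_below z v : 0 < z.2 -> measurable_fun upper v ->
  (forall w, 0 <= v w) ->
  (\int[muxt]_(w in drum (1 / 6) (1 / 4) z) (v w)%:E <=
   \int[mux]_(x in disc (1 / 6) z) vertical_square (fun w => w.2 * v w)%R x)%E.
Proof.
move=> t0 mv v0; have b4 : 1 / 4 <= 1 :> R by lra.
have below (s t : R) : 0 < t -> `|s - t| < 1 / 4 * t -> 1 / 2 * t <= s.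
  by move=> ?; rewrite ltr_norml => /andP[? ?]; lra.
have halves (t : R) : t + 1 / 4 * t - (t - 1 / 4 * t) = t / 2 by field.
have quarter (t : R) : 0 < t -> t - 1 / 4 * t < t + 1 / 4 * t by move=> ?; lra.
have mB := measurable_drum (1 / 6) (1 / 4) z.
set B := drum _ _ z in mB *.
have BU : B `<=` upper by exact: drum_upper.
have mU := @measurable_upper R n.
pose vB := v \_ B.
have vB0 w : 0 <= vB w by rewrite /vB patchE; case: ifP.
have mvB : measurable_fun setT vB.
  by apply/(measurable_restrictT _ mB); exact: measurable_funS mU BU mv.
have mvBx x : measurable_fun setT (fun s : measurableTypeR R => vB (x, s)).
  exact: (measurableT_comp mvB (pair1_measurable x)).
have -> : (\int[muxt]_(w in B) (v w)%:E = \int[muxt]_w (vB w)%:E)%E.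
  rewrite [LHS]integral_mkcond; apply: eq_integral => w _.
  by rewrite /vB !patchE; case: ifP.
rewrite (@integral_xt_iterated R n (fun w => (vB w)%:E)); last 2 first.
- exact/measurable_EFinP.
- by move=> w; rewrite lee_fin.
have mwv : measurable_fun upper (fun w : pt => w.2 * v w).
  by apply: measurable_funM => //; apply: measurable_funTS; exact: measurable_snd.
rewrite [leRHS]integral_mkcond; apply: ge0_le_integral => //.
- by move=> x _; apply: integral_ge0 => s _; rewrite lee_fin.
- apply: (@measurable_vertical R n (fun w => (vB w)%:E)); first exact/measurable_EFinP.
  by move=> w; rewrite lee_fin.
- apply/(measurable_restrictT _ (measurable_disc _ _)); apply: measurable_funTS.
  exact: measurable_vertical_square.
move=> x _; rewrite patchE; case: ifPn => xz; last first.
  rewrite integral0_eq// => s _; rewrite /vB patchE ifF//.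
  by apply: contraNF xz; rewrite !inE => -[].
apply: le_sqrte; first by apply: integral_ge0 => s _; rewrite lee_fin.
pose J : set R := `]z.2 - 1 / 4 * z.2, z.2 + 1 / 4 * z.2[%classic.
have JE s : J s <-> `|s - z.2| < 1 / 4 * z.2.
  rewrite /J /= in_itv /= ltr_norml; split=> /andP[H1 H2]; apply/andP; split; lra.
have -> : (\int[leb]_s (vB (x, s))%:E = \int[leb]_(s in J) (vB (x, s))%:E)%E.
  rewrite [RHS]integral_mkcond; apply: eq_integral => s _; rewrite patchE; case: ifPn => // sJ.
  rewrite /vB patchE ifF//; apply: contraNF sJ; rewrite !inE => -[_ H]; exact/JE.
have Jt : (leb J <= (z.2 / 2)%:E)%E.
  by rewrite /J lebesgue_measure_itv /= lte_fin quarter// -EFinB lee_fin halves.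
have mJ : measurable (J : set (measurableTypeR R)) by exact: measurable_itv.
have J0 s : J s -> z.2 / 2 <= s by move=> /JE /below; rewrite mul1r mulrC; exact.
apply: (@le_trans _ _ ((z.2 / 2)%:E * \int[leb]_(s in J) (vB (x, s) ^+ 2)%:E)%E).
  apply: (integral_sqr_le mJ Jt) => [|s _]; [exact: measurable_funTS|exact: vB0].
have h0 : 0 <= z.2 / 2 by rewrite divr_ge0// ltW.
rewrite -ge0_integralZl_EFin//; last 2 first.
- by move=> s _; rewrite lee_fin sqr_ge0.
- apply/measurable_EFinP; apply: measurable_funX; exact: measurable_funTS.
have mP : measurable ([set s : R | 0 < s] : set (measurableTypeR R)).
  rewrite (_ : [set s | _] = `]0, +oo[%classic) ?measurable_itv//.
  by apply/seteqP; split=> s; rewrite /= in_itv /= andbT.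
have JP : J `<=` [set s : R | 0 < s].
  by move=> s /J0; apply: lt_le_trans; rewrite divr_gt0.
have mQ : measurable_fun [set s : R | 0 < s] (fun s : measurableTypeR R => ((s * v (x, s)) ^+ 2 / s)%:E).
  have -> : (fun s : measurableTypeR R => ((s * v (x, s)) ^+ 2 / s)%:E) =
     (fun w : pt => ((w.2 * v w) ^+ 2 / w.2)%:E) \o pair x by [].
  apply: (measurable_comp mU).
  - by move=> _ [s s0 <-].
  - apply/measurable_EFinP; apply: measurable_funM; first exact: measurable_funX.
    apply: measurable_inv_upper => //; apply: measurable_funTS; exact: measurable_snd.
  - apply: measurable_funTS; exact: pair1_measurable.
apply: (@le_trans _ _ (\int[leb]_(s in J) ((s * v (x, s)) ^+ 2 / s)%:E)%E).
  apply: ge0_le_integral => //.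
  - by move=> s _; rewrite -EFinM lee_fin mulr_ge0// sqr_ge0.
  - apply: measurable_funeM; apply/measurable_EFinP; apply: measurable_funX; exact: measurable_funTS.
  - exact: measurable_funS mP JP mQ.
  - move=> s Js; rewrite -EFinM lee_fin; have s0 : 0 < s by exact: JP.
    rewrite (_ : (s * v (x, s)) ^+ 2 / s = s * v (x, s) ^+ 2); last by field; rewrite gt_eqF.
    apply: ler_pM => //; [exact: sqr_ge0|exact: J0|].
    by rewrite lerXn2r ?nnegrE// /vB patchE; case: ifP.
apply: ge0_subset_integral => // s s0.
by rewrite lee_fin divr_ge0 ?sqr_ge0// ltW.
Qed.

End square_functions_from_below.

(** * The pointwise estimate *)

Section nontangential_mean.
Context {R : realType} {n : nat}.
Local Notation C := R[i].
Local Notation pt := ('rV[R]_n * measurableTypeR R)%type.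
Local Notation mux := (lebesgue_rV R n).
Local Notation muxt := (lebesgue_xt R n).
Implicit Types (z w : pt) (x : 'rV[R]_n).

Lemma measurable_vnorm_upper (G : pt -> 'cV[C]_n.+1) :
  (forall i, loc_integrable upper (fun w => G w i 0)) ->
  measurable_fun upper (fun w => vnorm (G w)).
Proof.
move=> lG; have -> : (fun w => vnorm (G w)) = @Num.sqrt R \o (fun w => vnorm (G w) ^+ 2).
  by apply/funext => w /=; rewrite sqrtr_sqr ger0_norm// sqrtr_ge0.
apply: measurableT_comp; first by apply: continuous_measurable_fun; exact: sqrt_continuous.
apply: measurable_vnorm2 => //; exact: measurable_upper.
Qed.

Lemma cmod_le_vnorm (v : 'cV[C]_n.+1) i : cmod (v i 0) <= vnorm v.
Proof.
rewrite -[leLHS]ger0_norm ?cmod_ge0// -sqrtr_sqr ler_wsqrtr// (bigD1 i)//= lerDl.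
by apply: sumr_ge0 => j _; exact: sqr_ge0.
Qed.

(** Both hypotheses of [whitney_mean_le] hold with Lam a multiple of
    y / t^(m + n): the first by averaging [conical_from_below] over a disc, the
    second by [vertical_from_below]. A positive bound [y] replaces the integral
    of S + V because Lam has to be positive. *)
Lemma nontangential_mean_le (m : nat) : (0 < n)%N -> (1 <= m)%N ->
  exists2 K : R, 0 < K & forall (u dtm_u : pt -> C) (grad_u dtm_grad_u : pt -> 'cV[C]_n.+1),
  weak_dt upper m u dtm_u -> weak_grad upper u grad_u ->
  weak_dt_vec upper m grad_u dtm_grad_u ->
  forall (z : pt) (y q : R), 0 < z.2 -> 0 < y ->
  (\int[mux]_(x in disc (1 / 6) z)
     (conical_square (fun w => w.2 ^+ m.+1 * vnorm (dtm_grad_u w))%R x +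
      vertical_square (fun w => w.2 * vnorm (grad_u w))%R x) <= y%:E)%E ->
  0 < q <= 2 * (1 + n.+1%:R^-1) ->
  (((fine (muxt (whitney z)))^-1%:E *
    \int[muxt]_(w in whitney z) ((w.2 ^+ m * cmod (dtm_u w)) `^ q)%:E) `^ q^-1 <=
   (K * y / z.2 ^+ n)%:E)%E.
Proof.
move=> n0 m1; have [K0 K00 HK0] := @whitney_mean_le R n m n0 m1.
(* The factor 2 ^ (m + n + 2) covers the weight of the conical square
   function, the other one the volume of the disc. *)
have [M ME] : exists M : R, M = 2 ^+ (m + n.+2) * (16 * n%:R) ^+ n.
  by exists (2 ^+ (m + n.+2) * (16 * n%:R) ^+ n).
have N0 : 0 < 16 * n%:R :> R by rewrite mulr_gt0// ltr0n.
have N1 : 1 <= 16 * n%:R :> R by rewrite -natrM ler1n muln_gt0.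
have M1 : 1 <= M by rewrite ME mulr_ege1// exprn_ege1// ler1n.
have M0 : 0 < M by exact: lt_le_trans M1.
have discs (t : R) : 0 < t -> 1 / 16 * t <= 1 / 6 * t by move=> ?; lra.
exists (K0 * M); first exact: mulr_gt0.
move=> u dtm_u grad_u dtm_grad_u um gu gum z y q t0 y0 Hy qs.
have lH i : loc_integrable upper (fun z => dtm_grad_u z i 0) by have [] := gum i.
have lG i : loc_integrable upper (fun z => grad_u z i 0) by have [] := gu i.
have mH := measurable_vnorm_upper lH; have mG := measurable_vnorm_upper lG.
have mU := @measurable_upper R n.
have m2 j : measurable_fun upper (fun w : pt => w.2 ^+ j).
  by apply: measurable_funX; apply: measurable_funTS; exact: measurable_snd.
set S := conical_square _ in Hy; set V := vertical_square _ in Hy.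
have mS : measurable_fun setT S.
  by apply: measurable_conical; apply: measurable_funM.
have mV : measurable_fun setT V.
  by apply: measurable_vertical_square; apply: measurable_funM => //; exact: (m2 1%N).
have S0 x : (0 <= S x)%E by exact: conical_ge0.
have V0 x : (0 <= V x)%E by exact: vertical_ge0.
have mD := measurable_disc (1 / 6) z.
have Vy : (\int[mux]_(x in disc (1 / 6) z) V x <= y%:E)%E.
  apply: le_trans Hy; apply: ge0_le_integral => //.
  - exact: measurable_funTS.
  - by apply: measurable_funTS; exact: emeasurable_funD.
  - by move=> x _; rewrite leeDr.
have Sy : (\int[mux]_(x in disc (1 / 16) z) S x <= y%:E)%E.
  apply: le_trans Hy; apply: (@le_trans _ _ (\int[mux]_(x in disc (1 / 6) z) S x)%E).
    apply: ge0_subset_integral => //; first exact: measurable_disc.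
      exact: measurable_funTS.
    by move=> x; rewrite /disc /= => xz; apply: (lt_le_trans xz); rewrite discs// exprn_gt0.
  apply: ge0_le_integral => //.
  - exact: measurable_funTS.
  - by apply: measurable_funTS; exact: emeasurable_funD.
  - by move=> x _; rewrite leeDl.
pose Lam := M * y / (z.2 ^+ m * z.2 ^+ n).
have tj j : 0 < z.2 ^+ j by exact: exprn_gt0.
have Lam0 : 0 < Lam by rewrite divr_gt0 ?mulr_gt0.
set B := drum (1 / 6) (1 / 4) z.
have mB : measurable B by exact: measurable_drum.
have BU : B `<=` upper by apply: drum_upper => //; lra.
rewrite (_ : K0 * M * y / z.2 ^+ n = K0 * z.2 ^+ m * Lam); last first.
  by rewrite /Lam; field; rewrite !gt_eqF.
apply: (HK0 _ _ _ _ um gu gum) => //; last first.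
  apply: (@le_trans _ _ (\int[muxt]_(w in B) (vnorm (grad_u w))%:E)%E).
    apply: ge0_le_integral => //.
    - by move=> w _; rewrite lee_fin cmod_ge0.
    - by apply/measurable_EFinP; apply: measurable_cmod_upper.
    - apply/measurable_EFinP; exact: measurable_funS mU BU mG.
    - by move=> w _; rewrite lee_fin cmod_le_vnorm.
  apply: (@le_trans _ _ (\int[mux]_(x in disc (1 / 6) z) V x)%E).
    by apply: (vertical_from_below t0 mG) => w; exact: sqrtr_ge0.
  apply: (le_trans Vy); rewrite lee_fin.
  rewrite (_ : Lam * z.2 ^+ m.-1 * z.2 ^+ n.+1 = M * y); last first.
    rewrite -mulrA -exprD addnS -addSn prednK// exprD.
    by rewrite /Lam divfK// gt_eqF// mulr_gt0.
  by rewrite ler_peMl// ltW.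
pose r := z.2 / (16 * n%:R).
have r0 : 0 < r ^+ n by rewrite exprn_gt0// divr_gt0.
pose k := z.2 ^+ (2 * m.+1) / (2 ^+ (2 * m.+1 + n.+1) * z.2 ^+ n.+1).
have p2 j : 0 < 2 ^+ j :> R by exact: exprn_gt0.
have k0 : 0 < k by rewrite divr_gt0// mulr_gt0.
set J := (\int[muxt]_(w in _) _)%E.
have J0 : (0 <= J)%E by apply: integral_ge0 => w _; rewrite lee_fin sqr_ge0.
have kJ0 : (0 <= k%:E * J)%E by rewrite mule_ge0// lee_fin ltW.
have aS x : disc (1 / 16) z x -> ((k%:E * J) `^ 2^-1 <= S x)%E.
  exact: conical_from_below.
have a0 : (0 <= (k%:E * J) `^ 2^-1)%E by exact: poweR_ge0.
have ay : ((k%:E * J) `^ 2^-1 <= (y / r ^+ n)%:E)%E.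
  apply: lee_div => //; apply: le_trans Sy.
  apply: (@le_trans _ _ (\int[mux]_(x in disc (1 / 16) z) cst ((k%:E * J) `^ 2^-1) x)%E).
    rewrite integral_cst; last exact: measurable_disc.
    by rewrite muleC lee_wpmul2l//; exact: mux_disc.
  apply: ge0_le_integral => //; first exact: measurable_disc.
  exact: measurable_funTS.
have yr0 : 0 <= y / r ^+ n by rewrite divr_ge0// ltW.
have := sqrte_le kJ0 yr0 ay => /(lee_div k0) HJ.
apply: (@le_trans _ _ ((z.2 ^+ 2)%:E * ((y / r ^+ n) ^+ 2 / k)%:E)%E).
  by apply: lee_wpmul2l => //; rewrite lee_fin ltW.
rewrite -EFinM lee_fin.
have -> : z.2 ^+ 2 * ((y / r ^+ n) ^+ 2 / k) =
    z.2 ^+ n.+1 * (y * (16 * n%:R) ^+ n / (z.2 ^+ m * z.2 ^+ n)) ^+ 2 * 2 ^+ (2 * m.+1 + n.+1).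
  have rE : r ^+ n = z.2 ^+ n / (16 * n%:R) ^+ n by exact: expr_div_n.
  have tE : z.2 ^+ (2 * m.+1) = z.2 ^+ 2 * (z.2 ^+ m) ^+ 2 by rewrite -exprMn -exprS -exprM mulnC.
  have NX : 0 < (16 * n%:R) ^+ n :> R by exact: exprn_gt0.
  rewrite /k rE tE; move: (p2 (2 * m.+1 + n.+1)%N) NX (tj m) (tj n) (tj n.+1).
  move: (2 ^+ _) (_ ^+ n) (z.2 ^+ m) (z.2 ^+ n) (z.2 ^+ n.+1) => a b c d e a0' b0 c0 d0 e0.
  by field; rewrite !gt_eqF.
rewrite -mulrA ler_wpM2l ?(ltW (tj _))// /Lam ME.
have -> : 2 ^+ (m + n.+2) * (16 * n%:R) ^+ n * y / (z.2 ^+ m * z.2 ^+ n) =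
  (y * (16 * n%:R) ^+ n / (z.2 ^+ m * z.2 ^+ n)) * 2 ^+ (m + n.+2) :> R by ring.
rewrite [leRHS]exprMn ler_wpM2l ?sqr_ge0// -exprM.
apply: ler_weXn2l; first by rewrite ler1n.
rewrite mul2n muln2 doubleS doubleD !addSn -!addnS leq_add2l -addnn !addSn !addnS !ltnS.
by rewrite (leq_trans (leq_addr n n)).
Qed.

End nontangential_mean.

(** * A covering lemma *)

Section vitali.
Context {R : realType} {n : nat}.
Local Notation rV := 'rV[R]_n.
Local Notation mux := (lebesgue_rV R n).
Implicit Types (q : rV * R) (L : seq (rV * R)).

Definition qcube q : set rV :=
  [set x | forall i, q.1 0 i - q.2 < x 0 i <= q.1 0 i + q.2].

Lemma qcubeE q : qcube q =
  [set x : rV | forall i, (q.1 - const_mx q.2) 0 i < x 0 i <= (q.1 + const_mx q.2) 0 i].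
Proof. by apply/seteqP; split=> x xq i; have := xq i; rewrite !mxE. Qed.

Lemma measurable_qcube q : measurable (qcube q).
Proof. by rewrite qcubeE; exact: measurable_rV_box. Qed.

Lemma mux_qcube q : 0 <= q.2 -> mux (qcube q) = ((2 * q.2) ^+ n)%:E.
Proof.
move=> t0; rewrite qcubeE lebesgue_rV_box; last by move=> i; rewrite !mxE; lra.
rewrite (eq_bigr (fun=> 2 * q.2)); last by move=> i _; rewrite !mxE; ring.
by rewrite prodr_const card_ord.
Qed.

Lemma qcube_sub q q' x : q.2 <= q'.2 -> qcube q x -> qcube q' x ->
  qcube q `<=` qcube (q'.1, 3 * q'.2).
Proof.
move=> tt' xq xq' w wq i; have /andP[? ?] := xq i; have /andP[? ?] := xq' i.
by have /andP[? ?] := wq i; apply/andP; split=> /=; lra.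
Qed.

Definition cubes L : set rV := [set x | exists2 q, q \in L & qcube q x].

Lemma measurable_cubes L : measurable (cubes L).
Proof.
elim: L => [|q L IH].
  by rewrite (_ : cubes [::] = set0)//; apply/seteqP; split=> x // -[].
rewrite (_ : cubes _ = qcube q `|` cubes L).
  by apply: measurableU => //; exact: measurable_qcube.
apply/seteqP; split=> x.
  by move=> [q']; rewrite inE => /predU1P[-> xq|q'L xq]; [left|right; exists q'].
move=> [xq|[q' q'L xq]]; first by exists q => //; rewrite mem_head.
by exists q' => //; rewrite inE q'L orbT.
Qed.

Lemma largest_cube L q0 : q0 \in L ->
  exists2 q, q \in L & forall q', q' \in L -> q'.2 <= q.2.
Proof.
elim: L q0 => // q L IH q0 _; have [L0|[q1 q1L]] : L = [::] \/ exists q1, q1 \in L.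
- by case: (L) => [|a b]; [left|right; exists a; rewrite mem_head].
- by exists q; rewrite ?mem_head// L0 => q'; rewrite inE => /eqP ->.
have [q2 q2L H] := IH _ q1L; have [q2q|qq2] := leP q2.2 q.2.
  exists q; first by rewrite mem_head.
  by move=> q'; rewrite inE => /predU1P[->//|/H q'2]; exact: le_trans q2q.
exists q2; first by rewrite inE q2L orbT.
by move=> q'; rewrite inE => /predU1P[->|/H//]; exact: ltW.
Qed.

(** Keep the largest cube, drop those that meet it, which are inside its
    triple, and go on with the others. *)
Lemma vitali_cubes (g : rV -> \bar R) (A : R) L :
  measurable_fun setT g -> (forall x, 0 <= g x)%E -> 0 <= A ->
  (forall q, q \in L -> 0 < q.2 /\
     ((q.2 ^+ n)%:E <= A%:E * \int[mux]_(x in qcube q) g x)%E) ->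
  (mux (cubes L) <= (6 ^+ n * A)%:E * \int[mux]_(x in cubes L) g x)%E.
Proof.
move=> mg g0 A0; have [k] := ubnP (size L); elim: k L => // k IH L.
rewrite ltnS => Lk HL.
have int0 D : (0 <= \int[mux]_(x in D) g x)%E by exact: integral_ge0.
have A60 : 0 <= 6 ^+ n * A by rewrite mulr_ge0// exprn_ge0.
have [L0|[q0 q0L]] : L = [::] \/ exists q1, q1 \in L.
  by case: (L) => [|a b]; [left|right; exists a; rewrite mem_head].
  rewrite (_ : cubes L = set0) ?measure0 ?mule_ge0 ?lee_fin//.
  by rewrite L0; apply/seteqP; split=> x // -[].
have [q qL qmax] := largest_cube q0L; have [t0 qA] := HL q qL.
pose P q' := ~~ `[< exists x, qcube q' x /\ qcube q x >].
pose L' := [seq q' <- L | P q'].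
have qq : qcube q q.1 by move=> i; apply/andP; split; lra.
have L'L : (size L' < size L)%N.
  rewrite size_filter ltn_neqAle count_size andbT -all_count.
  apply/negP => /allP /(_ q qL); rewrite /P => /negP; apply.
  by apply/asboolP; exists q.1.
have sub' : cubes L `<=` qcube (q.1, 3 * q.2) `|` cubes L'.
  move=> x [q' q'L xq']; have [Pq'|] := boolP (P q').
    by right; exists q' => //; rewrite mem_filter Pq'.
  rewrite negbK => /asboolP[w [wq' wq]]; left.
  exact: (qcube_sub (qmax _ q'L) wq' wq).
have mQ := measurable_qcube; have mL := measurable_cubes.
have HL' := IH L' (leq_trans L'L Lk).
have {}HL' : (mux (cubes L') <= (6 ^+ n * A)%:E * \int[mux]_(x in cubes L') g x)%E.
  by apply: HL' => q'; rewrite mem_filter => /andP[_]; exact: HL.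
have disj : [disjoint qcube q & cubes L'].
  apply/disj_setPS => x [xq [q']]; rewrite mem_filter => /andP[Pq' _] xq'.
  by move/negP: Pq'; apply; apply/asboolP; exists x.
apply: (@le_trans _ _ (mux (qcube (q.1, 3 * q.2)%R) + mux (cubes L'))%E).
  apply: (@le_trans _ _ (mux (qcube (q.1, 3 * q.2)%R `|` cubes L'))); last exact: measureU2.
  by apply: le_measure; rewrite ?inE//; exact: measurableU.
rewrite mux_qcube; last by rewrite mulr_ge0// ltW.
apply: (@le_trans _ _ ((6 ^+ n * A)%:E * \int[mux]_(x in qcube q) g x +
   (6 ^+ n * A)%:E * \int[mux]_(x in cubes L') g x)%E).
  apply: leeD => //=; rewrite (_ : 2 * (3 * q.2) = 6 * q.2); last by ring.
  rewrite exprMn !EFinM -muleA; by apply: lee_wpmul2l.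
rewrite -ge0_muleDr// -ge0_integral_setU//; last exact: measurable_funTS.
apply: lee_wpmul2l; first by rewrite lee_fin.
apply: ge0_subset_integral => //; [exact: measurableU|exact: measurable_funTS|].
move=> x [xq|[q']]; first by exists q.
by rewrite mem_filter => /andP[_ q'L] xq'; exists q'.
Qed.

End vitali.

(** * A weak-type bound *)

Section weak_type.
Context {R : realType} {n : nat}.
Local Notation rV := 'rV[R]_n.
Local Notation pt := ('rV[R]_n * measurableTypeR R)%type.
Local Notation mux := (lebesgue_rV R n).
Implicit Types (z : pt) (x w : rV).

(** A countable family of cubes: it makes unions of uncountably many discs
    measurable and exhausts them by finite unions. *)
Definition grid (kj : {ffun 'I_n -> int} * nat) : set rV :=
  [set x | forall i, (kj.1 i)%:~R / kj.2.+1%:R < x 0 i <= ((kj.1 i)%:~R + 1) / kj.2.+1%:R].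

Lemma measurable_grid kj : measurable (grid kj).
Proof.
rewrite (_ : grid kj = [set x : rV | forall i,
  (\row_i ((kj.1 i)%:~R / kj.2.+1%:R) : rV) 0 i < x 0 i <=
  (\row_i (((kj.1 i)%:~R + 1) / kj.2.+1%:R) : rV) 0 i]).
  exact: measurable_rV_box.
by apply/seteqP; split=> x xk i; have := xk i; rewrite !mxE.
Qed.

Lemma coord_lt z x r : 0 < r -> \sum_(i < n) (x 0 i - z.1 0 i) ^+ 2 < r ^+ 2 ->
  forall i, `|x 0 i - z.1 0 i| < r.
Proof.
move=> r0 xr i; rewrite -(@ltr_pXn2r _ 2)// ?nnegrE//; last exact: ltW.
rewrite real_normK ?num_real//; apply: le_lt_trans xr.
by rewrite (bigD1 i)//= lerDl sumr_ge0// => j _; exact: sqr_ge0.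
Qed.

Lemma coneE z x : cone x z <-> 0 < z.2 /\ \sum_(i < n) (x 0 i - z.1 0 i) ^+ 2 < z.2 ^+ 2.
Proof.
rewrite /cone /=; split=> -[t0]; rewrite enorm_lt// => H; split=> //;
  by apply: le_lt_trans H; rewrite le_eqVlt; apply/orP; left; apply/eqP; apply: eq_bigr => i _; rewrite !mxE.
Qed.

Lemma cone_grid z x : cone x z -> exists kj, grid kj x /\ grid kj `<=` [set w | cone w z].
Proof.
move=> /coneE[t0 xz]; set S := \sum_(i < n) _ in xz.
have xzi := coord_lt t0 xz.
pose c := n%:R * (2 * z.2 + 1) / (z.2 ^+ 2 - S).
have S0 : 0 < z.2 ^+ 2 - S by rewrite subr_gt0.
have c0 : 0 <= c.
  by apply: divr_ge0; [rewrite mulr_ge0// addr_ge0// mulr_ge0// ltW|exact: ltW].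
pose j := Num.bound c; have cj : c < j.+1%:R.
  by apply: (lt_le_trans (archi_boundP c0)); rewrite ler_nat.
have [dl dlE] : exists dl : R, dl = j.+1%:R^-1 by exists (j.+1%:R^-1).
have dl0 : 0 < dl by rewrite dlE invr_gt0.
have dl1 : dl <= 1 by rewrite dlE invf_le1// ler1n.
have dlc : n%:R * (2 * z.2 * dl + dl ^+ 2) < z.2 ^+ 2 - S.
  apply: (@le_lt_trans _ _ (c * dl * (z.2 ^+ 2 - S))).
    rewrite (_ : c * dl * _ = n%:R * (2 * z.2 * dl + dl)); last by rewrite /c; field; rewrite gt_eqF.
    by rewrite ler_wpM2l// lerD2l expr2 ler_piMl// ltW.
  by rewrite gtr_pMl// dlE ltr_pdivrMr ?mul1r.
exists ([ffun i => Num.ceil (x 0 i * j.+1%:R) - 1], j); split.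
  move=> i /=; rewrite ffunE ltr_pdivrMr// ler_pdivlMr//.
  rewrite -[X in _ && (_ <= _ + X)](_ : 1%:~R = 1)// -intrD subrK; exact: ceil_itv.
have close w : grid ([ffun i => Num.ceil (x 0 i * j.+1%:R) - 1], j) w -> forall i, `|w 0 i - x 0 i| <= dl.
  move=> wk i; have := wk i; rewrite /= ffunE -dlE.
  have := ceil_itv (x 0 i * j.+1%:R); set k := (_ - 1)%:~R.
  have -> : (Num.ceil (x 0 i * j.+1%:R))%:~R = k + 1 :> R by rewrite /k -[1 in RHS](_ : 1%:~R = 1)// -intrD subrK.
  rewrite -ltr_pdivrMr// -ler_pdivlMr// -dlE mulrDl mul1r => /andP[? ?] /andP[? ?].
  by rewrite ler_norml; apply/andP; split; lra.
move=> w /close wx; apply/coneE; split=> //.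
apply: (@le_lt_trans _ _ (S + n%:R * (2 * z.2 * dl + dl ^+ 2))); last by rewrite -ltrBrDl.
have -> : n%:R * (2 * z.2 * dl + dl ^+ 2) = \sum_(i < n) (2 * z.2 * dl + dl ^+ 2).
  by rewrite sumr_const card_ord mulr_natl.
rewrite -big_split /=; apply: ler_sum => i _.
set a := x 0 i - z.1 0 i; set b := w 0 i - x 0 i.
rewrite (_ : w 0 i - z.1 0 i = a + b); last by rewrite /a /b; ring.
rewrite sqrrD -addrA lerD2l -mulrA mulr_natl; apply: lerD.
  rewrite lerMn2r/=; apply: (le_trans (ler_norm _)); rewrite normrM.
  by apply: ler_pM => //; [exact/ltW/xzi|exact: wx].
by rewrite -[leLHS]real_normK ?num_real// lerXn2r ?nnegrE ?(ltW dl0)//; exact: wx.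
Qed.

Lemma cone_qcube z : [set w | cone w z] `<=` qcube z.
Proof.
move=> w /coneE[t0 /(coord_lt t0)] H i; have := H i.
by rewrite ltr_norml => /andP[? ?]; apply/andP; split; lra.
Qed.

Section cones_over.
Variable Z : set pt.

Definition shadow : set rV := [set x | exists2 z, Z z & cone x z].

Let P (N : nat) : set rV :=
  if unpickle N is Some kj then
    if `[< exists2 z, Z z & 0 < z.2 /\ grid kj `<=` [set w | cone w z] >] then grid kj else set0
  else set0.

Let mP N : measurable (P N).
Proof.
rewrite /P; case: unpickle => // kj; case: ifP => // _; exact: measurable_grid.
Qed.

Let shadowE : shadow = \bigcup_N P N.
Proof.
apply/seteqP; split=> x.
  move=> [z Zz xz]; have [kj [kx ksub]] := cone_grid xz.
  exists (pickle kj) => //; rewrite /P pickleK ifT//.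
  by apply/asboolP; exists z => //; split=> //; case: xz.
move=> [N _]; rewrite /P; case: unpickle => // kj; case: ifPn => // /asboolP[z Zz [_ H]].
by move=> /H xz; exists z.
Qed.

(** Each grid cube inside some disc selects one such disc. Finitely many of
    them are handled by [vitali_cubes], and continuity from below concludes. *)
Lemma shadow_le (g : rV -> \bar R) (A : R) :
  measurable_fun setT g -> (forall x, 0 <= g x)%E -> 0 <= A ->
  (forall z, Z z -> 0 < z.2 -> ((z.2 ^+ n)%:E <= A%:E * \int[mux]_(x in qcube z) g x)%E) ->
  (mux shadow <= (6 ^+ n * A)%:E * \int[mux]_x g x)%E.
Proof.
move=> mg g0 A0 HZ.
have /choice[sel Ho] : forall N, exists oz : option pt,
    if oz is Some z then [/\ Z z, 0 < z.2 & P N `<=` qcube z] else P N = set0.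
  move=> N; rewrite /P; case: unpickle => [kj|]; last by exists None.
  case: ifPn => [/asboolP[z Zz [z0 H]]|_]; last by exists None.
  by exists (Some z); split=> //; apply: subset_trans H _; exact: cone_qcube.
pose F N : set rV := \bigcup_(k in [set k | (k < N)%N]) P k.
have mF N : measurable (F N) by apply: bigcup_measurable => k _; exact: mP.
have FE : \bigcup_N F N = shadow.
  rewrite shadowE; apply/seteqP; split=> x.
    by move=> [N _ [k _ Pk]]; exists k.
  by move=> [N _ PN]; exists N.+1 => //; exists N => /=.
have Fle N : (mux (F N) <= (6 ^+ n * A)%:E * \int[mux]_x g x)%E.
  pose L := pmap sel (iota 0 N).
  have LZ z : z \in L -> Z z /\ 0 < z.2.
    by rewrite mem_pmap => /mapP[k _ zk]; have := Ho k; rewrite -zk => -[].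
  apply: (@le_trans _ _ (mux (cubes L))).
    apply: le_measure; rewrite ?inE//; first exact: measurable_cubes.
    move=> x [k kN Pk]; have := Ho k; case ok : (sel k) => [z|] Hz; last by rewrite Hz in Pk.
    case: Hz => _ _ H; exists z; last exact: H.
    by rewrite mem_pmap -ok; apply/mapP; exists k => //; rewrite mem_iota.
  apply: (le_trans (vitali_cubes mg g0 A0 _)).
    by move=> z /LZ[Zz z0]; split=> //; exact: HZ.
  apply: lee_wpmul2l; first by rewrite lee_fin mulr_ge0// exprn_ge0.
  by apply: ge0_subset_integral => //; exact: measurable_cubes.
rewrite -FE; have ndF : {homo F : N M / (N <= M)%N >-> (N <= M)%O}.
  move=> N M NM; apply/subsetPset => x [k kN Pk]; exists k => //=.
  exact: leq_trans NM.
have cF := nondecreasing_cvg_mu (mu := mux) mF (bigcup_measurable (fun N _ => mF N)) ndF.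
rewrite -(cvg_lim _ cF)//; apply: lime_le; first by apply/cvg_ex; eexists; exact: cF.
by apply: nearW => N; exact: Fle.
Qed.

End cones_over.

(** It turns a lower bound on an integral of G over a cube into one on the
    integral of G^p. *)
Lemma le_power_split (G : \bar R) (sg p : R) : 0 < sg -> 1 < p -> (0 <= G)%E ->
  (G <= sg%:E + (sg `^ (1 - p))%:E * G `^ p)%E.
Proof.
move=> sg0 p1; have p0 : 0 < p by exact: lt_trans p1.
have c0 : 0 < sg `^ (1 - p) by exact: powR_gt0.
case: G => [x||]//; last first.
  by move=> _; rewrite poweRyr ?gt_eqF// gt0_muley ?lte_fin// addey// leey.
rewrite poweR_EFin -EFinM -EFinD !lee_fin => x0.
have [xs|sx] := leP x sg; first by rewrite (le_trans xs)// lerDl mulr_ge0// powR_ge0.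
have xpos : 0 < x by exact: lt_trans sx.
rewrite (@le_trans _ _ (sg `^ (1 - p) * x `^ p))//; last by rewrite lerDr ltW.
rewrite -[leLHS]powRr1 ?(ltW xpos)// -[in leLHS](subrK p 1) powRD; last first.
  by apply/implyP => _; rewrite gt_eqF.
rewrite ler_wpM2r ?powR_ge0//.
rewrite -(opprB p) !powRN lef_pV2 ?posrE ?powR_gt0//.
by apply: ge0_ler_powR; rewrite ?nnegrE ?subr_ge0 ?(ltW p1) ?(ltW sg0) ?(ltW sx) ?(ltW xpos).
Qed.

(** At a point [z] with a(z) > s the integral of [G] over the cube exceeds
    s t^n / K = 2 B, where B = sg (2 t)^n with sg = s / (2^(n + 1) K). The
    part sg of [le_power_split] contributes B, so the part with G^p
    contributes at least B, that is t^n <= sg^-p times the integral of G^p. *)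
Lemma weak_type_bound (p K s : R) (G : rV -> \bar R) (a : pt -> \bar R) :
  1 < p -> 0 < K -> 0 < s ->
  measurable_fun setT G -> (forall x, 0 <= G x)%E ->
  (forall z y, 0 < z.2 -> 0 < y -> (\int[mux]_(x in disc (1 / 6) z) G x <= y%:E)%E ->
     (a z <= (K * y / z.2 ^+ n)%:E)%E) ->
  (mux [set x | s%:E < ereal_sup [set a z | z in cone x]] <=
   (6 ^+ n * (s / (2 ^+ n.+1 * K)) `^ (- p))%:E * \int[mux]_x (G x `^ p))%E.
Proof.
move=> p1 K0 s0 mG G0 Ha.
have [sg sgE] : exists sg, sg = s / (2 ^+ n.+1 * K) by exists (s / (2 ^+ n.+1 * K)).
have p2 j : 0 < 2 ^+ j :> R by exact: exprn_gt0.
have sg0 : 0 < sg by rewrite sgE divr_gt0// mulr_gt0.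
have sE : s = 2 * sg * 2 ^+ n * K.
  by rewrite sgE exprS; field; rewrite !gt_eqF.
rewrite -sgE.
pose Z : set pt := [set z | (s%:E < a z)%E].
rewrite (_ : [set x | _] = shadow Z); last first.
  apply/seteqP; split=> x /=; first by move=> /ereal_sup_gt[_ [z xz <-] saz]; exists z.
  by move=> [z Zz xz]; apply: (lt_le_trans Zz); apply: ereal_sup_ubound; exists z.
have mGp : measurable_fun setT (fun x => (G x `^ p)%E).
  exact: (measurableT_comp (measurable_poweR _)).
apply: shadow_le => //; [by move=> x; exact: poweR_ge0|exact: powR_ge0|].
move=> z Zz t0; pose B := sg * (2 * z.2) ^+ n.
have t20 : 0 < (2 * z.2) ^+ n by rewrite exprn_gt0// mulr_gt0.
have B0 : 0 < B by exact: mulr_gt0.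
have mQ := measurable_qcube z.
have discQ : disc (1 / 6) z `<=` qcube z.
  move=> x xz; apply: cone_qcube; apply/coneE; split=> //.
  apply: (lt_trans xz); rewrite gtr_pMl ?exprn_gt0//; lra.
have big : ((2 * B)%:E < \int[mux]_(x in qcube z) G x)%E.
  rewrite ltNge; apply/negP => H; move: Zz; rewrite /Z /= ltNge => /negP; apply.
  have B20 : 0 < 2 * B by rewrite mulr_gt0.
  have -> : s = K * (2 * B) / z.2 ^+ n.
    by rewrite sE /B exprMn; field; rewrite gt_eqF// exprn_gt0.
  apply: Ha => //; apply: le_trans H; apply: ge0_subset_integral => //.
    exact: measurable_disc.
  exact: measurable_funTS.
set I := (\int[mux]_(x in qcube z) (G x `^ p))%E.
have I0 : (0 <= I)%E by apply: integral_ge0 => x _; exact: poweR_ge0.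
pose c := sg `^ (1 - p); have c0 : 0 < c by exact: powR_gt0.
have split_int : (\int[mux]_(x in qcube z) G x <= B%:E + c%:E * I)%E.
  have -> : (B%:E = \int[mux]_(x in qcube z) cst sg%:E x)%E.
    by rewrite integral_cst// mux_qcube ?(ltW t0)// -EFinM.
  rewrite -ge0_integralZl_EFin//; last 3 first.
  - by move=> x _; exact: poweR_ge0.
  - exact: measurable_funTS.
  - exact: ltW.
  rewrite -ge0_integralD//; last 3 first.
  - by move=> x _; rewrite lee_fin ltW.
  - by move=> x _; rewrite mule_ge0// ?lee_fin ?(ltW c0)// poweR_ge0.
  - by apply: measurable_funeM; exact: measurable_funTS.
  apply: ge0_le_integral => //.
  - exact: measurable_funTS.
  - apply: emeasurable_funD => //; apply: measurable_funeM; exact: measurable_funTS.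
  - by move=> x _; exact: le_power_split.
have BI : (B%:E <= c%:E * I)%E.
  have := lt_le_trans big split_int; move: I0; case: (I) => [r||]//.
    by rewrite -EFinM -EFinD lte_fin !lee_fin => _ ?; lra.
  by move=> _ _; rewrite gt0_muley ?lte_fin// leey.
apply: (@le_trans _ _ (sg^-1%:E * B%:E)%E).
  rewrite -EFinM lee_fin /B mulrA mulVf ?gt_eqF// mul1r lerXn2r ?nnegrE ?mulr_ge0 ?(ltW t0)//.
  by rewrite ler_peMl ?(ltW t0)// ler1n.
apply: (@le_trans _ _ (sg^-1%:E * (c%:E * I))%E).
  by apply: lee_wpmul2l => //; rewrite lee_fin invr_ge0 ltW.
rewrite muleA -EFinM /c -powR_inv1 ?(ltW sg0)// -powRD; last by apply/implyP => _; rewrite gt_eqF.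
by rewrite addrA addNr add0r.
Qed.

End weak_type.

(** * The weak norm of the nontangential maximal function *)

Section summation.
Context {R : realType}.

Lemma poweR_add_le (p : R) (a b : \bar R) : 0 < p -> (0 <= a -> 0 <= b ->
  (a + b) `^ p <= (2 `^ p)%:E * (a `^ p + b `^ p))%E.
Proof.
move=> p0; have c0 : 0 < 2 `^ p :> R by exact: powR_gt0.
case: a => [a||]// a0; case: b => [b||]// b0; last 3 first.
- rewrite [X in (_ <= _ * (_ + X))%E]poweRyr ?gt_eqF// addey //.
  by rewrite gt0_muley ?lte_fin// leey.
- rewrite [X in (_ <= _ * (X + _))%E]poweRyr ?gt_eqF// addye //.
  by rewrite gt0_muley ?lte_fin// leey.
- by rewrite !addye// poweRyr ?gt_eqF// addye// gt0_muley ?lte_fin// leey.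
rewrite -EFinD !poweR_EFin -EFinD -EFinM lee_fin; rewrite !lee_fin in a0 b0.
rewrite (_ : a + b = 2 * ((a + b) / 2)); last by field.
rewrite powRM// ?divr_ge0 ?addr_ge0// ler_wpM2l ?powR_ge0//.
exact: powR_mean_le (ltW p0).
Qed.

End summation.

Section main.
Context {R : realType} {n : nat}.
Local Notation C := R[i].
Local Notation pt := ('rV[R]_n * measurableTypeR R)%type.
Local Notation mux := (lebesgue_rV R n).

Lemma integral_Lp_norm (p a : R) (f : 'rV[R]_n -> \bar R) : 0 < p ->
  (forall x, 0 <= f x)%E -> Lp_norm p f = a%:E ->
  (\int[mux]_x (f x `^ p))%E = (a `^ p)%:E.
Proof.
move=> p0 f0; rewrite /Lp_norm unlock => fa.
have -> : (\int[mux]_x (f x `^ p) = \int[mux]_x (`|f x| `^ p))%E.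
  by apply: eq_integral => x _; rewrite gee0_abs.
rewrite -poweR_EFin -fa -poweRrM mulVf ?gt_eqF// poweRe1//.
by apply: integral_ge0 => x _; exact: poweR_ge0.
Qed.

Lemma nontangential_max_ge0 (q : R) (F : pt -> R) x :
  (0 <= nontangential_max q F x)%E.
Proof.
rewrite /nontangential_max; set Y := (X in ereal_sup X).
have Yx : Y ((((fine (lebesgue_xt R n (whitney (x, 1))))^-1%:E *
       \int[lebesgue_xt R n]_(w in whitney (x, 1%R)) (F w `^ q)%:E) `^ q^-1)%E).
  exists (x, 1) => //; split=> //=; rewrite enorm_lt// big1 ?expr1n// => i _.
  by rewrite !mxE subrr expr0n.
by apply: le_trans (ereal_sup_ubound Yx); exact: poweR_ge0.
Qed.

(** The constant collects (a + b)^p <= 2^p (a^p + b^p), used pointwise, and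
    a^p + b^p <= 2 (a + b)^p, used for the norms, where S and V have norms a
    and b. *)
Lemma weak_Lp_bound (p K : R) (N S V : 'rV[R]_n -> \bar R) : 1 < p -> 0 < K ->
  measurable_fun setT S -> measurable_fun setT V ->
  (forall x, 0 <= S x)%E -> (forall x, 0 <= V x)%E -> (forall x, 0 <= N x)%E ->
  (forall s : R, 0 < s -> (mux [set x | (s%:E < N x)%E] <=
     (6 ^+ n * (s / K) `^ (- p))%:E * \int[mux]_x ((S x + V x) `^ p))%E) ->
  (weak_Lp_norm p N <= (K * (6 ^+ n * 2 `^ p * 2) `^ p^-1)%:E * (Lp_norm p S + Lp_norm p V))%E.
Proof.
move=> p1 K0 mS mV S0 V0 N0 HN; have p0 : 0 < p by exact: lt_trans p1.
have X0 : 0 < 6 ^+ n * 2 `^ p * 2 :> R by rewrite !mulr_gt0 ?exprn_gt0 ?powR_gt0.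
have C0 : 0 < K * (6 ^+ n * 2 `^ p * 2) `^ p^-1 by rewrite mulr_gt0// powR_gt0.
have nS : (0 <= Lp_norm p S)%E by exact: Lnorm_ge0.
have nV : (0 <= Lp_norm p V)%E by exact: Lnorm_ge0.
have [oo|fin] := eqVneq (Lp_norm p S + Lp_norm p V)%E +oo%E.
  by rewrite oo gt0_muley ?lte_fin// leey.
have [a a0 aE] : exists2 a : R, 0 <= a & Lp_norm p S = a%:E.
  move: nS fin; case: (Lp_norm p S) => [a||]//; first by rewrite lee_fin; exists a.
  by move=> _; rewrite addye ?eqxx// gt_eqF// (lt_le_trans _ nV).
have [b b0 bE] : exists2 b : R, 0 <= b & Lp_norm p V = b%:E.
  move: nV fin; case: (Lp_norm p V) => [b||]//; first by rewrite lee_fin; exists b.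
  by rewrite aE.
have mpow (f : 'rV[R]_n -> \bar R) : measurable_fun setT f ->
  measurable_fun setT (fun x => (f x `^ p)%E).
  by move=> mf; exact: (measurableT_comp (measurable_poweR _)).
have GA : (\int[mux]_x ((S x + V x) `^ p) <= (2 `^ p * 2 * (a + b) `^ p)%:E)%E.
  apply: (@le_trans _ _ (\int[mux]_x ((2 `^ p)%:E * (S x `^ p + V x `^ p)))%E).
    apply: ge0_le_integral => //.
    - by move=> x _; exact: poweR_ge0.
    - by apply: mpow; exact: emeasurable_funD.
    - by apply: measurable_funeM; apply: emeasurable_funD; exact: mpow.
    - by move=> x _; exact: poweR_add_le.
  rewrite ge0_integralZl_EFin ?powR_ge0//; last 2 first.
  - by move=> x _; rewrite adde_ge0// poweR_ge0.
  - by apply: emeasurable_funD; exact: mpow.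
  rewrite ge0_integralD//; last 4 first.
  - by move=> x _; exact: poweR_ge0.
  - exact: mpow.
  - by move=> x _; exact: poweR_ge0.
  - exact: mpow.
  rewrite (integral_Lp_norm p0 S0 aE) (integral_Lp_norm p0 V0 bE).
  rewrite -EFinD -EFinM lee_fin -mulrA ler_wpM2l ?powR_ge0// mulrDl mul1r.
  by apply: lerD; apply: ge0_ler_powR; rewrite ?nnegrE ?addr_ge0 ?(ltW p0)//; lra.
apply: ub_ereal_sup => _ [s s0 <-]; have {}s0 : 0 < s by exact: s0.
have -> : [set x | (s%:E < `|N x|)%E] = [set x | (s%:E < N x)%E].
  by apply/seteqP; split=> x /=; rewrite gee0_abs.
rewrite aE bE -EFinD -EFinM.
have sK : 0 < s / K by exact: divr_gt0.
have HE : (mux [set x | s%:E < N x] <=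
    (6 ^+ n * 2 `^ p * 2 * (s / K) `^ (- p) * (a + b) `^ p)%:E)%E.
  apply: (le_trans (HN s s0)).
  apply: (@le_trans _ _ ((6 ^+ n * (s / K) `^ (- p))%:E * (2 `^ p * 2 * (a + b) `^ p)%:E)%E).
    by apply: lee_wpmul2l => //; rewrite lee_fin mulr_ge0 ?exprn_ge0 ?powR_ge0.
  by rewrite -EFinM lee_fin le_eqVlt; apply/orP; left; apply/eqP; ring.
apply: (@le_trans _ _ (s%:E * ((6 ^+ n * 2 `^ p * 2 * (s / K) `^ (- p) * (a + b) `^ p)%:E `^ p^-1))%E).
  apply: lee_wpmul2l; first by rewrite lee_fin ltW.
  by apply: lee_poweR => //; rewrite invr_ge0 ltW.
rewrite poweR_EFin -EFinM lee_fin powRM ?powR_ge0//; last first.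
  by rewrite mulr_ge0 ?powR_ge0 ?(ltW X0).
rewrite powRM ?powR_ge0 ?(ltW X0)// -!powRrM mulfV ?gt_eqF// mulNr mulfV ?gt_eqF//.
rewrite powRr1 ?addr_ge0// powR_inv1 ?(ltW sK)// invf_div le_eqVlt.
apply/orP; left; apply/eqP; field; rewrite gt_eqF//.
Qed.

End main.

Theorem lemma5p2 (R : realType) (n : nat) (hn : (3 <= n)%N)
    (lam rho : R) (hlam : 0 < lam) (hrho : 0 < rho)
    (hthreshold : @smallness_threshold R n lam rho) :
  exists (m6 : nat) (eps6 : R), 0 < eps6 /\
  forall (m : nat) (p : R), (m6 <= m)%N -> 2 - eps6 < p < 2 + eps6 ->
  exists K : R,
  forall (A : 'rV[R]_n -> 'M[complex R]_n.+1)
    (B1 B2 : 'rV[R]_n -> 'cV[complex R]_n.+1)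
    (f : 'rV[R]_n -> complex R)
    (u : 'rV[R]_n * R -> complex R),
  coefficients lam rho A B1 B2 ->
  Cc_smooth f ->
  (exists s ds, single_layer A B1 B2 f s ds /\ weak_dt upper 1 s u) \/
    double_layer A B1 B2 f u ->
  forall (dtm_u : 'rV[R]_n * R -> complex R)
    (grad_u dtm_grad_u : 'rV[R]_n * R -> 'cV[complex R]_n.+1),
  weak_dt upper m u dtm_u ->
  weak_grad upper u grad_u ->
  weak_dt_vec upper m grad_u dtm_grad_u ->
  forall q : R, 0 < q < p ->
  (weak_Lp_norm p (nontangential_max q
     (fun z => (z.2 ^+ m * cmod (dtm_u z))%R)) <=
   K%:E *
   (Lp_norm p (conical_square
      (fun z => (z.2 ^+ m.+1 * vnorm (dtm_grad_u z))%R)) +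
    Lp_norm p (vertical_square
      (fun z => (z.2 * vnorm (grad_u z))%R))))%E.
Proof.
exists 1%N, (2 / n.+1%:R); split; first by rewrite divr_gt0.
move=> m p m1 /andP[p_lo p_hi].
have n0 : (0 < n)%N by exact: leq_trans hn.
have p1 : 1 < p.
  apply: le_lt_trans p_lo; rewrite lerBrDr -lerBrDl ler_pdivrMr//.
  have : 4 <= n.+1%:R :> R by rewrite ler_nat.
  lra.
have [K0 K00 HK0] := @nontangential_mean_le R n m n0 m1.
have K10 : 0 < 2 ^+ n.+1 * K0 by rewrite mulr_gt0// exprn_gt0.
exists (2 ^+ n.+1 * K0 * (6 ^+ n * 2 `^ p * 2) `^ p^-1).
move=> A B1 B2 f u _ _ _ dtm_u grad_u dtm_grad_u um gu gum q /andP[q0 qp].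
have lH i : loc_integrable upper (fun z => dtm_grad_u z i 0) by have [] := gum i.
have lG i : loc_integrable upper (fun z => grad_u z i 0) by have [] := gu i.
have mH := measurable_vnorm_upper lH; have mG := measurable_vnorm_upper lG.
have m2 j : measurable_fun upper (fun w : 'rV[R]_n * measurableTypeR R => w.2 ^+ j).
  by apply: measurable_funX; apply: measurable_funTS; exact: measurable_snd.
have mS : measurable_fun setT (conical_square
    (fun z : 'rV[R]_n * measurableTypeR R => z.2 ^+ m.+1 * vnorm (dtm_grad_u z))).
  by apply: measurable_conical; apply: measurable_funM.
have mV : measurable_fun setT (vertical_square
    (fun z : 'rV[R]_n * measurableTypeR R => z.2 * vnorm (grad_u z))).
  by apply: measurable_vertical_square; apply: measurable_funM => //; exact: (m2 1%N).
apply: weak_Lp_bound => // [x|x|x|s s0]; [exact: conical_ge0|exact: vertical_ge0|exact: nontangential_max_ge0|].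
apply: weak_type_bound => //; first exact: emeasurable_funD.
  by move=> x; rewrite adde_ge0 ?conical_ge0 ?vertical_ge0.
move=> z y t0 y0 Hy; apply: (HK0 u dtm_u grad_u dtm_grad_u) => //.
rewrite q0 /= (le_trans (ltW qp))// (le_trans (ltW p_hi))// mulrDr mulr1.
by [].
Qed.
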